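(* Let $n=1$ and let $R(x)=\dfrac{3^{1/4}}{\sqrt{\cosh(2x\sqrt2)}}$, the unique solution (up to translation and sign change) of $-\frac12R''+R=R^5$. For $t_*\in\mathbb R$, let $f(x)=R(x)e^{i\frac{t_*}{2}x^2}$ and $$\tilde v^\varepsilon(t,x)=\frac{1}{\sqrt{\frac\pi2+\varepsilon t_*-t}}\,R\left(\frac{x}{\frac\pi2+\varepsilon t_*-t}\right)e^{i\frac{\varepsilon}{\pi/2+\varepsilon t_*-t}}\,e^{i\frac{x^2}{2\varepsilon(t-\pi/2-\varepsilon t_* )}} .$$ Let $u^\varepsilon$ be the solution of $$i\varepsilon\partial_tu^\varepsilon+\tfrac12\varepsilon^2\partial_x^2u^\varepsilon=\tfrac{x^2}{2}u^\varepsilon-\varepsilon^2|u^\varepsilon|^4u^\varepsilon,\qquad u^\varepsilon|_{t=0}=f .$$ Then for any $\lambda>0$, $$\limsup_{\varepsilon\to0}\ \sup_{\frac\pi2-\Lambda\varepsilon\le t\le\frac\pi2+\varepsilon t_*-\lambda\varepsilon}\left\|B^\varepsilon(t)\left(u^\varepsilon(t)-\tilde v^\varepsilon(t)\right)\right\|_{L^2}\ \longrightarrow\ 0\quad\text{as }\Lambda\to+\infty,$$ where $B^\varepsilon(t)$ is any of the operators $\mathrm{Id}$, $\varepsilon\partial_x$, or $\frac x\varepsilon+i\left(t-\frac\pi2\right)\partial_x$. In particular, $$\liminf_{\varepsilon\to0}\ \sup_{0\le t\le\pi/2+t_*\varepsilon-\lambda\varepsilon}\|\varepsilon\partial_xu^\varepsilon(t)\|_{L^2}\longrightarrow+\infty\quad\text{as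 }\lambda\to0^+,$$ $$\liminf_{\varepsilon\to0}\ \sup_{0\le t\le\pi/2+t_*\varepsilon-\lambda\varepsilon}\|\sqrt\varepsilon\,u^\varepsilon(t)\|_{L^\infty}\longrightarrow+\infty\quad\text{as }\lambda\to0^+.$$
   Context: Here $\varepsilon\in]0,1]$, $x\in\mathbb R$, $t\ge0$, and norms are over $\mathbb R_x$. $u^\varepsilon$ is the solution in $C(I;\Sigma)$, $\Sigma=\{f\in H^1(\mathbb R):xf\in L^2(\mathbb R)\}$, on its interval of existence $I$.
   Formalization: Uniqueness of R up to translation and sign is stated among nonzero real-valued H^1 solutions of -½R''+R=R^5, since without such a restriction it is false (0, the constant 1 and periodic functions also solve the equation). *)

(* Defs.v *)
From HB Require Import structures.
From mathcomp Require Import all_boot all_order all_algebra.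
From mathcomp Require Import all_classical all_reals all_analysis.
From mathcomp Require Import complex.
Set Implicit Arguments.
Unset Strict Implicit.
Unset Printing Implicit Defensive.
Import Order.TTheory GRing.Theory Num.Theory.
Import numFieldNormedType.Exports.
Local Open Scope complex_scope.
Local Open Scope ring_scope.
Local Open Scope classical_set_scope.

Section FunctionSpaces.
Context {R : realType}.
Implicit Types (f g : R -> R[i]) (phi : R -> R).

Local Notation mu := (@lebesgue_measure R).

Definition Lpnorm (p : \bar R) f : \bar R :=
  Lnorm mu p (fun x => (Normc.normc (f x))%:E).

Definition L2norm f : \bar R := Lpnorm 2%:E f.
Definition Linftynorm f : \bar R := Lpnorm +oo%E f.

Definition cmeasurable f : Prop :=
  measurable_fun setT (fun x => complex.Re (f x)) /\
  measurable_fun setT (fun x => complex.Im (f x)).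

Definition is_L2 f : Prop := cmeasurable f /\ (L2norm f < +oo)%E.

(* Real-valued test functions suffice for complex-valued distributions, since
   the pairing [cpair] below is bilinear (no conjugation). *)
Definition test_function phi : Prop :=
  (forall (n : nat) (x : R), derivable (phi^`(n)) x 1) /\
  (exists M : R, forall x, M < `|x| -> phi x = 0).

Definition cpair f phi : R[i] :=
  Complex (\int[mu]_x (complex.Re (f x) * phi x))
          (\int[mu]_x (complex.Im (f x) * phi x)).

Definition cloc_integrable f : Prop :=
  locally_integrable setT (fun x => complex.Re (f x)) /\
  locally_integrable setT (fun x => complex.Im (f x)).

Definition is_weak_deriv f g : Prop :=
  [/\ cloc_integrable f, cloc_integrable g &
      forall phi, test_function phi -> cpair f (phi^`()) = - cpair g phi].

(* A choice of a representative of the weak derivative, which is unique up to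
   equality almost everywhere (and the zero function if there is none). *)
Definition weak_deriv f : R -> R[i] := xget (fun=> 0) (is_weak_deriv f).

Definition is_H1 f : Prop :=
  is_L2 f /\ exists g, is_weak_deriv f g /\ is_L2 g.

Definition xmul f : R -> R[i] := fun x => x%:C * f x.

Definition is_Sigma f : Prop := is_H1 f /\ is_L2 (xmul f).

Definition Sigma_norm f : \bar R :=
  (L2norm f + L2norm (weak_deriv f) + L2norm (xmul f))%E.

Definition continuous_in_Sigma (J : set R) (v : R -> R -> R[i]) : Prop :=
  forall t0, J t0 ->
    is_Sigma (v t0) /\
    Sigma_norm (fun x => v t x - v t0 x) @[t --> within J (nbhs t0)] --> 0%E.

Definition is_cderive (z : R -> R[i]) (t : R) (d : R[i]) : Prop :=
  is_derive t 1 (fun s => complex.Re (z s)) (complex.Re d) /\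
  is_derive t 1 (fun s => complex.Im (z s)) (complex.Im d).

End FunctionSpaces.

Section NLS.
Context {R : realType}.
Implicit Types (eps t : R) (f : R -> R[i]) (J : set R) (v : R -> R -> R[i]).

Local Notation mu := (@lebesgue_measure R).

(* i eps d_t v + eps^2/2 d_x^2 v = x^2/2 v - eps^2 |v|^4 v, as an equality of
   distributions in x at every time t in the interior of J; for v in C(J; Sigma)
   this is the usual notion of solution. *)
Definition NLS_equation eps J v : Prop :=
  forall t, J° t -> forall phi, test_function phi ->
  exists d : R[i],
    is_cderive (fun s => cpair (v s) phi) t d /\
    'i%C * eps%:C * d + (2^-1 * eps ^+ 2)%:C * cpair (v t) (phi^`(2))
    = cpair (fun x => (x ^+ 2 / 2)%:C * v t x) phi
      - (eps ^+ 2)%:C *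
        cpair (fun x => (Normc.normc (v t x) ^+ 4)%:C * v t x) phi.

Definition is_solution eps f J v : Prop :=
  [/\ is_interval J /\ (forall t, J t -> 0 <= t),
      J 0,
      continuous_in_Sigma J v,
      {ae mu, forall x, v 0 x = f x} &
      NLS_equation eps J v].

(* v is a solution which cannot be extended beyond J: J is the (forward)
   interval of existence. *)
Definition is_maximal_solution eps f J v : Prop :=
  is_solution eps f J v /\
  forall J' v', is_solution eps f J' v' -> J `<=` J' ->
    (forall t, J t -> {ae mu, forall x, v' t x = v t x}) -> J' `<=` J.

Definition cosh (y : R) : R := (expR y + expR (- y)) / 2.

Definition Rsol (x : R) : R :=
  (3 `^ (4^-1)) / Num.sqrt (cosh (2 * x * Num.sqrt 2)).

Definition expi (theta : R) : R[i] := Complex (cos theta) (sin theta).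

Definition init_data (tstar : R) : R -> R[i] :=
  fun x => (Rsol x)%:C * expi (tstar / 2 * x ^+ 2).

Definition vtilde (tstar eps t : R) : R -> R[i] := fun x =>
  let T := pi / 2 + eps * tstar in
  ((Num.sqrt (T - t))^-1 * Rsol (x / (T - t)))%:C
  * expi (eps / (T - t))
  * expi (x ^+ 2 / (2 * eps * (t - T))).

Definition ground_state_equation (Q : R -> R) : Prop :=
  forall x, [/\ derivable Q x 1, derivable (Q^`()) x 1 &
                - 2^-1 * derive1n 2 Q x + Q x = Q x ^+ 5].

Definition B_id (eps t : R) f : R -> R[i] := f.

Definition B_dx (eps t : R) f : R -> R[i] :=
  fun x => eps%:C * weak_deriv f x.

Definition B_J (eps t : R) f : R -> R[i] :=
  fun x => (x / eps)%:C * f x + 'i%C * (t - pi / 2)%:C * weak_deriv f x.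

End NLS.

(* Main.v *)
Require Import Defs.
From mathcomp Require Import all_boot all_order all_algebra.
From mathcomp Require Import all_classical all_reals all_analysis.
From mathcomp Require Import measurable_realfun ess_sup_inf complex ring lra.

(** The potential is harmonic and the nonlinearity is the mass-critical one, so
    the lens transformation turns the standing wave of the ground state R into
    an explicit solution with the prescribed datum.  Let h be the solution
    h(t) = cos t + eps tstar sin t of h'' + h = 0; it first vanishes at
    pi/2 + arctan(eps tstar).  Before that time
      u(t,x) = h^(-1/2) R(x/h) exp(i eps sin t / h) exp(i x^2 h'/(2 eps h))
    solves the equation and equals the datum at t = 0 ([sol_is_solution]).

    A maximal solution must agree with it.  The difference of two solutions
    satisfies a linear equation whose source is, at each point, bounded by the
    difference itself, because solutions are bounded functions, locally
    uniformly in time ([inSig_sup_bound]).  The self-adjoint part of the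
    equation does not change the L2 norm of the difference, and Gronwall's
    argument makes it vanish ([mass_der], [mass_end], [nls_unique]).  Since the
    equation is only given against test functions, the pairing with the
    difference itself, which lies in the energy space, is reached by density
    ([inSig_density], [pairing_increment]).  Maximality then forces the interval
    of existence to contain the one of the explicit solution ([maximal_sol]).

    In the variable y = x/eps, both the explicit solution and [vtilde] belong
    to the family
      k R(k^2 y) exp(i (c + b y^2 / 2)),
    with parameters ((eps/h)^(1/2), eps h'/h, eps sin t / h) for the former and
    (s^(-1/2), -1/s, 1/s) for the latter, where t = pi/2 + eps tstar - eps s.
    For s in a compact subset of the positive half-line these parameters differ
    by O(eps) ([par_close]).  The profiles, their derivatives and their first
    moments are Lipschitz functions of the parameters in L2, because R decays
    faster than any power ([prof_lip]); and the three operators act on dilated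
    profiles as combinations of the identity, d/dy and y with bounded
    coefficients ([operator_bound]).  Hence the limsup in eps is zero for every
    large Lambda ([concentration]).  At s = lambda, the gradient is at least a
    constant times k^2 and the supremum is k R(0), with k close to
    lambda^(-1/2); this gives the two divergences ([wave1_lower],
    [wave_sup_lower]).

    As to the ground state, if Q is a solution in H1 then
    Q'^2 - 2 Q^2 + (2/3) Q^6 is constant and integrable, hence zero.  If Q is
    not identically zero it has no zero, and w = Q^(-2) satisfies w'' = 8 w; the
    first integral leaves only the translates of the hyperbolic cosine
    ([ground_state_unique]). *)

Set Implicit Arguments.
Unset Strict Implicit.
Unset Printing Implicit Defensive.
Import Order.TTheory GRing.Theory Num.Theory.
Import numFieldNormedType.Exports.
Local Open Scope complex_scope.
Local Open Scope ring_scope.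
Local Open Scope classical_set_scope.
Local Notation der f x d := (is_derive x 1 f d).

(** * Calculus of one real variable *)


Section Calculus.
Context {R : realType}.
Implicit Types (f g : R -> R) (x y a b : R).

Lemma der_eq f x a b : der f x a -> a = b -> der f x b.
Proof. by move=> h <-. Qed.

Lemma der_ext f g x a : f =1 g -> der f x a -> der g x a.
Proof. by move=> /funext ->. Qed.

Lemma derD f g x a b : der f x a -> der g x b -> der (fun y => f y + g y) x (a + b).
Proof. by move=> hf hg; exact: is_deriveD. Qed.

Lemma derN f x a : der f x a -> der (fun y => - f y) x (- a).
Proof. by move=> hf; exact: is_deriveN. Qed.

Lemma derB f g x a b : der f x a -> der g x b -> der (fun y => f y - g y) x (a - b).
Proof. by move=> hf hg; apply: derD => //; exact: derN. Qed.

Lemma derM f g x a b : der f x a -> der g x b ->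
  der (fun y => f y * g y) x (a * g x + f x * b).
Proof.
move=> hf hg; apply: (der_eq (is_deriveM hf hg)).
by rewrite /GRing.scale /= addrC mulrC.
Qed.

Lemma der_cst (c : R) x : der (fun=> c) x 0.
Proof. exact: is_derive_cst. Qed.

Lemma der_id x : der (fun y => y) x 1.
Proof. exact: is_derive_id. Qed.

Lemma derZ c f x a : der f x a -> der (fun y => c * f y) x (c * a).
Proof.
by move=> hf; apply: der_eq (derM (der_cst c x) hf) _; rewrite mul0r add0r.
Qed.

Lemma der_comp f g x a b : der f (g x) a -> der g x b ->
  der (fun y => f (g y)) x (a * b).
Proof. by move=> hf hg; exact: is_derive1_comp. Qed.

Lemma derX n f x a : der f x a ->
  der (fun y => f y ^+ n) x (n%:R * f x ^+ n.-1 * a).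
Proof.
move=> hf; elim: n => [|n ih].
  by rewrite mul0r mul0r; apply: der_cst.
apply: (@der_ext (fun y => f y * f y ^+ n)); first by move=> y; rewrite exprS.
apply: der_eq (derM hf ih) _.
by case: n {ih} => [|n]; rewrite /= ?exprS -?natr1; ring.
Qed.

Lemma derV f x a : f x != 0 -> der f x a ->
  der (fun y => (f y)^-1) x (- a / f x ^+ 2).
Proof.
move=> f0 hf; apply: (der_eq (is_deriveV f0 hf)).
by rewrite /GRing.scale /= mulNr mulrC -mulNr.
Qed.

Lemma der_expR f x a : der f x a -> der (fun y => expR (f y)) x (expR (f x) * a).
Proof. by move=> hf; apply: der_comp => //; exact: is_derive_expR. Qed.

Lemma der_sin f x a : der f x a -> der (fun y => sin (f y)) x (cos (f x) * a).
Proof. by move=> hf; apply: der_comp => //; exact: is_derive_sin. Qed.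

Lemma der_cos f x a : der f x a -> der (fun y => cos (f y)) x (- sin (f x) * a).
Proof. by move=> hf; apply: der_comp => //; exact: is_derive_cos. Qed.

Lemma der_derivable f x a : der f x a -> derivable f x 1.
Proof. by move=> []. Qed.

Lemma der_derive1 f x a : der f x a -> derive1 f x = a.
Proof. by move=> [_]; rewrite derive1E. Qed.

Lemma derivable_der f x : derivable f x 1 -> der f x (derive1 f x).
Proof. by move=> h; split => //; rewrite derive1E. Qed.

Lemma der_continuous f x a : der f x a -> {for x, continuous f}.
Proof. by move=> [/derivable1_diffP/differentiable_continuous]. Qed.

Lemma cvg_der f x a :
  h^-1 * (f (x + h) - f x) @[h --> 0^'] --> a -> der f x a.
Proof.
move=> h0.
have h : h^-1 *: (f (h *: 1 + x) - f x) @[h --> 0^'] --> a.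
  apply: cvg_trans h0.
  by apply: near_eq_cvg; apply: nearW => h; rewrite /GRing.scale /= mulr1 (addrC x).
split; first by apply/cvg_ex; exists a.
exact: cvg_lim.
Qed.

Lemma der_sqbound f x C : f x = 0 -> (forall h, `|h| < 1 -> `|f (x + h)| <= C * h ^+ 2) ->
  der f x 0.
Proof.
move=> fx0 hC; apply: cvg_der; rewrite fx0.
have C0 : 0 <= C.
  have : `|2^-1 : R| < 1 by rewrite ger0_norm//; lra.
  move=> /hC /(le_trans (normr_ge0 _)).
  by rewrite pmulr_lge0// exprn_gt0.
apply/cvgrPdist_lt => e e0; near=> h.
have hn0 : h != 0 by near: h; exact: nbhs_dnbhs_neq.
have h1 : `|h| < 1.
  by near: h; apply: dnbhs0_lt.
have h2 : `|h| < e / (C + 1).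
  by near: h; apply: dnbhs0_lt; rewrite divr_gt0// ltr_wpDl.
rewrite sub0r normrN subr0 normrM normfV mulrC ltr_pdivrMr ?normr_gt0//.
apply: le_lt_trans (hC h h1) _.
rewrite -normr_id -real_normK ?num_real// normr_id expr2 mulrA ltr_pM2r ?normr_gt0//.
apply: le_lt_trans (_ : (C + 1) * `|h| < _); first by rewrite ler_wpM2r// lerDl.
by rewrite mulrC -ltr_pdivlMr// ltr_wpDl.
Unshelve. all: by end_near. Qed.

Lemma der_eps f x a :
  (forall e, 0 < e -> exists2 d, 0 < d &
     forall h, `|h| < d -> `|f (x + h) - f x - h * a| <= e * `|h|) -> der f x a.
Proof.
move=> hf; apply: cvg_der; apply/cvgrPdist_le => e e0.
have [d d0 hd] := hf e e0; near=> h.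
have hn0 : h != 0 by near: h; exact: nbhs_dnbhs_neq.
have h1 : `|h| < d by near: h; exact: dnbhs0_lt.
have := hd h h1; rewrite -ler_pdivrMr ?normr_gt0// -normfV -normrM distrC.
by rewrite mulrC mulrBr mulKf.
Unshelve. all: by end_near. Qed.

Lemma near_der f g x a : (\near x, f x = g x) -> der f x a -> der g x a.
Proof. exact: near_eq_is_derive. Qed.

Lemma mvt f g a b : a < b -> (forall x, a <= x <= b -> der f x (g x)) ->
  exists2 c, a < c < b & f b - f a = g c * (b - a).
Proof.
move=> ab fg; have [||c cab cE] := @MVT _ f g _ _ ab.
- by move=> x; rewrite in_itv/= => /andP[ax xb]; apply: fg; rewrite !ltW.
- by apply: derivable_within_continuous => x; rewrite in_itv/= => /fg/der_derivable.
by exists c => //; move: cab; rewrite in_itv.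
Qed.

Lemma der_nondecr f g a b : a <= b -> (forall x, a <= x <= b -> der f x (g x)) ->
  (forall x, a < x < b -> 0 <= g x) -> f a <= f b.
Proof.
rewrite le_eqVlt => /predU1P[->//|ab] fg g0.
have [c cab cE] := mvt ab fg.
by rewrite -subr_ge0 cE mulr_ge0 ?g0// subr_ge0 ltW.
Qed.

Lemma der_bound f g a b K : (forall x, der f x (g x)) ->
  (forall x, `|g x| <= K) -> `|f b - f a| <= K * `|b - a|.
Proof.
move=> fg gK.
wlog ab : a b / a < b => [hw|].
  have [ab|ba|->] := ltgtP a b; first exact: hw.
  - by rewrite distrC (distrC b); exact: hw.
  - by rewrite !subrr normr0 mulr0.
have [c cab ->] := mvt ab (fun x _ => fg x).
by rewrite normrM ler_wpM2r.
Qed.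

Lemma der_const f : (forall x, der f x 0) -> forall x y, f x = f y.
Proof.
move=> f0 x y; apply/eqP; rewrite -subr_eq0 -normr_le0.
have := @der_bound f (fun=> 0) y x 0 f0 (fun x => _).
by rewrite normr0 mul0r; apply.
Qed.

End Calculus.

(** * Smooth functions and bumps *)

Section Smooth.
Context {R : realType}.
Implicit Types (f g : R -> R) (x y a b : R).

Definition smooth f := forall n x, derivable (f^`(n)) x 1.

Lemma smooth_der f x : smooth f -> der f x (derive1 f x).
Proof. by move=> sf; apply: derivable_der; exact: (sf 0%N). Qed.

Lemma smooth_derive1 f : smooth f -> smooth (derive1 f).
Proof. by move=> sf n x; rewrite -derive1Sn; exact: sf. Qed.

(** A class of functions whose derivatives stay in the class consists of
    smooth functions; every smoothness proof below exhibits such a class. *)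
Lemma smooth_class (S : (R -> R) -> Prop) :
  (forall f, S f -> exists2 g, S g & forall x, der f x (g x)) ->
  forall f, S f -> smooth f.
Proof.
move=> hS f Sf n.
have : S f^`(n).
  elim: n => [|n /hS[g Sg fg]] //.
  rewrite derive1nS; suff -> : derive1 f^`(n) = g by [].
  by apply/funext => x; apply: der_derive1.
by move=> /hS[g _ fg] x; exact: der_derivable (fg x).
Qed.

Lemma smooth_id : smooth (fun y : R => y).
Proof.
apply: (@smooth_class (fun h => h = (fun y => y) \/ exists c : R, h = fun=> c)); last by left.
move=> _ [->|[c ->]].
  by exists (fun=> 1); [right; exists 1|move=> z; exact: der_id].
by exists (fun=> 0); [right; exists 0|move=> z; exact: der_cst].
Qed.

Lemma smooth_continuous f : smooth f -> continuous f.
Proof. by move=> sf x; exact: (der_continuous (smooth_der x sf)). Qed.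

Lemma smooth_affine c a b f : smooth f -> smooth (fun x => c * f (a * x + b)).
Proof.
move=> sf.
apply: (@smooth_class (fun h => exists c f, smooth f /\ h = (fun x => c * f (a * x + b)))); last by exists c, f.
move=> _ [k [u [su ->]]]; exists (fun x => (k * a) * derive1 u (a * x + b)).
  by exists (k * a), (derive1 u); split; [exact (smooth_derive1 su)|].
move=> x; rewrite -mulrA; apply: derZ; rewrite mulrC; apply: der_comp.
  exact: smooth_der.
apply: der_eq (derD (derZ a (der_id x)) (der_cst b x)) _.
by rewrite mulr1 addr0.
Qed.

Arguments smooth_affine : clear implicits.

Lemma smoothM f g : smooth f -> smooth g -> smooth (fun x => f x * g x).
Proof.
move=> sf sg.
apply: (@smooth_class (fun h => exists2 s : seq ((R -> R) * (R -> R)),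
  (forall p, List.In p s -> smooth p.1 /\ smooth p.2) &
  h = (fun x => \sum_(p <- s) p.1 x * p.2 x))); last first.
  exists [:: (f, g)]; first by move=> p /= [<-|].
  by apply/funext => x; rewrite big_seq1.
move=> _ [s hs ->].
elim: s hs => [hs|[u v] s ih hs].
  exists (fun=> 0).
    by exists [::] => //; apply/funext => x; rewrite big_nil.
  by move=> x; apply: der_ext (der_cst 0 x) => y; rewrite big_nil.
have [|h [s' hs' hE] hder] := ih; first by move=> p ps; apply: hs; right.
have [su sv] : smooth u /\ smooth v by apply: (hs (u, v)); left.
exists (fun x => (derive1 u x * v x + u x * derive1 v x) + h x).
  exists [:: (derive1 u, v), (u, derive1 v) & s'].
    move=> p /= [<-|[<-|/hs']]; [by split; [exact (smooth_derive1 su)|exact sv]|by split; [exact su|exact (smooth_derive1 sv)]|by []].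
  by apply/funext => x; rewrite !big_cons /= addrA hE.
move=> x.
apply: (@der_ext _ (fun x => u x * v x + \sum_(p <- s) p.1 x * p.2 x)).
  by move=> y; rewrite big_cons.
by apply: derD (hder x); apply: derM; exact: smooth_der.
Qed.

(** The flat functions x^-k exp(-1/x), extended by zero to x <= 0. *)
Definition flat (k : nat) (x : R) : R := if 0 < x then x^-1 ^+ k * expR (- x^-1) else 0.

(** The inequality z <= exp z at [z = y / n], raised to the power [n]. *)
Lemma exprn_expR_le (n : nat) y : 0 <= y -> y ^+ n * expR (- y) <= n%:R ^+ n.
Proof.
move=> y0; case: n => [|n].
  by rewrite !expr0 mul1r expR_le1 oppr_le0.
have n0 : 0 < n.+1%:R :> R by rewrite ltr0n.
have : y / n.+1%:R <= expR (y / n.+1%:R).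
  by apply: le_trans (expR_ge1Dx _); rewrite lerDr.
rewrite ler_pdivrMr// => h.
have {}h : y ^+ n.+1 <= (expR (y / n.+1%:R) * n.+1%:R) ^+ n.+1.
  by rewrite lerXn2r// nnegrE ?mulr_ge0 ?expR_ge0.
rewrite exprMn -expRM_natl in h.
rewrite expRN ler_pdivrMr ?expR_gt0//.
apply: le_trans h _.
by rewrite (mulrC n.+1%:R) divfK ?gt_eqF// mulrC.
Qed.

(** Every flat function is O(x^2) at 0, so it has a zero derivative there. *)
Lemma flat_bound k x : `|flat k x| <= k.+2%:R ^+ k.+2 * x ^+ 2.
Proof.
rewrite /flat; case: ifPn => [x0|_]; last first.
  by rewrite normr0 mulr_ge0 ?sqr_ge0// exprn_ge0.
have y0 : 0 <= x^-1 by rewrite invr_ge0 ltW.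
rewrite ger0_norm; last by rewrite mulr_ge0 ?exprn_ge0 ?expR_ge0.
have h : x^-1 ^+ k.+2 * expR (- x^-1) * x ^+ 2 <= k.+2%:R ^+ k.+2 * x ^+ 2.
  by rewrite ler_wpM2r ?sqr_ge0//; exact: exprn_expR_le.
apply: le_trans h.
rewrite [leRHS](_ : _ = x^-1 ^+ k * expR (- x^-1))//.
by rewrite !exprS; field; rewrite gt_eqF.
Qed.

(** The span of the flat functions is closed under differentiation. *)
Lemma flat_der k x : der (flat k) x (flat k.+2 x - k%:R * flat k.+1 x).
Proof.
have [x0|x0|x0] := ltgtP 0 x; last first.
- rewrite -x0 {2 3}/flat ltxx mulr0 subr0.
  apply: (@der_sqbound _ _ _ (k.+2%:R ^+ k.+2)).
    by rewrite /flat ltxx.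
  by move=> h _; rewrite add0r; exact: flat_bound.
- apply: (@near_der _ (fun=> 0)).
    near=> z; rewrite /flat ifF//; apply/negbTE; rewrite -leNgt ltW//.
    by near: z; exact: lt_nbhsl.
  by rewrite {1 2}/flat !ltNge (ltW x0)/= mulr0 subr0; exact: der_cst.
- apply: (@near_der _ (fun z => z^-1 ^+ k * expR (- z^-1))).
    by near=> z; rewrite /flat ifT//; near: z; exact: lt_nbhsr.
  rewrite /flat x0.
  have hV : der (fun z => z^-1) x (- 1 / x ^+ 2).
    by apply: (derV (f := fun z => z)) (der_id x); rewrite gt_eqF.
  apply: der_eq (derM (derX k hV) (der_expR (derN hV))) _.
  case: k => [|k]; rewrite !exprS /=; field; rewrite gt_eqF//.
Unshelve. all: by end_near. Qed.

Lemma smooth_flat k : smooth (flat k).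
Proof.
apply: (@smooth_class (fun h => exists s : seq (R * nat),
  h = (fun x => \sum_(p <- s) p.1 * flat p.2 x))); last first.
  by exists [:: (1, k)]; apply/funext => x; rewrite big_seq1 mul1r.
move=> _ [s ->]; elim: s => [|[c n] s [h [s' hE] hder]].
  exists (fun=> 0); first by exists [::]; apply/funext => x; rewrite big_nil.
  by move=> x; apply: der_ext (der_cst 0 x) => y; rewrite big_nil.
exists (fun x => c * (flat n.+2 x - n%:R * flat n.+1 x) + h x).
  exists [:: (c, n.+2), (- (c * n%:R), n.+1) & s'].
  by apply/funext => x; rewrite !big_cons /= hE; ring.
move=> x.
apply: (@der_ext _ (fun x => c * flat n x + \sum_(p <- s) p.1 * flat p.2 x)).
  by move=> y; rewrite big_cons.
by apply: derD (hder x); apply: derZ; exact: flat_der.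
Qed.

Definition bump (x : R) : R := flat 0 (1 * x + 1) * flat 0 (-1 * x + 1).

Lemma smooth_bump : smooth bump.
Proof.
apply: smoothM.
  have -> : (fun x => flat 0 (1 * x + 1)) = (fun x => 1 * flat 0 (1 * x + 1)).
    by apply/funext => x; rewrite [RHS]mul1r.
  by apply: (smooth_affine 1 _ _ (flat 0)); exact: smooth_flat.
have -> : (fun x => flat 0 (-1 * x + 1)) = (fun x => 1 * flat 0 (-1 * x + 1)).
  by apply/funext => x; rewrite [RHS]mul1r.
by apply: (smooth_affine 1 _ _ (flat 0)); exact: smooth_flat.
Qed.

Lemma flat_ge0 k x : 0 <= flat k x.
Proof.
rewrite /flat; case: ifPn => // x0.
by rewrite mulr_ge0 ?exprn_ge0 ?expR_ge0 ?invr_ge0 ?ltW.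
Qed.

Lemma bump_ge0 x : 0 <= bump x.
Proof. by rewrite mulr_ge0 ?flat_ge0. Qed.

Lemma bump_out x : 1 <= `|x| -> bump x = 0.
Proof.
rewrite ler_normr => /orP[x1|x1]; rewrite /bump.
  by rewrite [X in _ * X]/flat ifF ?mulr0//; apply/negbTE; rewrite -leNgt; lra.
by rewrite [X in X * _]/flat ifF ?mul0r//; apply/negbTE; rewrite -leNgt; lra.
Qed.

Lemma bump_gt0 x : `|x| < 1 -> 0 < bump x.
Proof.
rewrite ltr_norml => /andP[x1 x2]; rewrite /bump /flat !ifT; [|lra|lra].
by rewrite !expr0 !mul1r mulr_gt0 ?expR_gt0.
Qed.

End Smooth.

(** * Square-integrable functions *)

Section L2.
Context {R : realType}.
Implicit Types (f g h : R -> R) (c : R).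

Local Notation mu := (@lebesgue_measure R).
Local Notation mfun f := (measurable_fun setT (f : R -> R)).

Lemma aeS (P Q : R -> Prop) : (forall x, P x -> Q x) ->
  {ae mu, forall x : R, P x} -> {ae mu, forall x : R, Q x}.
Proof. by move=> PQ; apply: negligibleS => x /= h /PQ. Qed.

Lemma aeI (P Q : R -> Prop) : {ae mu, forall x : R, P x} ->
  {ae mu, forall x : R, Q x} -> {ae mu, forall x : R, P x /\ Q x}.
Proof.
move=> hP hQ; apply: negligibleS (negligibleU hP hQ) => x /= /not_andP[];
  by [left|right].
Qed.

Lemma ae_forall (P : R -> Prop) : (forall x, P x) -> {ae mu, forall x : R, P x}.
Proof. by move=> h; exact: aeW. Qed.

Definition intg f := mu.-integrable setT (EFin \o f).

Lemma intg_mfun f : intg f -> mfun f.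
Proof. by move=> /integrableP[/measurable_EFinP]. Qed.

Lemma intg_eq f g : f =1 g -> intg f -> intg g.
Proof. by move=> /funext ->. Qed.

Lemma intg_le f g : mfun f -> (forall x, `|f x| <= g x) -> intg g -> intg f.
Proof.
move=> mf fg; apply: le_integrable => //; first exact/measurable_EFinP.
move=> x _ /=; rewrite lee_fin (le_trans (fg x))//; exact: ler_norm.
Qed.

Lemma intgD f g : intg f -> intg g -> intg (fun x => f x + g x).
Proof. by rewrite /intg => hf hg; exact: (integrableD _ hf hg). Qed.

Lemma intgZ c f : intg f -> intg (fun x => c * f x).
Proof. by rewrite /intg => hf; exact: (integrableZl _ _ hf). Qed.

Lemma intgN f : intg f -> intg (fun x => - f x).
Proof. by move=> hf; apply: intg_eq (intgZ (-1) hf) => x; rewrite mulN1r. Qed.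

Lemma intgB f g : intg f -> intg g -> intg (fun x => f x - g x).
Proof. by move=> hf hg; apply: intgD => //; exact: intgN. Qed.

Lemma intg_norm f : intg f -> intg (fun x => `|f x|).
Proof. by move=> hf; exact: integrable_norm. Qed.

Lemma intg_bdd c f h : mfun h -> (forall x, `|h x| <= c) -> intg f ->
  intg (fun x => h x * f x).
Proof.
move=> mh hc hf; apply: (@intg_le _ (fun x => c * `|f x|)).
- by apply: measurable_funM => //; exact: intg_mfun.
- by move=> x; rewrite normrM ler_wpM2r.
- by apply: intgZ; exact: intg_norm.
Qed.

Lemma intD f g : intg f -> intg g ->
  \int[mu]_x (f x + g x) = \int[mu]_x f x + \int[mu]_x g x.
Proof. by move=> hf hg; exact: RintegralD. Qed.

Lemma intB f g : intg f -> intg g ->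
  \int[mu]_x (f x - g x) = \int[mu]_x f x - \int[mu]_x g x.
Proof. by move=> hf hg; exact: RintegralB. Qed.

Lemma intZ c f : intg f -> \int[mu]_x (c * f x) = c * \int[mu]_x f x.
Proof. by move=> hf; exact: RintegralZl. Qed.

Lemma intN f : intg f -> \int[mu]_x (- f x) = - \int[mu]_x f x.
Proof.
move=> hf; rewrite -mulN1r -intZ//; apply: eq_Rintegral => x _.
by rewrite mulN1r.
Qed.

Lemma int_le f g : intg f -> intg g -> (forall x, f x <= g x) ->
  \int[mu]_x f x <= \int[mu]_x g x.
Proof. by move=> hf hg fg; apply: le_Rintegral. Qed.

Lemma int_ge0 f : (forall x, 0 <= f x) -> 0 <= \int[mu]_x f x.
Proof. by move=> f0; apply: Rintegral_ge0. Qed.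

Lemma int_norm f : intg f -> `|\int[mu]_x f x| <= \int[mu]_x `|f x|.
Proof. by move=> hf; apply: le_normr_Rintegral. Qed.

Lemma int_eq f g : f =1 g -> \int[mu]_x f x = \int[mu]_x g x.
Proof. by move=> /funext ->. Qed.

Lemma int_EFin f : intg f -> (\int[mu]_x (f x)%:E = (\int[mu]_x f x)%:E)%E.
Proof. by move=> hf; rewrite fineK//; exact: integrable_fin_num. Qed.

Lemma int_ae f g : mfun f -> mfun g -> {ae mu, forall x : R, f x = g x} ->
  \int[mu]_x f x = \int[mu]_x g x.
Proof.
move=> mf mg fg; congr fine; apply: ae_eq_integral => //.
- exact/measurable_EFinP.
- exact/measurable_EFinP.
- by apply: aeS fg => x /= -> _.
Qed.

Lemma intg_ae f g : mfun f -> mfun g -> {ae mu, forall x : R, f x = g x} ->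
  intg f -> intg g.
Proof.
move=> mf mg fg /integrableP[_ fi]; apply/integrableP; split.
  exact/measurable_EFinP.
have <- : (\int[mu]_x `|(EFin \o f) x| = \int[mu]_x `|(EFin \o g) x|)%E.
  2: by [].
apply: ae_eq_integral => //.
- by apply/measurableT_comp => //; exact/measurable_EFinP.
- by apply/measurableT_comp => //; exact/measurable_EFinP.
- by apply: aeS fg => x /= -> _.
Qed.

Lemma int_eq0_ae f : intg f -> (forall x, 0 <= f x) -> \int[mu]_x f x = 0 ->
  {ae mu, forall x : R, f x = 0}.
Proof.
move=> hf f0 i0.
have /(ae_eq_integral_abs mu measurableT) : measurable_fun setT (EFin \o f).
  by apply/measurable_EFinP; exact: intg_mfun.
move=> [+ _]; have -> : (\int[mu]_x `|(EFin \o f) x| = 0)%E.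
  rewrite -[0%E]/(0%:E) -i0 -int_EFin//; apply: eq_integral => x _ /=.
  by rewrite ger0_norm.
by move=> /(_ erefl); apply: filterS => x /= /(_ Logic.I) [].
Qed.

Lemma int_dct (F : nat -> R -> R) f g : (forall n, mfun (F n)) -> mfun f ->
  {ae mu, forall x : R, F n x @[n --> \oo] --> f x} ->
  (forall n x, `|F n x| <= g x) -> intg g ->
  \int[mu]_x F n x @[n --> \oo] --> \int[mu]_x f x.
Proof.
move=> mF mf Ff Fg hg.
have mF' n : measurable_fun setT (EFin \o F n) by exact/measurable_EFinP.
have mf' : measurable_fun setT (EFin \o f) by exact/measurable_EFinP.
have [] := @dominated_convergence _ _ _ mu setT measurableT
  (fun n => EFin \o F n) (EFin \o f) (EFin \o g).
- by move=> n; exact: mF'.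
- exact: mf'.
- apply: aeS Ff => x /= hx _.
  by apply: cvg_EFin; [exact: nearW|exact: hx].
- exact: hg.
- by apply: aeW => x n _ /=; rewrite lee_fin.
move=> fi _ Fc.
apply: fine_cvg.
rewrite fineK; first exact: Fc.
exact: integrable_fin_num.
Qed.

Definition inL2 f := mfun f /\ intg (fun x => f x ^+ 2).

Lemma inL2_mfun f : inL2 f -> mfun f. Proof. by case. Qed.

Lemma inL2_sq f : inL2 f -> intg (fun x => f x ^+ 2). Proof. by case. Qed.

Lemma inL2_le f g : mfun f -> (forall x, `|f x| <= `|g x|) -> inL2 g -> inL2 f.
Proof.
move=> mf fg [mg hg]; split => //; apply: intg_le hg.
  exact: measurable_funX.
move=> x; rewrite normrX -(real_normK (num_real (g x))).
by rewrite lerXn2r// nnegrE.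
Qed.

Lemma inL2_ae f g : mfun g -> {ae mu, forall x : R, f x = g x} -> inL2 f -> inL2 g.
Proof.
move=> mg fg [mf hf]; split => //; apply: intg_ae hf.
- exact: measurable_funX.
- exact: measurable_funX.
- by apply: aeS fg => x ->.
Qed.

Lemma inL2M f g : inL2 f -> inL2 g -> intg (fun x => f x * g x).
Proof.
move=> [mf hf] [mg hg].
apply: (@intg_le _ (fun x => f x ^+ 2 + g x ^+ 2)).
- exact: measurable_funM.
- move=> x; rewrite normrM.
  have : 0 <= (`|f x| - `|g x|) ^+ 2 by exact: sqr_ge0.
  have : 0 <= (`|f x| + `|g x|) ^+ 2 by exact: sqr_ge0.
  rewrite -(real_normK (num_real (f x))) -(real_normK (num_real (g x))); nra.
- exact: intgD.
Qed.

Lemma inL2Z c f : inL2 f -> inL2 (fun x => c * f x).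
Proof.
move=> [mf hf]; split; first exact: measurable_funM.
by apply: intg_eq (intgZ (c ^+ 2) hf) => x; rewrite exprMn.
Qed.

Lemma inL2D f g : inL2 f -> inL2 g -> inL2 (fun x => f x + g x).
Proof.
move=> hf hg; split.
  by apply: measurable_funD; exact: inL2_mfun.
apply: (@intg_eq (fun x => f x ^+ 2 + g x ^+ 2 + 2 * (f x * g x))).
  by move=> x; ring.
by apply: intgD; [apply: intgD; exact: inL2_sq|apply: intgZ; exact: inL2M].
Qed.

Lemma inL2N f : inL2 f -> inL2 (fun x => - f x).
Proof.
move=> hf; have := inL2Z (-1) hf.
by under eq_fun do rewrite mulN1r.
Qed.

Lemma inL2B f g : inL2 f -> inL2 g -> inL2 (fun x => f x - g x).
Proof. by move=> hf hg; apply: inL2D => //; exact: inL2N. Qed.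

Lemma inL2_bdd c f h : mfun h -> (forall x, `|h x| <= c) -> inL2 f ->
  inL2 (fun x => h x * f x).
Proof.
move=> mh hc hf; apply: (@inL2_le _ (fun x => c * f x)).
- by apply: measurable_funM => //; exact: inL2_mfun.
- by move=> x; rewrite !normrM ler_wpM2r// (le_trans (hc x))// ler_norm.
- exact: inL2Z.
Qed.

Lemma inL20 : inL2 (fun=> 0).
Proof.
split; first exact: measurable_cst.
by apply: (@intg_eq (fun=> 0)); [move=> x; rewrite expr0n|exact: integrable0].
Qed.

(** The L2 norm as a real number; it is meaningful on [inL2] only. *)
Definition nrm f := Num.sqrt (\int[mu]_x (f x ^+ 2)).

Lemma nrm_ge0 f : 0 <= nrm f. Proof. exact: sqrtr_ge0. Qed.

Lemma nrm_sq f : nrm f ^+ 2 = \int[mu]_x (f x ^+ 2).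
Proof. by rewrite sqr_sqrtr//; apply: int_ge0 => x; exact: sqr_ge0. Qed.

Lemma nrm_eq f g : f =1 g -> nrm f = nrm g.
Proof. by move=> /funext ->. Qed.

Lemma nrm0 : nrm (fun=> 0) = 0.
Proof.
rewrite /nrm (@int_eq _ (fun=> 0 * 0)); last by move=> x; rewrite expr2.
by rewrite intZ ?mul0r ?sqrtr0//; exact: integrable0.
Qed.

Lemma nrm_ae f g : mfun f -> mfun g -> {ae mu, forall x : R, f x = g x} ->
  nrm f = nrm g.
Proof.
move=> mf mg fg; congr Num.sqrt; apply: int_ae.
- exact: measurable_funX.
- exact: measurable_funX.
- by apply: aeS fg => x ->.
Qed.

Lemma nrm_eq0_ae f : inL2 f -> nrm f = 0 -> {ae mu, forall x : R, f x = 0}.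
Proof.
move=> hf f0.
have := @int_eq0_ae (fun x => f x ^+ 2) (inL2_sq hf) (fun x => sqr_ge0 (f x)).
rewrite -nrm_sq f0 expr0n /= => /(_ erefl).
by apply: aeS => x /eqP; rewrite sqrf_eq0 => /eqP.
Qed.

Lemma cauchy_schwarz f g : inL2 f -> inL2 g ->
  `|\int[mu]_x (f x * g x)| <= nrm f * nrm g.
Proof.
move=> hf hg; set p := \int[mu]_x _; set a := nrm f; set b := nrm g.
have a0 : 0 <= a := nrm_ge0 f.
have b0 : 0 <= b := nrm_ge0 g.
have quad s t : 0 <= s ^+ 2 * a ^+ 2 + 2 * s * t * p + t ^+ 2 * b ^+ 2.
  have : 0 <= \int[mu]_x ((s * f x + t * g x) ^+ 2).
    by apply: int_ge0 => x; exact: sqr_ge0.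
  rewrite (@int_eq _ (fun x => s ^+ 2 * f x ^+ 2 + (2 * s * t) * (f x * g x) +
     t ^+ 2 * g x ^+ 2)); last by move=> x; ring.
  have i1 := intgZ (s ^+ 2) (inL2_sq hf).
  have i2 := intgZ (2 * s * t) (inL2M hf hg).
  have i3 := intgZ (t ^+ 2) (inL2_sq hg).
  rewrite intD ?intD ?intZ//; first by rewrite -!nrm_sq.
  - exact: inL2_sq.
  - exact: inL2M.
  - exact: inL2_sq.
  - exact: intgD.
have [b1|b1] := eqVneq b 0.
  have [p1|p1] := eqVneq p 0; first by rewrite p1 normr0 mulr_ge0.
  have := quad 1 (- (a ^+ 2 + 1) / (2 * p)).
  have -> : 2 * 1 * (- (a ^+ 2 + 1) / (2 * p)) * p = - (a ^+ 2 + 1) by field.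
  by rewrite b1 expr0n mulr0 => ?; exfalso; nra.
have {b1}b1 : 0 < b by rewrite lt_def b1.
have := quad (b ^+ 2) (- p).
have -> : (b ^+ 2) ^+ 2 * a ^+ 2 + 2 * b ^+ 2 * - p * p + (- p) ^+ 2 * b ^+ 2 =
  b ^+ 2 * ((a * b) ^+ 2 - p ^+ 2) by ring.
rewrite pmulr_rge0 ?exprn_gt0// subr_ge0 => h.
rewrite -(@ler_pXn2r _ 2)// ?nnegrE ?mulr_ge0//.
by rewrite real_normK ?num_real.
Qed.

Lemma nrmD f g : inL2 f -> inL2 g -> nrm (fun x => f x + g x) <= nrm f + nrm g.
Proof.
move=> hf hg; rewrite -(@ler_pXn2r _ 2)// ?nnegrE ?addr_ge0 ?nrm_ge0//.
rewrite nrm_sq (@int_eq _ (fun x => f x ^+ 2 + 2 * (f x * g x) + g x ^+ 2));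
  last by move=> x; ring.
have i1 := inL2_sq hf.
have i2 := inL2M hf hg.
have i3 := inL2_sq hg.
have i4 := intgZ 2 i2.
rewrite intD ?intD ?intZ//; last exact: intgD.
rewrite -!nrm_sq sqrrD lerD2r lerD2l -[leRHS]mulr_natl ler_wpM2l//.
by apply: le_trans (cauchy_schwarz hf hg); exact: ler_norm.
Qed.

Lemma nrmZ c f : inL2 f -> nrm (fun x => c * f x) = `|c| * nrm f.
Proof.
move=> hf; rewrite /nrm (@int_eq _ (fun x => c ^+ 2 * f x ^+ 2)); last first.
  by move=> x; rewrite exprMn.
by rewrite (intZ _ (inL2_sq hf)) sqrtrM ?sqr_ge0// sqrtr_sqr.
Qed.

Lemma nrmN f : nrm (fun x => - f x) = nrm f.
Proof. by congr Num.sqrt; apply: int_eq => x; rewrite sqrrN. Qed.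

Lemma nrmB f g : inL2 f -> inL2 g -> nrm (fun x => f x - g x) <= nrm f + nrm g.
Proof. by move=> hf hg; rewrite -(nrmN g); apply: nrmD => //; exact: inL2N. Qed.

Lemma nrm_le f g : inL2 f -> inL2 g -> (forall x, `|f x| <= `|g x|) -> nrm f <= nrm g.
Proof.
move=> hf hg fg; apply: ler_wsqrtr; apply: int_le; [exact: inL2_sq|exact: inL2_sq|].
move=> x; rewrite -(real_normK (num_real (f x))) -(real_normK (num_real (g x))).
by rewrite lerXn2r// nnegrE.
Qed.

(** A function dominated almost everywhere agrees almost everywhere with one
    dominated everywhere, namely its truncation. *)
Lemma le_ae_everywhere f g : mfun f -> mfun g -> {ae mu, forall x : R, `|f x| <= `|g x|} ->
  exists h, [/\ mfun h, {ae mu, forall x : R, h x = f x} & forall x, `|h x| <= `|g x|].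
Proof.
move=> mf mg fg; have mg' : mfun (fun x => `|g x|) by exact: measurableT_comp.
exists (fun x => Num.max (- `|g x|) (Num.min `|g x| (f x))); split.
- apply: measurable_maxr; first exact: measurableT_comp.
  exact: measurable_minr.
- apply: aeS fg => x; rewrite ler_norml => /andP[h1 h2].
  by rewrite min_r// max_r.
- move=> x; have g0 := normr_ge0 (g x); rewrite ler_norml le_max ge_max lexx/= ge_min lexx/= andbT; lra.
Qed.

Lemma inL2_le_ae f g : mfun f -> {ae mu, forall x : R, `|f x| <= `|g x|} ->
  inL2 g -> inL2 f.
Proof.
move=> mf fg hg; have [h [mh hf hh]] := le_ae_everywhere mf (inL2_mfun hg) fg.
by apply: (inL2_ae mf hf); exact: inL2_le hg.
Qed.

Lemma nrm_le_ae f g : mfun f -> inL2 g -> {ae mu, forall x : R, `|f x| <= `|g x|} ->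
  nrm f <= nrm g.
Proof.
move=> mf hg fg; have [h [mh hf hh]] := le_ae_everywhere mf (inL2_mfun hg) fg.
by rewrite -(nrm_ae mh mf hf); apply: nrm_le => //; exact: inL2_le hg.
Qed.

Lemma nrm_bdd c f h : mfun h -> (forall x, `|h x| <= c) -> inL2 f ->
  nrm (fun x => h x * f x) <= c * nrm f.
Proof.
move=> mh hc hf; have c0 : 0 <= c by exact: le_trans (hc 0).
rewrite -[X in X * _]ger0_norm// -nrmZ//; apply: nrm_le.
- exact: inL2_bdd hf.
- exact: inL2Z.
- by move=> x; rewrite !normrM ler_wpM2r// (le_trans (hc x))// ler_norm.
Qed.

Lemma nrmB_tri f g h : inL2 f -> inL2 g -> inL2 h ->
  nrm (fun x => f x - h x) <= nrm (fun x => f x - g x) + nrm (fun x => g x - h x).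
Proof.
move=> hf hg hh.
rewrite (@nrm_eq _ (fun x => (f x - g x) + (g x - h x))).
  by apply: nrmD; exact: inL2B.
by move=> x; ring.
Qed.

Lemma nrmBC f g : nrm (fun x => f x - g x) = nrm (fun x => g x - f x).
Proof. by rewrite -nrmN; apply: nrm_eq => x; ring. Qed.

Lemma nrm_cvg0_dct (F : nat -> R -> R) f g : (forall n, mfun (F n)) -> mfun f ->
  {ae mu, forall x : R, F n x @[n --> \oo] --> f x} ->
  (forall n x, `|F n x - f x| <= g x) -> inL2 g ->
  nrm (fun x => F n x - f x) @[n --> \oo] --> 0.
Proof.
move=> mF mf Ff Fg hg.
have sq0 : (Num.sqrt y : R) @[y --> (0 : R)] --> (0 : R).
  by rewrite -[X in _ --> X](@sqrtr0 R); exact: sqrt_continuous.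
apply: cvg_comp sq0.
have {1}<- : \int[mu]_x ((fun=> 0) x) = 0 :> R by rewrite /Rintegral integral0.
apply: (@int_dct _ _ (fun x => g x ^+ 2)).
- by move=> n; apply: measurable_funX; exact: measurable_funB.
- exact: measurable_cst.
- apply: aeS Ff => x hx.
  have -> : 0 = (f x - f x) ^+ 2 by rewrite subrr expr0n.
  have hd : F n x - f x @[n --> \oo] --> f x - f x.
    by apply: cvgB => //; exact: cvg_cst.
  have -> : (fun n => (F n x - f x) ^+ 2) = (fun n => (F n x - f x) * (F n x - f x)).
    by apply/funext => n; rewrite expr2.
  by rewrite expr2; apply: cvgM.
- move=> n x; rewrite normrX lerXn2r ?nnegrE// .
  by apply: le_trans (Fg n x).
- exact: inL2_sq.
Qed.

End L2.

(** * Integration of compactly supported functions *)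

Section CompactSupport.
Context {R : realType}.
Implicit Types (f g h F : R -> R) (c x M : R).

Local Notation mu := (@lebesgue_measure R).
Local Notation mfun f := (measurable_fun setT (f : R -> R)).

Lemma continuous_mfun f : continuous f -> mfun f.
Proof. exact: continuous_measurable_fun. Qed.

Lemma cc_bounded f M : continuous f -> (forall x, M < `|x| -> f x = 0) ->
  exists B : R, forall x, `|f x| <= B.
Proof.
move=> cf f0; have M0 : - `|M| <= `|M| by rewrite ge0_cp.
have cnf : {within `[- `|M|, `|M|], continuous (fun x => `|f x|)}.
  by apply: continuous_subspaceT => x; apply: cvg_norm; exact: cf.
have [c _ hc] := EVT_max M0 cnf; exists `|f c| => x.
have [xM|Mx] := leP `|x| `|M|; first by apply: hc; rewrite in_itv/= -ler_norml.
by rewrite f0 ?normr0// (le_lt_trans (ler_norm M)).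
Qed.

Lemma int_itv f M : (forall x, M < `|x| -> f x = 0) ->
  \int[mu]_x f x = \int[mu]_(x in `[- M, M]) f x.
Proof.
move=> f0; rewrite [RHS]Rintegral_mkcond; apply: eq_Rintegral => x _.
rewrite patchE; case: ifPn => //; rewrite notin_setE /= in_itv /= -ler_norml.
by move=> /negP; rewrite -ltNge => /f0.
Qed.

Lemma intg_itv f M : (forall x, M < `|x| -> f x = 0) ->
  mu.-integrable `[- M, M] (EFin \o f) -> intg f.
Proof.
move=> f0; have [+ _] := @integrable_mkcond _ _ _ mu `[- M, M] (EFin \o f) (measurable_itv _).
move=> /[apply]; rewrite /intg.
rewrite [X in mu.-integrable _ X -> _](_ : _ = EFin \o f)//; apply/funext => x.
rewrite patchE; case: ifPn => //; rewrite notin_setE /= in_itv /= -ler_norml.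
by move=> /negP; rewrite -ltNge => /f0 ->.
Qed.

Lemma intg_cc f M : continuous f -> (forall x, M < `|x| -> f x = 0) -> intg f.
Proof.
move=> cf f0; apply: (intg_itv f0); apply: continuous_compact_integrable.
  exact: segment_compact.
exact: continuous_subspaceT.
Qed.

Lemma inL2_cc f M : continuous f -> (forall x, M < `|x| -> f x = 0) -> inL2 f.
Proof.
move=> cf f0; split; first exact: continuous_mfun.
apply: (@intg_cc _ M) => [x|x /f0 ->]; last by rewrite expr0n.
by apply: (@continuous_comp _ _ _ f (fun y : R => y ^+ 2)); [exact: cf|exact: exprn_continuous].
Qed.

Lemma der_support f F M : (forall x, der F x (f x)) ->
  (forall x, M < `|x| -> F x = 0) -> forall x, M < `|x| -> f x = 0.
Proof.
move=> dF F0 x Mx; have : der F x 0.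
  apply: (near_der _ (der_cst 0 x)).
  have : (\forall y \near x, M < `|y|).
    by apply: (@cvgr_norm_gt R R R (nbhs x) _ (fun y : R => y) x).
  by apply: filterS => y /F0 ->.
by move=> [_ +]; have [_ ->] := dF x.
Qed.

Lemma int_FTC F f a b : a < b -> (forall x, der F x (f x)) -> continuous f ->
  \int[mu]_(x in `[a, b]) f x = F b - F a.
Proof.
move=> ab dF cf; rewrite /Rintegral (@continuous_FTC2 _ f F a b ab)//.
- exact: continuous_subspaceT.
- split.
  + by move=> x _; exact: der_derivable (dF x).
  + by apply: cvg_at_right_filter; exact: der_continuous (dF a).
  + by apply: cvg_at_left_filter; exact: der_continuous (dF b).
- by move=> x _; exact: der_derive1 (dF x).
Qed.

(** The fundamental theorem of calculus on an interval that contains the support. *)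
Lemma int_der_cc F f M : (forall x, der F x (f x)) -> continuous f ->
  (forall x, M < `|x| -> F x = 0) -> \int[mu]_x f x = 0.
Proof.
move=> dF cf F0.
have M0 : M < `|M| + 1 by rewrite (le_lt_trans (ler_norm M))// ltrDl.
have f0 := der_support dF F0.
have F0' x : `|M| + 1 <= `|x| -> F x = 0 by move=> h; apply: F0; exact: lt_le_trans h.
rewrite (@int_itv _ (`|M| + 1)); last first.
  by move=> x h; apply: f0; exact: lt_trans h.
rewrite (int_FTC _ dF cf).
  by rewrite !F0' ?subrr// ?normrN [leRHS]ger0_norm.
by rewrite (@lt_trans _ _ 0) ?oppr_lt0 ?ltr_wpDl.
Qed.

Definition locint f := locally_integrable setT f.

Lemma locint_mfun f : locint f -> mfun f. Proof. by case. Qed.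

Lemma locint_itv f M : locint f -> mu.-integrable `[- M, M] (EFin \o f).
Proof.
move=> [mf _ hf]; apply/integrableP; split.
  by apply/measurable_EFinP; exact: measurable_funS mf.
by apply: hf => //; exact: segment_compact.
Qed.

Lemma locintM f h M : locint f -> mfun h -> (exists B : R, forall x, `|h x| <= B) ->
  (forall x, M < `|x| -> h x = 0) -> intg (fun x => f x * h x).
Proof.
move=> lf mh [B hB] h0.
have : intg (f \_ `[- M, M]).
  have [+ _] := @integrable_mkcond _ _ _ mu `[- M, M] (EFin \o f) (measurable_itv _).
  by move=> /(_ (locint_itv M lf)); rewrite /intg restrict_EFin.
move=> /(intg_bdd mh hB); apply: intg_eq => x.
rewrite patchE; case: ifPn; first by rewrite mulrC.
rewrite notin_setE /= in_itv /= -ler_norml => /negP; rewrite -ltNge => /h0 ->.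
by rewrite mul0r mulr0.
Qed.

Lemma intg_restrict (i : interval R) f : intg f -> intg (f \_ [set` i]).
Proof.
move=> hf; have mi : measurable [set` i] by exact: measurable_itv.
have := @integrableS _ _ _ mu setT [set` i] _ measurableT mi (@subsetT _ _) hf.
have [+ _] := @integrable_mkcond _ _ _ mu [set` i] (EFin \o f) mi.
by move=> /[apply]; rewrite restrict_EFin.
Qed.

Lemma inL2_locint f : inL2 f -> locint f.
Proof.
move=> [mf hf]; split; [exact: mf|exact: openT|move=> K _ cK].
have mK : measurable K by exact: compact_measurable.
have : mu.-integrable K (EFin \o f).
  apply: (@le_integrable _ _ _ mu K mK (EFin \o f) (EFin \o (fun x => 1 + f x ^+ 2))).
  - by apply/measurable_EFinP; exact: measurable_funS mf.
  - move=> x _ /=; rewrite lee_fin [leRHS]ger0_norm ?addr_ge0 ?sqr_ge0//.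
    rewrite -(real_normK (num_real (f x))).
    have : 0 <= (`|f x| - 1) ^+ 2 by exact: sqr_ge0.
    have := normr_ge0 (f x); nra.
  - have i1 : mu.-integrable K (EFin \o (fun=> 1)).
      apply: continuous_compact_integrable => //.
      by apply: continuous_subspaceT => x; exact: cvg_cst.
    have i2 : mu.-integrable K (EFin \o (fun x => f x ^+ 2)).
      by apply: (@integrableS _ _ _ mu setT K _ measurableT mK _ hf).
    exact: (@integrableD _ _ _ mu K mK _ _ i1 i2).
by move=> /integrableP[].
Qed.

Lemma continuous_locint f : continuous f -> locint f.
Proof.
move=> cf; split; [exact: continuous_mfun|exact: openT|move=> K _ cK].
have /integrableP[] // : mu.-integrable K (EFin \o f).
apply: continuous_compact_integrable => //.
exact: continuous_subspaceT.
Qed.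

Lemma locintD f g : locint f -> locint g -> locint (fun x => f x + g x).
Proof. exact: locally_integrableD. Qed.

Lemma locintZ c f : locint f -> locint (fun x => c * f x).
Proof.
move=> [mf _ hf]; split; [exact: measurable_funM|exact: openT|move=> K KT cK].
under eq_integral do rewrite normrM EFinM.
rewrite ge0_integralZl//; last first.
  - apply/measurable_EFinP; apply: measurableT_comp => //.
    by apply: measurable_funS mf => //; exact: openT.
  - exact: compact_measurable.
by rewrite lte_mul_pinfty// hf.
Qed.

End CompactSupport.

(** * Mollification and weak derivatives *)

Section Mollifier.
Context {R : realType}.
Implicit Types (f g h phi : R -> R) (x y N M : R).

Local Notation mu := (@lebesgue_measure R).
Local Notation mfun f := (measurable_fun setT (f : R -> R)).

Lemma bumpN x : bump (- x) = bump x :> R.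
Proof. by rewrite /bump mulrC !mul1r !mulN1r opprK. Qed.

Lemma bump_supp x : 1 < `|x| -> bump x = 0 :> R.
Proof. by move=> /ltW; exact: bump_out. Qed.

Lemma continuous_bump : continuous (@bump R).
Proof. exact: (smooth_continuous smooth_bump). Qed.

Lemma bump_le1 x : bump x <= 1 :> R.
Proof.
rewrite /bump /flat; case: ifPn => h1; last by rewrite mul0r.
case: ifPn => h2; last by rewrite mulr0.
rewrite !expr0 ![1 * expR _]mul1r mulr_ile1 ?expR_ge0 ?expR_le1// oppr_le0.
  by rewrite invr_ge0 ltW.
by rewrite invr_ge0 ltW.
Qed.

Definition bump_mass : R := \int[mu]_x bump x.

Lemma intg_bump : intg (@bump R).
Proof. exact: (intg_cc continuous_bump bump_supp). Qed.

Lemma bump_mass_gt0 : 0 < bump_mass.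
Proof.
rewrite lt_def (int_ge0 (@bump_ge0 R)) andbT; apply/eqP => h0.
have [N [mN N0 hN]] := int_eq0_ae intg_bump (@bump_ge0 R) h0.
have : `]-1, 1[ `<=` N.
  move=> x /=; rewrite in_itv/= -ltr_norml => x1; apply: hN => /=.
  by apply/eqP; rewrite gt_eqF// bump_gt0.
move=> sub.
have : (mu `](- 1)%R, 1%R[ <= mu N)%E.
  by apply: (le_measure mu _ _ sub); rewrite inE//; exact: measurable_itv.
rewrite [X in (_ <= X)%E]N0 lebesgue_measure_itv/= lte_fin ifT; last by lra.
by rewrite -EFinD lee_fin; lra.
Qed.

(** The mollifying kernel at scale 1/N, centred at x; it is even in y - x. *)
Definition kern N x y : R := N / bump_mass * bump (N * y + - (N * x)).

(** The symmetry is what makes Tonelli's theorem give a contraction of L2. *)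
Lemma kernC N x y : kern N x y = kern N y x.
Proof. by rewrite /kern -bumpN opprD opprK addrC. Qed.

Lemma kern_ge0 N x y : 0 <= N -> 0 <= kern N x y.
Proof.
by move=> N0; rewrite mulr_ge0 ?bump_ge0// divr_ge0// ltW// bump_mass_gt0.
Qed.

Lemma kern_le N x y : 0 <= N -> kern N x y <= N / bump_mass.
Proof.
move=> N0; rewrite -[leRHS]mulr1 ler_wpM2l ?bump_le1//.
by rewrite divr_ge0// ltW// bump_mass_gt0.
Qed.

Lemma kern_out N x y : 0 < N -> N^-1 <= `|y - x| -> kern N x y = 0.
Proof.
move=> N0 h; rewrite /kern bump_out ?mulr0//.
by rewrite -mulrBr normrM gtr0_norm// -ler_pdivrMl// mulr1.
Qed.

Lemma kern_supp N x y : 0 < N -> `|x| + N^-1 < `|y| -> kern N x y = 0.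
Proof.
move=> N0 h; apply: kern_out => //.
have : `|y| <= `|y - x| + `|x|.
  by rewrite -[X in `|X| <= _](subrK x) ler_normD.
lra.
Qed.

Lemma smooth_kern N x : smooth (kern N x).
Proof. exact: (@smooth_affine R _ _ _ _ smooth_bump). Qed.
Arguments smooth_kern : clear implicits.

Lemma test_kern N x : 0 < N -> test_function (kern N x).
Proof.
move=> N0; split; first exact: smooth_kern.
by exists (`|x| + N^-1) => y; exact: kern_supp.
Qed.

Lemma continuous_kern N x : continuous (kern N x).
Proof. by move=> y; exact: (der_continuous (smooth_der y (smooth_kern N x))). Qed.

Lemma intg_kern N x : 0 < N -> intg (kern N x).
Proof.
move=> N0; apply: (@intg_cc _ _ (`|x| + N^-1)); first exact: continuous_kern.
by move=> y; exact: kern_supp.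
Qed.

Lemma int_kern N x : 0 < N -> \int[mu]_y kern N x y = 1.
Proof.
move=> N0; pose F y : R := N * y + - (N * x).
have dF y : der F y N.
  by apply: der_eq (derD (derZ N (der_id y)) (der_cst _ y)) _; rewrite mulr1 addr0.
have F' : F^`() = fun=> N by apply/funext => y; exact: der_derive1 (dF y).
have : (\int[mu]_y (bump y)%:E = \int[mu]_y ((bump (F y) * derive1 F y))%R%:E)%E.
  apply: increasing_ge0_integration_by_substitutionT.
  - by move=> a b ab; rewrite /F ltrD2r ltr_pM2l.
  - by rewrite F' => y; exact: cvg_cst.
  - by rewrite F'; exact: is_cvg_cst.
  - by rewrite F'; exact: is_cvg_cst.
  - by move=> y; exact: der_derivable (dF y).
  - apply/cvgrNyPle => A; near=> y; rewrite /F.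
    have : y <= (A + N * x) / N by near: y; apply: nbhs_ninfty_le; exact: num_real.
    by rewrite ler_pdivlMr// mulrC; lra.
  - apply/cvgryPge => A; near=> y; rewrite /F.
    have : (A + N * x) / N <= y by near: y; apply: nbhs_pinfty_ge; exact: num_real.
    by rewrite ler_pdivrMr// mulrC; lra.
  - exact: continuous_bump.
  - exact: bump_ge0.
rewrite int_EFin; last exact: intg_bump.
rewrite F' => hE.
have m0 := bump_mass_gt0.
have -> : \int[mu]_y kern N x y = bump_mass^-1 * \int[mu]_y (bump (F y) * N).
  rewrite -intZ.
    by apply: int_eq => y; rewrite /kern /F; ring.
  apply: intg_eq (intgZ bump_mass (intg_kern x N0)) => y.
  by rewrite /kern /F; field; rewrite gt_eqF.
by rewrite /Rintegral -hE /= mulVf// gt_eqF.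
Unshelve. all: by end_near. Qed.

Lemma kern_bounded N x : 0 < N -> exists B : R, forall y, `|kern N x y| <= B.
Proof.
move=> N0; exists (N / bump_mass) => y.
by rewrite ger0_norm ?kern_ge0 ?kern_le// ltW.
Qed.

Lemma intg_locint_kern f N x : 0 < N -> locint f -> intg (fun y => f y * kern N x y).
Proof.
move=> N0 lf; apply: (locintM lf _ (kern_bounded x N0) (fun y => kern_supp N0)).
by apply: continuous_mfun; exact: continuous_kern.
Qed.

Definition moll N f x : R := \int[mu]_y (f y * kern N x y).

(** At a Lebesgue point the mollified values converge: the kernel is
    dominated by a multiple of the averaging kernel of a ball. *)
Lemma moll_lebesgue_pt f x (u : nat -> R) : locint f -> lebesgue_pt f x ->
  (forall n, 0 < u n) -> (u n)^-1 @[n --> \oo] --> 0 ->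
  moll (u n) f x @[n --> \oo] --> f x.
Proof.
move=> lf hx u0 uy; have m0 := bump_mass_gt0.
have lfc N : 0 < N -> intg (fun y => (f y - f x) * kern N x y).
  move=> N0; apply: intg_eq (intgB (intg_locint_kern x N0 lf) (intgZ (f x) (intg_kern x N0))).
  by move=> y; ring.
have key N : 0 < N -> (`|moll N f x - f x|%:E <= (2 / bump_mass)%:E * davg f x N^-1)%E.
  move=> N0.
  have -> : moll N f x - f x = \int[mu]_y ((f y - f x) * kern N x y).
    rewrite -[X in _ - X]mulr1 -(int_kern x N0) -intZ; last exact: intg_kern.
    rewrite -intB; [|exact: intg_locint_kern|by apply: intgZ; exact: intg_kern].
    by apply: int_eq => y; ring.
  apply: (@le_trans _ _ (\int[mu]_y (`|(f y - f x) * kern N x y|)%R%:E)%E).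
    by rewrite int_EFin ?lee_fin; [apply: int_norm|apply: intg_norm]; exact: lfc.
  have mb : measurable (ball x N^-1) by exact: measurable_ball.
  have mfx : measurable_fun setT (fun y => `|f y - f x|).
    apply: measurableT_comp => //; apply: measurable_funB => //.
    exact: locint_mfun.
  rewrite /davg /iavg.
  have -> : mu (ball x N^-1) = (2 * N^-1)%:E.
    by rewrite lebesgue_measure_ball ?invr_ge0 ?ltW// mulr_natl.
  rewrite inver gt_eqF ?mulr_gt0 ?invr_gt0// muleA -EFinM.
  have -> : 2 / bump_mass / (2 * N^-1) = N / bump_mass.
    by field; rewrite !gt_eqF.
  rewrite -ge0_integralZl//; last 2 first.
    - apply/measurable_EFinP; apply: measurable_funS mfx => //; exact: openT.
    - by rewrite lee_fin divr_ge0// ltW.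
  rewrite [leRHS]integral_mkcond; apply: ge0_le_integral => //.
  - apply/measurable_EFinP; apply: measurableT_comp => //.
    exact: intg_mfun (lfc N N0).
  - apply: (measurable_restrictT _ _).1 => //.
    apply: measurable_funeM; apply/measurable_EFinP.
    by apply: measurable_funS mfx => //; exact: openT.
  move=> y _; rewrite patchE; case: ifPn => [_|]; last first.
    rewrite notin_setE /ball/= => /negP; rewrite -leNgt distrC => h.
    by rewrite kern_out// mulr0 normr0.
  rewrite /= lee_fin normrM mulrC ler_wpM2r// ger0_norm ?kern_ge0 ?kern_le//; exact: ltW.
have h1 : (davg f x (u n)^-1 @[n --> \oo] --> 0)%E.
  apply: cvg_comp hx => P [e /= e0 hP].
  move/cvgrPdist_lt : uy => /(_ e e0) [k _ hk].
  by exists k => // n /hk he; apply: hP => //=; rewrite invr_gt0.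
move/fine_cvgP : h1 => [hfin hc].
apply/cvgrPdist_lt => e e0.
move/cvgrPdist_lt : hc => /(_ (e * bump_mass / 2)) => hc.
have {hc} := hc _; rewrite !divr_gt0 ?mulr_gt0// => /(_ erefl).
apply: filter_app; apply: filterS hfin => n hfin hn.
rewrite sub0r normrN in hn.
have := key _ (u0 n); rewrite -[X in (_ <= _ * X)%E](fineK hfin) -EFinM lee_fin.
rewrite distrC => /le_lt_trans; apply.
rewrite mulrC -ltr_pdivlMr ?divr_gt0// (le_lt_trans (ler_norm _))//.
by rewrite (_ : e / (2 / bump_mass) = e * bump_mass / 2)//; field; rewrite gt_eqF.
Qed.

(** The mollifying kernels are admissible tests, and they recover the function at
    its Lebesgue points. *)
Lemma ae_ge0_test f : locint f ->
  (forall phi, test_function phi -> (forall x, 0 <= phi x) ->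
     0 <= \int[mu]_x (f x * phi x)) ->
  {ae mu, forall x : R, 0 <= f x}.
Proof.
move=> lf hf; have := @lebesgue_differentiation _ f lf.
apply: aeS => x hx.
have hu : (n.+1%:R : R)^-1 @[n --> \oo] --> (0 : R) by exact: cvg_harmonic.
have := moll_lebesgue_pt lf hx (fun n => ltr0Sn R n) hu.
move=> hc; rewrite -(cvg_lim (@Rhausdorff R) hc).
apply: limr_ge; first by apply/cvg_ex; exists (f x).
by apply: nearW => n; apply: hf => [|y]; [exact: test_kern|exact: kern_ge0].
Qed.

Lemma ae_eq0_test f : locint f ->
  (forall phi, test_function phi -> \int[mu]_x (f x * phi x) = 0) ->
  {ae mu, forall x : R, f x = 0}.
Proof.
move=> lf hf.
have h1 : {ae mu, forall x : R, 0 <= f x}.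
  by apply: ae_ge0_test => // phi tp _; rewrite hf.
have h2 : {ae mu, forall x : R, 0 <= -1 * f x}.
  apply: ae_ge0_test => [|phi [sp [M hM]] _]; first exact: locintZ.
  rewrite (@int_eq _ _ (fun x => -1 * (f x * phi x))); last by move=> x; ring.
  have cp : continuous phi by move=> x; exact: (der_continuous (smooth_der x sp)).
  rewrite intZ; first by rewrite hf ?mulr0//; split => //; exists M.
  apply: (@locintM _ _ _ M) => //; first exact: continuous_mfun.
  exact: cc_bounded cp hM.
apply: aeS (aeI h1 h2) => x [? ?]; apply/eqP; rewrite eq_le; apply/andP; split => //; lra.
Qed.

Lemma test_continuous phi : test_function phi -> continuous phi.
Proof. by move=> [sp _] x; exact: (der_continuous (smooth_der x sp)). Qed.

Lemma test_derive1 phi : test_function phi -> test_function (derive1 phi).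
Proof.
move=> [sp [M hM]]; split; first exact: smooth_derive1.
exists M; apply: der_support hM => x; exact: smooth_der.
Qed.

Lemma test_der phi x : test_function phi -> der phi x (derive1 phi x).
Proof. by move=> [sp _]; exact: smooth_der. Qed.

Lemma testM phi f : test_function phi -> smooth f ->
  test_function (fun x => f x * phi x).
Proof.
move=> [sp [M hM]] sf; split; first exact: smoothM.
by exists M => x /hM ->; rewrite mulr0.
Qed.

Lemma intg_locint_test f phi : locint f -> test_function phi ->
  intg (fun x => f x * phi x).
Proof.
move=> lf tp; have cp := test_continuous tp; case: tp => sp [M hM].
apply: (@locintM _ _ _ M) => //; first exact: continuous_mfun.
exact: cc_bounded cp hM.
Qed.

Lemma test_inL2 phi : test_function phi -> inL2 phi.
Proof. by move=> tp; have cp := test_continuous tp; case: tp => sp [M hM]; exact: inL2_cc cp hM. Qed.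

(** Weak derivatives of real-valued functions. *)
Definition wder f g := [/\ locint f, locint g &
  forall phi, test_function phi ->
    \int[mu]_x (f x * derive1 phi x) = - \int[mu]_x (g x * phi x)].

Lemma wder_uniq f g h : wder f g -> wder f h -> {ae mu, forall x : R, g x = h x}.
Proof.
move=> [lf lg fg] [_ lh fh].
have : {ae mu, forall x : R, g x + -1 * h x = 0}.
  apply: ae_eq0_test => [|phi tp]; first by apply: locintD => //; exact: locintZ.
  rewrite (@int_eq _ _ (fun x => g x * phi x - h x * phi x)); last by move=> x; ring.
  have i1 := intg_locint_test lg tp; have i2 := intg_locint_test lh tp.
  rewrite intB//; have := fg _ tp; rewrite (fh _ tp) => /oppr_inj ->.
  by rewrite subrr.
by apply: aeS => x; lra.
Qed.

Lemma wderD f g h k : wder f g -> wder h k ->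
  wder (fun x => f x + h x) (fun x => g x + k x).
Proof.
move=> [lf lg fg] [lh lk hk]; split; [exact: locintD|exact: locintD|move=> phi tp].
have tp' := test_derive1 tp.
rewrite (@int_eq _ _ (fun x => f x * derive1 phi x + h x * derive1 phi x)); last by move=> x; ring.
rewrite (@int_eq _ (fun x => (g x + k x) * phi x) (fun x => g x * phi x + k x * phi x)); last by move=> x; ring.
by rewrite !intD ?fg ?hk//; do ?[exact: intg_locint_test]; ring.
Qed.

Lemma wderZ c f g : wder f g -> wder (fun x => c * f x) (fun x => c * g x).
Proof.
move=> [lf lg fg]; split; [exact: locintZ|exact: locintZ|move=> phi tp].
have tp' := test_derive1 tp.
rewrite (@int_eq _ _ (fun x => c * (f x * derive1 phi x))); last by move=> x; ring.
rewrite (@int_eq _ (fun x => c * g x * phi x) (fun x => c * (g x * phi x))); last by move=> x; ring.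
by rewrite !intZ ?fg//; do ?[exact: intg_locint_test]; ring.
Qed.

Lemma locint_ae f g : measurable_fun setT g -> {ae mu, forall x : R, f x = g x} ->
  locint f -> locint g.
Proof.
move=> mg fg [mf _ hf]; split; [exact: mg|exact: openT|move=> K KT cK].
have <- : (\int[mu]_(x in K) `|f x|%:E = \int[mu]_(x in K) `|g x|%:E)%E.
  2: exact: hf.
have mK := compact_measurable cK.
apply: ge0_ae_eq_integral => //.
- apply/measurable_EFinP; apply: measurableT_comp => //; exact: measurable_funS mf.
- apply/measurable_EFinP; apply: measurableT_comp => //; exact: measurable_funS mg.
- by apply: aeS fg => x -> .
Qed.

Lemma wder_ae f g f' g' : measurable_fun setT f' -> measurable_fun setT g' ->
  {ae mu, forall x : R, f x = f' x} -> {ae mu, forall x : R, g x = g' x} ->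
  wder f g -> wder f' g'.
Proof.
move=> mf' mg' ff gg [lf lg fg].
split; [exact: locint_ae ff lf|exact: locint_ae gg lg|move=> phi tp].
have mphi : measurable_fun setT phi by apply: continuous_mfun; exact: test_continuous.
have mphi' : measurable_fun setT (derive1 phi).
  by apply: continuous_mfun; apply: test_continuous; exact: test_derive1.
have <- : \int[mu]_x (f x * derive1 phi x) = \int[mu]_x (f' x * derive1 phi x).
  apply: int_ae.
  - by apply: measurable_funM => //; exact: locint_mfun.
  - exact: measurable_funM.
  - by apply: aeS ff => x ->.
have <- : \int[mu]_x (g x * phi x) = \int[mu]_x (g' x * phi x).
  apply: int_ae.
  - by apply: measurable_funM => //; exact: locint_mfun.
  - exact: measurable_funM.
  - by apply: aeS gg => x ->.
exact: fg.
Qed.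

Lemma der_wder f g : (forall x, der f x (g x)) -> continuous g -> wder f g.
Proof.
move=> dfg cg; have cf : continuous f by move=> x; exact: der_continuous (dfg x).
have lf := continuous_locint cf; have lg := continuous_locint cg.
split => // phi tp; have tp' := test_derive1 tp.
have i1 := intg_locint_test lf tp'; have i2 := intg_locint_test lg tp.
apply/eqP; rewrite -addr_eq0 addrC -intD//; apply/eqP.
have [_ [M hM]] := tp.
apply: (@int_der_cc _ (fun x => f x * phi x) _ M).
- by move=> x; apply: derM => //; exact: test_der.
- move=> x; apply: cvgD; apply: cvgM.
  + exact: cg.
  + exact: test_continuous.
  + exact: cf.
  + exact: test_continuous.
- by move=> x /hM ->; rewrite mulr0.
Qed.

End Mollifier.

(** * Density of test functions *)

Section Density.
Context {R : realType}.
Implicit Types (f g h phi K : R -> R) (x y N M L : R).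

Local Notation mu := (@lebesgue_measure R).
Local Notation mfun f := (measurable_fun setT (f : R -> R)).

(** A correlation rather than a convolution: test functions are paired with
    translates of the kernel, without reflection. *)
Definition corr K f x : R := \int[mu]_y (f y * K (y - x)).

Lemma test_shift K x : test_function K -> test_function (fun y => K (y - x)).
Proof.
move=> [sK [M hM]]; split.
  have := @smooth_affine R 1 1 (- x) K sK.
  by under eq_fun do rewrite !mul1r.
exists (M + `|x|) => y hy; apply: hM.
have : `|y| <= `|y - x| + `|x| by rewrite -[X in `|X| <= _](subrK x) ler_normD.
lra.
Qed.

Lemma intg_corr K f x : locint f -> test_function K -> intg (fun y => f y * K (y - x)).
Proof. by move=> lf tK; apply: intg_locint_test => //; exact: test_shift. Qed.

Lemma testN K : test_function K -> test_function (fun y => - K y).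
Proof.
move=> [sK [M hM]]; split.
  have := @smooth_affine R (-1) 1 0 K sK.
  by under eq_fun do rewrite mul1r addr0 mulN1r.
by exists M => y /hM ->; rewrite oppr0.
Qed.

(** Differentiating under the integral only moves the derivative to the kernel. *)
Lemma corr_der K f x : locint f -> test_function K ->
  der (corr K f) x (corr (fun z => - derive1 K z) f x).
Proof.
move=> lf tK; have tK' := test_derive1 tK.
have dK (y z : R) : der (fun z => f y * K (y - z)) z (f y * (- derive1 K (y - z))).
  apply: derZ; rewrite -mulrN1; apply: der_comp; first exact: test_der.
  by apply: der_eq (derB (der_cst y z) (der_id z)) _; rewrite sub0r.
have [B hB] : exists B : R, forall y, `|derive1 K y| <= B.
  have ck := test_continuous tK'.
  by case: tK' => _ [M hM]; exact: cc_bounded ck hM.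
have B0 : 0 <= B by exact: le_trans (hB 0).
have [_ [M hM]] := tK'.
pose L := `|M| + `|x| + 1.
pose G y := B * `|(f \_ `[- L, L]) y|.
have iG : intg G.
  apply: intgZ; apply: intg_norm.
  have [+ _] := @integrable_mkcond _ _ _ mu `[- L, L] (EFin \o f) (measurable_itv _).
  by move=> /(_ (locint_itv L lf)); rewrite /intg restrict_EFin.
have xI : [set` `]x - 1, x + 1[%R] x by rewrite /= in_itv/=; apply/andP; split; lra.
have Hd1 z y : (fun z => f y * K (y - z))^`() z = f y * - derive1 K (y - z).
  exact: der_derive1 (dK y z).
have := @cvg_differentiation_under_integral R _ _ mu (fun z y => f y * K (y - z))
  setT measurableT x (x - 1) (x + 1) xI.
move=> /(_ _ _ G) H.
apply: cvg_der.
have -> : corr (fun z => - derive1 K z) f x =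
    \int[mu]_(y in setT) partial1of2 (fun z y => f y * K (y - z)) x y.
  by apply: int_eq => y; rewrite /partial1of2 Hd1.
apply: cvg_trans (H _ _ _ iG _).
- apply: near_eq_cvg; apply: nearW => z.
  by rewrite /GRing.scale/= (addrC z).
- by move=> z _; exact: intg_corr.
- by move=> z y _ _; exact: der_derivable (dK y z).
- by move=> y; rewrite mulr_ge0.
- move=> z y; rewrite /= in_itv/= => /andP[z1 z2] _.
  rewrite /partial1of2 Hd1 normrM normrN /G patchE mulrC.
  case: ifPn => [_|]; first by rewrite ler_wpM2r.
  rewrite notin_setE /= in_itv /= -ler_norml => /negP; rewrite -ltNge => hy.
  rewrite hM ?normr0 ?mul0r ?mulr_ge0//.
  have : `|y| <= `|y - z| + `|z| by rewrite -[X in `|X| <= _](subrK z) ler_normD.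
  have : `|z| <= `|x| + 1.
    have : `|z - x| <= 1 by rewrite ler_norml; apply/andP; split; lra.
    have : `|z| <= `|z - x| + `|x| by rewrite -[X in `|X| <= _](subrK x) ler_normD.
    lra.
  have := ler_norm M; rewrite /L in hy; lra.
Qed.

Lemma smooth_corr K f : locint f -> test_function K -> smooth (corr K f).
Proof.
move=> lf tK.
apply: (@smooth_class _ (fun c => exists2 K, test_function K & c = corr K f)); last by exists K.
move=> _ [k tk ->]; exists (corr (fun z => - derive1 k z) f).
  exists (fun z => - derive1 k z) => //; apply: testN; exact: test_derive1.
by move=> x; exact: corr_der.
Qed.

Definition mker N z : R := N / bump_mass * bump (N * z).

Lemma kernE N x y : kern N x y = mker N (y - x).
Proof. by rewrite /kern /mker mulrBr. Qed.

Lemma moll_corr N f : moll N f = corr (mker N) f.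
Proof. by apply/funext => x; apply: int_eq => y; rewrite kernE. Qed.

Lemma test_mker N : 0 < N -> test_function (mker N).
Proof.
move=> N0; have := test_kern 0 N0; congr test_function.
by apply/funext => y; rewrite kernE subr0.
Qed.

Lemma smooth_moll N f : 0 < N -> locint f -> smooth (moll N f).
Proof. by move=> N0 lf; rewrite moll_corr; apply: smooth_corr => //; exact: test_mker. Qed.

Lemma moll_der N f g x : 0 < N -> wder f g -> der (moll N f) x (moll N g x).
Proof.
move=> N0 [lf lg fg]; rewrite moll_corr.
apply: der_eq (corr_der x lf (test_mker N0)) _.
rewrite moll_corr /corr.
have tm := test_mker N0.
have /fg := test_shift x tm.
have -> : derive1 (fun y => mker N (y - x)) = (fun y => derive1 (mker N) (y - x)).
  apply/funext => y; apply: der_derive1.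
  have h1 : der (fun y => y - x) y 1.
    by apply: der_eq (derB (der_id y) (der_cst x y)) _; rewrite subr0.
  by have := der_comp (f := mker N) (g := fun y => y - x) (test_der (y - x) tm) h1; rewrite mulr1.
move=> h; rewrite -[RHS]opprK -h -intN.
  by apply: int_eq => y; rewrite mulrN.
by apply: intg_corr => //; exact: test_derive1.
Qed.

Lemma moll_supp N f M : 1 <= N -> (forall x, M < `|x| -> f x = 0) ->
  forall x, M + 1 < `|x| -> moll N f x = 0.
Proof.
move=> N1 f0 x hx; have N0 : 0 < N by lra.
rewrite /moll (@int_eq _ _ (fun=> 0 * 0)).
  by rewrite intZ ?mul0r//; exact: integrable0.
move=> y; rewrite mul0r; have [hy|hy] := ltP M `|y|; first by rewrite f0 ?mul0r.
rewrite kern_out ?mulr0//.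
have : `|x| <= `|x - y| + `|y| by rewrite -[X in `|X| <= _](subrK y) ler_normD.
have : N^-1 <= 1 by rewrite invf_le1.
rewrite distrC; lra.
Qed.

(** Jensen's inequality for the probability density [kern N x]. *)
Lemma moll_sqr_le N f x : 0 < N -> inL2 f ->
  moll N f x ^+ 2 <= \int[mu]_y (f y ^+ 2 * kern N x y).
Proof.
move=> N0 hf; have lf := inL2_locint hf.
set c := moll N f x.
have i1 : intg (fun y => f y ^+ 2 * kern N x y).
  have [B hB] := kern_bounded x N0.
  have mk : mfun (kern N x) by apply: continuous_mfun; exact: continuous_kern.
  by apply: intg_eq (intg_bdd mk hB (inL2_sq hf)) => y; rewrite mulrC.
have i2 := intg_locint_kern x N0 lf.
have i3 := intg_kern x N0.
have : 0 <= \int[mu]_y ((f y - c) ^+ 2 * kern N x y).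
  by apply: int_ge0 => y; rewrite mulr_ge0 ?sqr_ge0// kern_ge0// ltW.
rewrite (@int_eq _ _ (fun y => f y ^+ 2 * kern N x y - 2 * c * (f y * kern N x y) +
   c ^+ 2 * kern N x y)); last by move=> y; ring.
have i4 := intgZ (2 * c) i2; have i5 := intgZ (c ^+ 2) i3.
have i6 := intgB i1 i4.
rewrite intD// intB// (intZ _ i2) (intZ _ i3) int_kern//; rewrite -/(moll N f x) -/c.
nra.
Qed.

(** Young's inequality, by Tonelli. *)
Lemma moll_inL2_nrm N f : 0 < N -> inL2 f ->
  inL2 (moll N f) /\ nrm (moll N f) <= nrm f.
Proof.
move=> N0 hf; have lf := inL2_locint hf.
have cm : continuous (moll N f).
  by move=> x; apply: der_continuous (smooth_der x (smooth_moll N0 lf)).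
have mm := continuous_mfun cm.
pose F (p : measurableTypeR R * measurableTypeR R) : \bar R := (f p.2 ^+ 2 * kern N p.1 p.2)%:E.
have mF : measurable_fun setT F.
  apply/measurable_EFinP; apply: measurable_funM.
    apply: measurable_funX; apply: (measurableT_comp (inL2_mfun hf)) => //.
  apply: measurable_funM => //.
  apply: (measurableT_comp (continuous_mfun (@continuous_bump R))).
  apply: measurable_funD; first exact: measurable_funM.
  by apply: measurableT_comp => //; exact: measurable_funM.
have F0 p : (0 <= F p)%E.
  by rewrite lee_fin mulr_ge0 ?sqr_ge0// kern_ge0// ltW.
have i1 x : intg (fun y => f y ^+ 2 * kern N x y).
  have [B hB] := kern_bounded x N0.
  have mk : mfun (kern N x) by apply: continuous_mfun; exact: continuous_kern.
  by apply: intg_eq (intg_bdd mk hB (inL2_sq hf)) => y; rewrite mulrC.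
have H : (\int[mu]_x (moll N f x ^+ 2)%:E <= \int[mu]_y (f y ^+ 2)%:E)%E.
  apply: (@le_trans _ _ (\int[mu]_x \int[mu]_y F (x, y))%E).
    apply: ge0_le_integral => //.
    - by move=> x _; rewrite lee_fin sqr_ge0.
    - by apply/measurable_EFinP; exact: measurable_funX.
    - exact: (@measurable_fun_fubini_tonelli_F _ _ _ _ R mu F mF F0).
    - by move=> x _; rewrite /F/= int_EFin// lee_fin; exact: moll_sqr_le.
  rewrite (@fubini_tonelli _ _ _ _ R mu mu F mF F0).
  rewrite le_eqVlt; apply/orP; left; apply/eqP.
  apply: eq_integral => y _; rewrite /F /=.
  under eq_integral do rewrite kernC EFinM.
  rewrite ge0_integralZl//.
  - by rewrite int_EFin ?int_kern ?mule1//; exact: intg_kern.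
  - by apply/measurable_EFinP; apply: continuous_mfun; exact: continuous_kern.
  - by move=> x _; rewrite lee_fin kern_ge0// ltW.
  - by rewrite lee_fin sqr_ge0.
have i2 : intg (fun x => moll N f x ^+ 2).
  apply/integrableP; split; first by apply/measurable_EFinP; exact: measurable_funX.
  under eq_integral do rewrite /= ger0_norm ?sqr_ge0//.
  apply: le_lt_trans H _; rewrite int_EFin ?ltry//; exact: inL2_sq.
split; first by split.
by apply: ler_wsqrtr; rewrite -lee_fin -!int_EFin//; exact: inL2_sq.
Qed.

Lemma moll_linear N f g x : 0 < N -> locint f -> locint g ->
  moll N (fun y => f y - g y) x = moll N f x - moll N g x.
Proof.
move=> N0 lf lg; rewrite /moll -intB; [|exact: intg_locint_kern|exact: intg_locint_kern].
by apply: int_eq => y; ring.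
Qed.

Lemma moll_bounded N f B x : 0 < N -> mfun f -> (forall y, `|f y| <= B) -> `|moll N f x| <= B.
Proof.
move=> N0 mf hB; have B0 : 0 <= B by exact: le_trans (hB 0).
have i := intg_bdd mf hB (intg_kern x N0).
apply: le_trans (int_norm i) _.
rewrite -[leRHS]mulr1 -(int_kern x N0) -intZ; last exact: intg_kern.
apply: int_le; [exact: intg_norm|by apply: intgZ; exact: intg_kern|move=> y].
have k0 : 0 <= kern N x y by rewrite kern_ge0// ltW.
by rewrite normrM (ger0_norm k0) ler_wpM2r.
Qed.

Lemma bounded_cc_inL2 f B M : mfun f -> (forall x, `|f x| <= B) ->
  (forall x, M < `|x| -> f x = 0) -> inL2 f.
Proof.
move=> mf hB h0; split => //.
apply: (@intg_itv _ _ M); first by move=> x /h0 ->; rewrite expr0n.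
apply: measurable_bounded_integrable => //.
- rewrite /= lebesgue_measure_itv/=; case: ifPn => // _.
  by rewrite -EFinD ltry.
- by apply: measurable_funX; exact: measurable_funS mf.
- exists (B ^+ 2); split; first exact: num_real.
  move=> r Br x _; apply: le_trans (ltW Br); rewrite normrX lerXn2r ?nnegrE//.
  exact: le_trans (hB 0).
Qed.

(** Almost every point is a Lebesgue point; the mollified functions are bounded
    and supported in a fixed interval, so that dominated convergence applies. *)
Lemma moll_cvg_bounded f B M : mfun f -> (forall x, `|f x| <= B) ->
  (forall x, M < `|x| -> f x = 0) ->
  nrm (fun x => moll n.+1%:R f x - f x) @[n --> \oo] --> 0.
Proof.
move=> mf hB h0; have B0 : 0 <= B by exact: le_trans (hB 0).
have hf := bounded_cc_inL2 mf hB h0.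
have lf := inL2_locint hf.
have hu : (n.+1%:R : R)^-1 @[n --> \oo] --> (0 : R) by exact: cvg_harmonic.
have n0 n : 0 < n.+1%:R :> R by rewrite ltr0n.
pose g := (fun=> 2 * B : R) \_ `[- (M + 1), M + 1].
apply: (@nrm_cvg0_dct _ _ _ g).
- by move=> n; apply: inL2_mfun; case: (moll_inL2_nrm (n0 n) hf).
- exact: mf.
- apply: aeS (lebesgue_differentiation lf) => x hx.
  exact: (moll_lebesgue_pt lf hx n0 hu).
- move=> n x; rewrite /g patchE; case: ifPn => [_|].
    apply: le_trans (ler_normB _ _) _.
    have := moll_bounded x (n0 n) mf hB; have := hB x; lra.
  rewrite notin_setE /= in_itv /= -ler_norml => /negP; rewrite -ltNge => hy.
  rewrite (moll_supp _ h0)// ?h0 ?subrr ?normr0//; last by rewrite ler1n.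
  lra.
- apply: (@bounded_cc_inL2 _ (2 * B) (M + 1)).
  + by apply/(measurable_restrictT _ _).1 => //; exact: measurable_cst.
  + by move=> x; rewrite /g patchE; case: ifPn; rewrite ?normr0 ?ger0_norm ?mulr_ge0.
  + move=> x hx; rewrite /g patchE ifN// notin_setE /= in_itv /= -ler_norml.
    by apply/negP; rewrite -ltNge.
Qed.

Definition trunc (k : R) f x : R := Num.max (- k) (Num.min k (f x)).

Lemma trunc_bound k f x : 0 <= k -> `|trunc k f x| <= `|f x| /\ `|trunc k f x| <= k.
Proof.
move=> k0; rewrite /trunc; have [h|h] := leP (f x) k.
  have [h'|h'] := leP (- k) (f x).
    by split => //; rewrite ler_norml h' h.
  rewrite normrN ger0_norm//; split => //.
  by rewrite ler_normr; apply/orP; right; lra.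
rewrite max_r; last by lra.
by rewrite ger0_norm//; split => //; rewrite ler_normr ltW.
Qed.

Lemma trunc_cvg f : inL2 f -> nrm (fun x => trunc n%:R f x - f x) @[n --> \oo] --> 0.
Proof.
move=> hf; have mf := inL2_mfun hf.
apply: (@nrm_cvg0_dct _ _ _ (fun x => `|2 * f x|)) => //.
- move=> n; apply: measurable_maxr; first exact: measurable_cst.
  by apply: measurable_minr => //; exact: measurable_cst.
- apply: ae_forall => x; apply: cvg_near_cst.
  near=> n.
  have : `|f x| <= n%:R by near: n; exact: nbhs_infty_ger.
  rewrite ler_norml => /andP[h1 h2].
  by rewrite /trunc min_r// max_r.
- move=> n x; apply: le_trans (ler_normB _ _) _.
  have [] := trunc_bound f x (ler0n R n).
  rewrite normrM (@ger0_norm _ 2)//; lra.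
- apply: inL2_le (inL2Z 2 hf) => [|x]; last by rewrite normr_id.
  by apply: measurableT_comp => //; exact: measurable_funM.
Unshelve. all: by end_near. Qed.

(** Truncation reduces to bounded functions, mollification being a contraction. *)
Lemma moll_cvg f M : inL2 f -> (forall x, M < `|x| -> f x = 0) ->
  nrm (fun x => moll n.+1%:R f x - f x) @[n --> \oo] --> 0.
Proof.
move=> hf h0; have lf := inL2_locint hf.
have n0 n : 0 < n.+1%:R :> R by rewrite ltr0n.
apply/cvgrPdist_lt => e e0.
have e3 : 0 < e / 3 by rewrite divr_gt0.
have /cvgrPdist_lt /(_ _ e3) [k _ /(_ k (leqnn k))] := trunc_cvg hf.
rewrite sub0r normrN ger0_norm ?nrm_ge0// => hk.
set g := trunc k%:R f in hk.
have mg : mfun g.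
  apply: measurable_maxr; first exact: measurable_cst.
  by apply: measurable_minr; [exact: measurable_cst|exact: inL2_mfun].
have gB x : `|g x| <= k%:R.
  by have [] := trunc_bound f x (ler0n R k).
have g0 x : M < `|x| -> g x = 0.
  move=> /h0 fx; rewrite /g /trunc fx; have : 0 <= k%:R :> R by rewrite ler0n.
  by move: k%:R => k' k0; rewrite min_r// max_r// oppr_le0.
have hg := bounded_cc_inL2 mg gB g0.
have lg := inL2_locint hg.
have /cvgrPdist_lt /(_ _ e3) := moll_cvg_bounded mg gB g0.
apply: filterS => n; rewrite !sub0r !normrN !ger0_norm ?nrm_ge0// => hn.
have [mf1 _] := moll_inL2_nrm (n0 n) hf.
have [mg1 _] := moll_inL2_nrm (n0 n) hg.
have h1 := nrmB_tri mf1 mg1 hf.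
have h2 := nrmB_tri mg1 hg hf.
have : nrm (fun x => moll n.+1%:R f x - moll n.+1%:R g x) <= nrm (fun x => g x - f x).
  rewrite [leRHS]nrmBC.
  rewrite (@nrm_eq _ _ (moll n.+1%:R (fun x => f x - g x))).
    by have [] := moll_inL2_nrm (n0 n) (inL2B hf hg).
  by move=> x; rewrite moll_linear.
move=> h3; apply: le_lt_trans h1 _; apply: le_lt_trans (lerD h3 h2) _.
have -> : e = e / 3 + (e / 3 + e / 3) by field.
by apply: ltrD => //; exact: ltrD.
Qed.

End Density.

(** * The energy space *)

Section SigmaReal.
Context {R : realType}.
Implicit Types (f g h phi K : R -> R) (x y N M L e : R).

Local Notation mu := (@lebesgue_measure R).
Local Notation mfun f := (measurable_fun setT (f : R -> R)).

(** Membership of the real-valued [f] in the energy space, together with a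
    weak derivative [g] of it. *)
Definition inSig f g := [/\ inL2 f, inL2 g, inL2 (fun x => x * f x) & wder f g].

(** The Sigma-distance of two functions with given weak derivatives. *)
Definition sdist f g f' g' : R :=
  nrm (fun x => f x - f' x) + nrm (fun x => g x - g' x) +
  nrm (fun x => x * f x - x * f' x).

Lemma test_moll N f M : 1 <= N -> locint f -> (forall x, M < `|x| -> f x = 0) ->
  test_function (moll N f).
Proof.
move=> N1 lf f0; split; first by apply: smooth_moll => //; lra.
by exists (M + 1); exact: moll_supp.
Qed.

Lemma inSig_density_cc f g M e : inSig f g -> 0 < e -> (forall x, M < `|x| -> f x = 0) ->
  (forall x, M < `|x| -> g x = 0) ->
  exists2 phi, test_function phi & sdist phi (derive1 phi) f g < e.
Proof.
move=> [hf hg hxf fg] e0 f0 g0.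
pose A := `|M| + 1; have A1 : 1 <= A by rewrite lerDr.
have ed : 0 < e / (4 * A) by rewrite divr_gt0//; lra.
have /cvgrPdist_lt /(_ _ ed) [k1 _ h1] := moll_cvg hf f0.
have /cvgrPdist_lt /(_ _ ed) [k2 _ h2] := moll_cvg hg g0.
pose k := maxn k1 k2; pose N : R := k.+1%:R.
have {h1} := h1 k (leq_maxl _ _); have {h2} := h2 k (leq_maxr _ _).
rewrite /= !sub0r !normrN !(ger0_norm (nrm_ge0 _)) => h2 h1.
have N1 : 1 <= N by rewrite ler1n.
have N0 : 0 < N by rewrite ltr0n.
exists (moll N f); first by apply: (test_moll N1 (inL2_locint hf) f0).
have -> : derive1 (moll N f) = moll N g.
  by apply/funext => x; apply: der_derive1; exact: moll_der.
have [mf _] := moll_inL2_nrm N0 hf.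
have [mg _] := moll_inL2_nrm N0 hg.
have i1 := inL2B mf hf.
have hx : nrm (fun x => x * moll N f x - x * f x) <= A * nrm (fun x => moll N f x - f x).
  have -> : A * nrm (fun x => moll N f x - f x) = nrm (fun x => A * (moll N f x - f x)).
    by rewrite nrmZ// ger0_norm//; lra.
  have dom x : `|x * moll N f x - x * f x| <= `|A * (moll N f x - f x)|.
    rewrite -mulrBr !normrM (@ger0_norm _ A); last by lra.
    have [h|h] := leP `|x| A; first by rewrite ler_wpM2r.
    rewrite (moll_supp N1 f0) ?f0 ?subrr ?normr0 ?mulr0//.
    + by have := ler_norm M; rewrite /A in h; lra.
    + by have := ler_norm M; rewrite /A in h; lra.
  apply: nrm_le => //; last exact: inL2Z.
  apply: inL2_le dom (inL2Z A i1); apply: measurable_funB; last exact: inL2_mfun hxf.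
  by apply: measurable_funM => //; exact: inL2_mfun.
have h1' : A * nrm (fun x => moll N f x - f x) < e / 4.
  rewrite mulrC -ltr_pdivlMr; last by lra.
  by rewrite (_ : e / 4 / A = e / (4 * A))//; field; rewrite gt_eqF//; lra.
have h3 : e / (4 * A) <= e / 4.
  by apply: ler_wpM2l; [exact: ltW|rewrite lef_pV2 ?posrE; lra].
rewrite /sdist; lra.
Qed.

Lemma bump0_gt0 : 0 < bump 0 :> R.
Proof. by apply: bump_gt0; rewrite normr0. Qed.

Definition cutoff N x : R := (bump 0)^-1 * bump (N^-1 * x + 0).

Lemma smooth_cutoff N : smooth (cutoff N).
Proof. exact: (@smooth_affine R _ _ _ _ smooth_bump). Qed.

Lemma cutoff_bound N x : `|cutoff N x| <= (bump 0)^-1.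
Proof.
have b0 := bump0_gt0.
have b1 : 0 <= (bump 0 : R)^-1 by rewrite invr_ge0 ltW.
by rewrite /cutoff normrM (ger0_norm b1) (ger0_norm (bump_ge0 _)) ler_piMr// bump_le1.
Qed.

Lemma cutoff_supp N x : 0 < N -> N < `|x| -> cutoff N x = 0.
Proof.
move=> N0 h; have h1 : 1 <= `|N^-1 * x + 0|.
  by rewrite addr0 normrM normfV (gtr0_norm N0) ler_pdivlMl// mulr1 ltW.
by rewrite /cutoff (bump_out h1) mulr0.
Qed.

Lemma cutoff_der N x : der (cutoff N) x ((bump 0)^-1 * (derive1 bump (N^-1 * x + 0) * N^-1)).
Proof.
apply: derZ; apply: der_comp; first exact: (smooth_der _ smooth_bump).
by apply: der_eq (derD (derZ N^-1 (der_id x)) (der_cst 0 x)) _; rewrite mulr1 addr0.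
Qed.

(** The derivative of the cutoff tends to 0 uniformly: cutting off does not
    change the weak derivative much. *)
Lemma cutoff_der_bound : exists2 C : R, 0 <= C & forall N x, 0 < N ->
  `|derive1 (cutoff N) x| <= C / N.
Proof.
have cb : continuous (derive1 (@bump R)).
  by move=> x; exact: (der_continuous (smooth_der x (smooth_derive1 smooth_bump))).
have sb : forall x, 1 < `|x| -> derive1 (@bump R) x = 0.
  by apply: der_support (@bump_supp R) => x; exact: (smooth_der _ smooth_bump).
have [B hB] := cc_bounded cb sb.
have b0 := bump0_gt0.
exists (B / bump 0).
  by apply: divr_ge0; [exact: le_trans (hB 0)|exact: ltW].
move=> N x N0; rewrite (der_derive1 (cutoff_der N x)) !normrM !normfV.
rewrite (gtr0_norm b0) (gtr0_norm N0) (mulrC B) -mulrA.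
apply: ler_wpM2l; first by rewrite invr_ge0 ltW.
by apply: ler_wpM2r => //; rewrite invr_ge0 ltW.
Qed.

Lemma cutoff_cvg1 x : cutoff n.+1%:R x @[n --> \oo] --> (1 : R).
Proof.
have b0 := bump0_gt0.
have e1 : 1 = (bump 0)^-1 * bump (0 * x + 0) :> R by rewrite mul0r addr0 mulVf// gt_eqF.
rewrite [X in _ --> X]e1.
have h : (n.+1%:R)^-1 * x + 0 @[n --> \oo] --> 0 * x + 0.
  by apply: cvgD; [apply: cvgM; [exact: cvg_harmonic|exact: cvg_cst]|exact: cvg_cst].
have := cvg_comp _ _ h (@continuous_bump R _) => hb.
by apply: cvgM; [exact: cvg_cst|exact: hb].
Qed.

Lemma cutoff_nrm f : inL2 f ->
  nrm (fun x => cutoff n.+1%:R x * f x - f x) @[n --> \oo] --> 0.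
Proof.
move=> hf; have b0 := bump0_gt0; have mf := inL2_mfun hf.
have mc N : mfun (cutoff N).
  by apply: continuous_mfun => x; exact: (der_continuous (cutoff_der N x)).
apply: (@nrm_cvg0_dct _ _ _ (fun x => `|((bump 0)^-1 + 1) * f x|)) => //.
- by move=> n; exact: measurable_funM.
- apply: ae_forall => x; rewrite -[X in _ --> X]mul1r.
  by apply: cvgMl; exact: cutoff_cvg1.
- move=> n x; apply: le_trans (ler_normB _ _) _.
  rewrite (normrM (cutoff _ _)) (normrM (_ + 1)).
  rewrite (@ger0_norm _ (_ + 1)); last by rewrite addr_ge0// invr_ge0 ltW.
  rewrite mulrDl mul1r lerD2r; apply: ler_wpM2r => //; exact: cutoff_bound.
- apply: inL2_le (inL2Z ((bump 0)^-1 + 1) hf) => [|x]; last by rewrite normr_id.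
  by apply: measurableT_comp => //; exact: measurable_funM.
Qed.

(** Cut off, then mollify. *)
Lemma inSig_density f g e : inSig f g -> 0 < e ->
  exists2 phi, test_function phi & sdist phi (derive1 phi) f g < e.
Proof.
move=> [hf hg hxf fg] e0.
have lf := inL2_locint hf; have lg := inL2_locint hg.
have mc N : mfun (cutoff N).
  by apply: continuous_mfun => x; exact: (der_continuous (cutoff_der N x)).
have cc' N : continuous (derive1 (cutoff N)).
  by move=> x; exact: (der_continuous (smooth_der x (smooth_derive1 (smooth_cutoff (N := N))))).
have mc' N : mfun (derive1 (cutoff N)) by exact: continuous_mfun.
have [C C0 hC] := cutoff_der_bound.
have e8 : 0 < e / 8 by lra.
have [k1 _ h1] : \forall n \near \oo, nrm (fun x => cutoff n.+1%:R x * f x - f x) < e / 8.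
  have /cvgrPdist_lt /(_ _ e8) := cutoff_nrm hf.
  by apply: filterS => n; rewrite sub0r normrN ger0_norm ?nrm_ge0.
have [k2 _ h2] : \forall n \near \oo, nrm (fun x => cutoff n.+1%:R x * g x - g x) < e / 8.
  have /cvgrPdist_lt /(_ _ e8) := cutoff_nrm hg.
  by apply: filterS => n; rewrite sub0r normrN ger0_norm ?nrm_ge0.
have [k3 _ h3] : \forall n \near \oo, nrm (fun x => cutoff n.+1%:R x * (x * f x) - x * f x) < e / 8.
  have /cvgrPdist_lt /(_ _ e8) := cutoff_nrm hxf.
  by apply: filterS => n; rewrite sub0r normrN ger0_norm ?nrm_ge0.
have [k4 _ h4] : \forall n \near \oo, C / n.+1%:R * nrm f < e / 8.
  have ed : 0 < e / 8 / (C * nrm f + 1) by rewrite divr_gt0// ltr_wpDl// mulr_ge0 ?nrm_ge0.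
  have /cvgrPdist_lt /(_ _ ed) := @cvg_harmonic R.
  apply: filterS => n; rewrite sub0r normrN ger0_norm ?invr_ge0// ltr_pdivlMr; last first.
    by rewrite ltr_wpDl// mulr_ge0 ?nrm_ge0.
  apply: le_lt_trans; rewrite -mulrA mulrCA ler_wpM2l ?invr_ge0//.
  by rewrite lerDl.
pose k := maxn (maxn k1 k2) (maxn k3 k4); pose N : R := k.+1%:R.
have N0 : 0 < N by rewrite ltr0n.
have {}h1 := h1 k (leq_trans (leq_maxl _ _) (leq_maxl _ _)).
have {}h2 := h2 k (leq_trans (leq_maxr _ _) (leq_maxl _ _)).
have {}h3 := h3 k (leq_trans (leq_maxl _ _) (leq_maxr _ _)).
have {}h4 := h4 k (leq_trans (leq_maxr _ _) (leq_maxr _ _)).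
rewrite /= -/N in h1 h2 h3 h4.
pose f1 x := cutoff N x * f x.
pose g1 x := derive1 (cutoff N) x * f x + cutoff N x * g x.
have hf1 : inL2 f1 by apply: (inL2_bdd (mc N) _ hf) => x; exact: cutoff_bound.
have hcf : inL2 (fun x => derive1 (cutoff N) x * f x).
  by apply: (inL2_bdd (mc' N) _ hf) => x; exact: hC.
have hcg : inL2 (fun x => cutoff N x * g x).
  by apply: (inL2_bdd (mc N) _ hg) => x; exact: cutoff_bound.
have hg1 : inL2 g1 by exact: inL2D.
have hxf1 : inL2 (fun x => x * f1 x).
  have : inL2 (fun x => cutoff N x * (x * f x)).
    by apply: (inL2_bdd (mc N) _ hxf) => x; exact: cutoff_bound.
  by apply: inL2_ae; [apply: measurable_funM => //; exact: inL2_mfun|apply: ae_forall => x; rewrite /f1; ring].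
have w1 : wder f1 g1.
  split; [exact: inL2_locint|exact: inL2_locint|move=> phi tp].
  have [_ _ fgt] := fg.
  have tcp := testM tp (smooth_cutoff (N := N)).
  have tc'p := testM tp (smooth_derive1 (smooth_cutoff (N := N))).
  have dE : derive1 (fun x => cutoff N x * phi x) =
      (fun x => derive1 (cutoff N) x * phi x + cutoff N x * derive1 phi x).
    apply/funext => x; apply: der_derive1; apply: derM; last exact: test_der.
    exact: (smooth_der _ (smooth_cutoff (N := N))).
  have := fgt _ tcp; rewrite dE => hE.
  have i1 : intg (fun x => f x * (derive1 (cutoff N) x * phi x)) by exact: intg_locint_test.
  have i2 : intg (fun x => f x * (cutoff N x * derive1 phi x)).
    by apply: intg_locint_test => //; apply: testM (smooth_cutoff (N := N)); exact: test_derive1.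
  have i3 : intg (fun x => g x * (cutoff N x * phi x)) by exact: intg_locint_test.
  have -> : \int[mu]_x (f1 x * derive1 phi x) = \int[mu]_x (f x * (cutoff N x * derive1 phi x)).
    by apply: int_eq => x; rewrite /f1; ring.
  have -> : \int[mu]_x (g1 x * phi x) =
     \int[mu]_x (f x * (derive1 (cutoff N) x * phi x) + g x * (cutoff N x * phi x)).
    by apply: int_eq => x; rewrite /g1; ring.
  rewrite intD//.
  move: hE; rewrite (@int_eq _ _ (fun x => f x * (derive1 (cutoff N) x * phi x) +
    f x * (cutoff N x * derive1 phi x))); last by move=> x; ring.
  by rewrite intD//; lra.
have f10 x : N < `|x| -> f1 x = 0 by move=> h; rewrite /f1 cutoff_supp ?mul0r.
have g10 x : N < `|x| -> g1 x = 0.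
  move=> h; rewrite /g1 cutoff_supp// mul0r addr0.
  have -> : derive1 (cutoff N) x = 0; last by rewrite mul0r.
  apply: (@der_support _ _ (cutoff N) N) h => y.
    exact: (smooth_der _ (smooth_cutoff (N := N))).
  exact: cutoff_supp.
have s1 : inSig f1 g1 by [].
have e2 : 0 < e / 2 by lra.
have [phi tp hphi] := inSig_density_cc s1 e2 f10 g10.
exists phi => //.
have tL := test_inL2 tp; have tL' := test_inL2 (test_derive1 tp).
have txL : inL2 (fun x => x * phi x) by exact: test_inL2 (testM tp smooth_id).
have a1 := nrmB_tri tL hf1 hf.
have a2 := nrmB_tri tL' hg1 hg.
have a3 := nrmB_tri txL hxf1 hxf.
have b2 : nrm (fun x => g1 x - g x) <= e / 8 + e / 8.
  rewrite (@nrm_eq _ _ (fun x => derive1 (cutoff N) x * f x + (cutoff N x * g x - g x))); last first.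
    by move=> x; rewrite /g1; ring.
  apply: le_trans (nrmD hcf (inL2B hcg hg)) _; apply: lerD; last exact: ltW.
  apply: le_trans (ltW h4); apply: nrm_bdd => // x; exact: hC.
have b3 : nrm (fun x => x * f1 x - x * f x) < e / 8.
  by rewrite (@nrm_eq _ _ (fun x => cutoff N x * (x * f x) - x * f x))// => x; rewrite /f1; ring.
have b1 : nrm (fun x => f1 x - f x) < e / 8 by exact: h1.
rewrite /sdist in hphi *; lra.
Qed.

(** The square is the integral of twice [phi] times its derivative, from the left
    of the support. *)
Lemma test_sup_bound phi x : test_function phi ->
  phi x ^+ 2 <= nrm phi ^+ 2 + nrm (derive1 phi) ^+ 2.
Proof.
move=> tp; have [sp [M hM]] := tp; have tp' := test_derive1 tp.
have hp := test_inL2 tp; have hp' := test_inL2 tp'.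
pose L := `|M| + `|x| + 1.
have xL : - L < x by have := ler_norm (- x); rewrite normrN /L; have := normr_ge0 M; lra.
have cf : continuous (fun y => 2 * (phi y * derive1 phi y)).
  by move=> y; apply: cvgMr; apply: cvgM; apply: test_continuous.
have dF y : der (fun y => phi y ^+ 2) y (2 * (phi y * derive1 phi y)).
  apply: der_eq (derX 2 (test_der y tp)) _; rewrite expr1; ring.
have := int_FTC xL dF cf.
have -> : phi (- L) = 0.
  apply: hM; rewrite normrN ger0_norm /L; last by rewrite !addr_ge0.
  by have := ler_norm M; have := normr_ge0 x; lra.
rewrite expr0n subr0 => <-.
rewrite !nrm_sq -intD; [|exact: inL2_sq|exact: inL2_sq].
have i1 : intg (fun y => phi y ^+ 2 + derive1 phi y ^+ 2) by apply: intgD; exact: inL2_sq.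
have i2 : intg (fun y => 2 * (phi y * derive1 phi y)) by apply: intgZ; exact: inL2M.
rewrite Rintegral_mkcond; apply: int_le => //.
  exact: intg_restrict.
move=> y; rewrite patchE; have s1 := sqr_ge0 (phi y - derive1 phi y).
have s2 := sqr_ge0 (phi y); have s3 := sqr_ge0 (derive1 phi y).
case: ifPn => _; [by nra|exact: addr_ge0].
Qed.

(** Sobolev embedding in dimension one: the bound passes to limits in L2 once it is
    paired with a nonnegative test function. *)
Lemma inSig_sup_bound f g : inSig f g ->
  {ae mu, forall x : R, f x ^+ 2 <= nrm f ^+ 2 + nrm g ^+ 2}.
Proof.
move=> hS; have [hf hg _ _] := hS.
pose S := nrm f ^+ 2 + nrm g ^+ 2.
have lS : locint (fun x => S + -1 * f x ^+ 2).
  apply: locintD; first by apply: continuous_locint => x; exact: cvg_cst.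
  by apply: locintZ; apply: open_integrable_locally; [exact: openT|exact: inL2_sq].
suff : {ae mu, forall x : R, 0 <= S + -1 * f x ^+ 2} by apply: aeS => x; rewrite /S; lra.
apply: ae_ge0_test => // th tth th0.
have ith : intg th.
  by have [_ [M hM]] := tth; apply: (@intg_cc _ _ M) => //; exact: test_continuous.
have [B hB] : exists B : R, forall x, `|th x| <= B.
  by have ct := test_continuous tth; case: tth => _ [M hM]; exact: cc_bounded ct hM.
have B0 : 0 <= B by exact: le_trans (hB 0).
have mth : mfun th by apply: continuous_mfun; exact: test_continuous.
pose T := \int[mu]_x th x; have T0 : 0 <= T by exact: int_ge0.
have if2 : intg (fun x => f x ^+ 2 * th x).
  by apply: intg_eq (intg_bdd mth hB (inL2_sq hf)) => x; rewrite mulrC.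
have -> : \int[mu]_x ((S + -1 * f x ^+ 2) * th x) = S * T - \int[mu]_x (f x ^+ 2 * th x).
  rewrite -intZ// -intB//; last exact: intgZ.
  by apply: int_eq => x; ring.
pose D := (2 * nrm f + 1) * T + (2 * nrm g + 1) * T + B * (2 * nrm f + 1).
have nf0 := nrm_ge0 f; have ng0 := nrm_ge0 g.
have D0 : 0 <= D by rewrite /D !addr_ge0 ?mulr_ge0; lra.
suff key e : 0 < e -> e <= 1 -> - (e * D) <= S * T - \int[mu]_x (f x ^+ 2 * th x).
  rewrite leNgt; apply/negP => neg.
  set X := S * T - _ in key neg.
  pose e := Num.min 1 (- X / (2 * (D + 1))).
  have h1 : 0 < - X / (2 * (D + 1)) by rewrite divr_gt0; lra.
  have e0 : 0 < e by rewrite lt_min ltr01 h1.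
  have e1 : e <= 1 by rewrite ge_min lexx.
  have e2 : e * (2 * (D + 1)) <= - X.
    by rewrite -ler_pdivlMr; [rewrite ge_min lexx orbT|lra].
  have := key e e0 e1; nra.
move=> e0 e1; have [phi tp hphi] := inSig_density hS e0.
have hp := test_inL2 tp; have hp' := test_inL2 (test_derive1 tp).
have np0 := nrm_ge0 phi; have np0' := nrm_ge0 (derive1 phi).
have d1 : nrm (fun x => phi x - f x) <= e.
  by have := nrm_ge0 (fun x => derive1 phi x - g x); have := nrm_ge0 (fun x => x * phi x - x * f x); rewrite /sdist in hphi; lra.
have d2 : nrm (fun x => derive1 phi x - g x) <= e.
  by have := nrm_ge0 (fun x => phi x - f x); have := nrm_ge0 (fun x => x * phi x - x * f x); rewrite /sdist in hphi; lra.
have n1 : nrm phi <= nrm f + e.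
  rewrite (@nrm_eq _ _ (fun x => f x + (phi x - f x))); last by move=> x; ring.
  by apply: le_trans (nrmD hf (inL2B hp hf)) _; rewrite lerD2l.
have n2 : nrm (derive1 phi) <= nrm g + e.
  rewrite (@nrm_eq _ (derive1 phi) (fun x => g x + (derive1 phi x - g x))); last by move=> x; ring.
  by apply: le_trans (nrmD hg (inL2B hp' hg)) _; rewrite lerD2l.
have ip2 : intg (fun x => phi x ^+ 2 * th x).
  by apply: intg_eq (intg_bdd mth hB (inL2_sq hp)) => x; rewrite mulrC.
have a1 : \int[mu]_x (phi x ^+ 2 * th x) <= (nrm phi ^+ 2 + nrm (derive1 phi) ^+ 2) * T.
  rewrite -intZ//; apply: int_le => //; first exact: intgZ.
  by move=> x; rewrite ler_wpM2r//; exact: test_sup_bound.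
have a2 : \int[mu]_x (f x ^+ 2 * th x) - \int[mu]_x (phi x ^+ 2 * th x) <=
    e * (B * (2 * nrm f + 1)).
  rewrite -intB// (@int_eq _ _ (fun x => (f x - phi x) * (th x * (f x + phi x)))); last first.
    by move=> x; ring.
  apply: le_trans (ler_norm _) _.
  have i3 := inL2_bdd mth hB (inL2D hf hp).
  apply: le_trans (cauchy_schwarz (inL2B hf hp) i3) _.
  apply: ler_pM; rewrite ?nrm_ge0//; first by rewrite nrmBC.
  apply: le_trans (nrm_bdd mth hB (inL2D hf hp)) _; rewrite ler_wpM2l//.
  by apply: le_trans (nrmD hf hp) _; lra.
have a3 : (nrm phi ^+ 2 + nrm (derive1 phi) ^+ 2) * T <=
    (S + e * (2 * nrm f + 1) + e * (2 * nrm g + 1)) * T.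
  by rewrite ler_wpM2r// /S; nra.
rewrite /D; lra.
Qed.

End SigmaReal.

(** * The energy estimate *)

Section Energy.
Context {R : realType}.
Implicit Types (f g phi : R -> R) (s t r : R).

Local Notation mu := (@lebesgue_measure R).
Local Notation mfun f := (measurable_fun setT (f : R -> R)).

Lemma le_arbitrary (x y D : R) : 0 <= D ->
  (forall e, 0 < e -> x <= y + D * e) -> x <= y.
Proof.
move=> D0 h; apply/ler_addgt0Pr => e e0.
have e1 : 0 < e / (D + 1) by rewrite divr_gt0//; lra.
apply: le_trans (h _ e1) _; rewrite lerD2l mulrCA ger_pMr// ler_pdivrMr; lra.
Qed.

Context (eps : R) (eps_gt0 : 0 < eps).

(** The energy form of the harmonic oscillator, divided by eps. *)
Definition hform f f' g g' : R :=
  eps / 2 * \int[mu]_x (f' x * g' x) +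
  (2 * eps)^-1 * \int[mu]_x ((x * f x) * (x * g x)).

Lemma hformC f f' g g' : hform f f' g g' = hform g g' f f'.
Proof. by congr (_ * _ + _ * _); apply: int_eq => x; rewrite mulrC. Qed.

Definition snrm f f' : R := nrm f + nrm f' + nrm (fun x => x * f x).

Lemma snrm_ge0 f f' : 0 <= snrm f f'.
Proof. by rewrite !addr_ge0 ?nrm_ge0. Qed.

Lemma inSigD f f' g g' : inSig f f' -> inSig g g' ->
  inSig (fun x => f x + g x) (fun x => f' x + g' x).
Proof.
move=> [f1 f2 f3 f4] [g1 g2 g3 g4]; split; [exact: inL2D|exact: inL2D| |exact: wderD].
have := inL2D f3 g3; apply: inL2_ae; last by apply: ae_forall => x; ring.
by apply: measurable_funM => //; apply: measurable_funD; exact: inL2_mfun.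
Qed.

Lemma inSigZ c f f' : inSig f f' -> inSig (fun x => c * f x) (fun x => c * f' x).
Proof.
move=> [f1 f2 f3 f4]; split; [exact: inL2Z|exact: inL2Z| |exact: wderZ].
have := inL2Z c f3; apply: inL2_ae; last by apply: ae_forall => x; ring.
by apply: measurable_funM => //; apply: measurable_funM => //; exact: inL2_mfun.
Qed.

Lemma inSigB f f' g g' : inSig f f' -> inSig g g' ->
  inSig (fun x => f x - g x) (fun x => f' x - g' x).
Proof.
move=> hf hg; have := inSigD hf (inSigZ (-1) hg).
by congr inSig; apply/funext => x; rewrite mulN1r.
Qed.

Lemma snrmB f f' g g' : snrm (fun x => f x - g x) (fun x => f' x - g' x) = sdist f f' g g'.
Proof. by congr (_ + _ + _); apply: nrm_eq => x; rewrite mulrBr. Qed.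

Lemma sdistC f f' g g' : sdist f f' g g' = sdist g g' f f'.
Proof. by congr (_ + _ + _); exact: nrmBC. Qed.

Lemma snrmD f f' g g' : inSig f f' -> inSig g g' ->
  snrm (fun x => f x + g x) (fun x => f' x + g' x) <= snrm f f' + snrm g g'.
Proof.
move=> [f1 f2 f3 _] [g1 g2 g3 _]; rewrite /snrm.
have := nrmD f1 g1; have := nrmD f2 g2; have := nrmD f3 g3.
rewrite (@nrm_eq _ (fun x => x * (f x + g x)) (fun x => x * f x + x * g x)); first lra.
by move=> x; rewrite mulrDr.
Qed.

Lemma hformBl f f' g g' h h' : inSig f f' -> inSig g g' -> inSig h h' ->
  hform (fun x => f x - g x) (fun x => f' x - g' x) h h' =
  hform f f' h h' - hform g g' h h'.
Proof.
move=> [f1 f2 f3 _] [g1 g2 g3 _] [h1 h2 h3 _].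
rewrite /hform.
rewrite (@int_eq _ (fun x => (f' x - g' x) * h' x) (fun x => f' x * h' x - g' x * h' x)); last by move=> x; ring.
rewrite (@int_eq _ (fun x => x * (f x - g x) * (x * h x)) (fun x => (x * f x) * (x * h x) - (x * g x) * (x * h x))); last by move=> x; ring.
by rewrite !intB; [ring|exact: inL2M..].
Qed.

Lemma hformBr f f' g g' h h' : inSig f f' -> inSig g g' -> inSig h h' ->
  hform h h' (fun x => f x - g x) (fun x => f' x - g' x) =
  hform h h' f f' - hform h h' g g'.
Proof. by move=> *; rewrite hformC hformBl// hformC (hformC g). Qed.

Definition hC : R := eps / 2 + (2 * eps)^-1.

Lemma hC_ge0 : 0 <= hC.
Proof. by rewrite addr_ge0 ?divr_ge0 ?invr_ge0 ?mulr_ge0 ?(ltW eps_gt0). Qed.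

Lemma hform_bound f f' g g' : inSig f f' -> inSig g g' ->
  `|hform f f' g g'| <= hC * (snrm f f' * snrm g g').
Proof.
move=> [f1 f2 f3 _] [g1 g2 g3 _].
have e1 : 0 <= eps / 2 by rewrite divr_ge0 ?(ltW eps_gt0).
have e2 : 0 <= (2 * eps)^-1 by rewrite invr_ge0 mulr_ge0 ?(ltW eps_gt0).
have n f := nrm_ge0 f.
apply: le_trans (ler_normD _ _) _; rewrite (normrM (eps / 2)) (normrM (2 * eps)^-1) (ger0_norm e1) (ger0_norm e2).
rewrite /hC [leRHS]mulrDl; apply: lerD; apply: ler_wpM2l => //.
  apply: le_trans (cauchy_schwarz f2 g2) _.
  have := n f; have := n f'; have := n g; have := n g'.
  have := n (fun x => x * f x); have := n (fun x => x * g x).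
  by move=> ? ? ? ? ? ?; apply: ler_pM; rewrite // /snrm; lra.
apply: le_trans (cauchy_schwarz f3 g3) _.
have := n f; have := n f'; have := n g; have := n g'.
by move=> ? ? ? ?; apply: ler_pM; rewrite // /snrm; lra.
Qed.

(** The functional through which the linear equation acts. *)
Definition lform f f' q g g' : R := hform f f' g g' - eps * \int[mu]_x (q x * g x).

Definition lC : R := hC + eps.

Lemma lC_ge0 : 0 <= lC. Proof. by rewrite addr_ge0 ?hC_ge0 ?ltW. Qed.

Lemma lform_bound f f' q g g' : inSig f f' -> inL2 q -> inSig g g' ->
  `|lform f f' q g g'| <= lC * ((snrm f f' + nrm q) * snrm g g').
Proof.
move=> hf hq hg; have [g1 g2 g3 _] := hg.
apply: le_trans (ler_normB _ _) _.
have h1 := hform_bound hf hg.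
have h2 := cauchy_schwarz hq g1.
have s1 := snrm_ge0 f f'; have s2 := snrm_ge0 g g'; have n1 := nrm_ge0 q.
have n2 : nrm g <= snrm g g' by rewrite /snrm; have := nrm_ge0 g'; have := nrm_ge0 (fun x => x * g x); lra.
have h3 : nrm q * nrm g <= nrm q * snrm g g' by exact: ler_wpM2l.
rewrite normrM (gtr0_norm eps_gt0) /lC.
have h4 : eps * `|\int[mu]_x (q x * g x)| <= eps * (nrm q * snrm g g').
  by apply: ler_wpM2l; [exact: ltW|lra].
have h5 : 0 <= hC * (nrm q * snrm g g') by rewrite !mulr_ge0 ?hC_ge0.
have h6 : 0 <= eps * (snrm f f' * snrm g g') by rewrite !mulr_ge0 ?(ltW eps_gt0).
have -> : (hC + eps) * ((snrm f f' + nrm q) * snrm g g') =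
  hC * (snrm f f' * snrm g g') + hC * (nrm q * snrm g g') +
  eps * (snrm f f' * snrm g g') + eps * (nrm q * snrm g g') by ring.
lra.
Qed.

Lemma lformBl f f' q g g' p h h' : inSig f f' -> inSig g g' -> inSig h h' ->
  inL2 q -> inL2 p ->
  lform (fun x => f x - g x) (fun x => f' x - g' x) (fun x => q x - p x) h h' =
  lform f f' q h h' - lform g g' p h h'.
Proof.
move=> hf hg hh hq hp; have [h1 _ _ _] := hh.
rewrite /lform hformBl//.
rewrite (@int_eq _ (fun x => (q x - p x) * h x) (fun x => q x * h x - p x * h x)); last by move=> x; ring.
by rewrite intB; [ring|exact: inL2M..].
Qed.

Lemma lformBr f f' q g g' h h' : inSig f f' -> inSig g g' -> inSig h h' -> inL2 q ->
  lform f f' q (fun x => g x - h x) (fun x => g' x - h' x) =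
  lform f f' q g g' - lform f f' q h h'.
Proof.
move=> hf hg hh hq; have [h1 _ _ _] := hh; have [g1 _ _ _] := hg.
rewrite /lform hformBr//.
rewrite (@int_eq _ (fun x => q x * (g x - h x)) (fun x => q x * g x - q x * h x)); last by move=> x; ring.
by rewrite intB; [ring|exact: inL2M..].
Qed.

Lemma test_inSig phi : test_function phi -> inSig phi (derive1 phi).
Proof.
move=> tp; have tp' := test_derive1 tp; split; [exact: test_inL2|exact: test_inL2| |].
  exact: test_inL2 (testM tp smooth_id).
apply: der_wder; first by move=> x; exact: test_der.
exact: test_continuous.
Qed.

(** A weak equation d<a,phi>/dt = sg * lform(b, q; phi) tested against smooth
    functions controls the increments of a against the whole energy space. *)
Lemma pairing_increment (sg : R) (a a' b b' q : R -> R -> R) s t eta : `|sg| <= 1 ->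
  (forall r, Num.min s t <= r <= Num.max s t ->
     [/\ inSig (a r) (a' r), inSig (b r) (b' r), inL2 (q r),
         sdist (b r) (b' r) (b s) (b' s) <= eta & nrm (fun x => q r x - q s x) <= eta] /\
     forall phi, test_function phi ->
       der (fun r => \int[mu]_x (a r x * phi x)) r
         (sg * lform (b r) (b' r) (q r) phi (derive1 phi))) ->
  forall psi psi', inSig psi psi' ->
  `|\int[mu]_x ((a t x - a s x) * psi x) - (t - s) * (sg * lform (b s) (b' s) (q s) psi psi')|
    <= `|t - s| * (2 * lC * eta * snrm psi psi').
Proof.
move=> sg1 H psi psi' hpsi.
have smm : Num.min s t <= s <= Num.max s t by rewrite ge_min lexx /= le_max lexx.
have tmm : Num.min s t <= t <= Num.max s t by rewrite ge_min lexx orbT /= le_max lexx orbT.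
have [[as1 bs qs b0 q0] _] := H s smm.
have [[at1 bt qt _ _] _] := H t tmm.
have eta0 : 0 <= eta by exact: le_trans (nrm_ge0 _) q0.
have lC0 := lC_ge0.
have [ast _ _ _] := inSigB at1 as1.
(* the estimate for test functions, by the mean value theorem *)
have key phi : test_function phi ->
  `|\int[mu]_x ((a t x - a s x) * phi x) - (t - s) * (sg * lform (b s) (b' s) (q s) phi (derive1 phi))|
    <= `|t - s| * (2 * lC * eta * snrm phi (derive1 phi)).
  move=> tp; have hp := test_inSig tp; have [p1 p2 p3 _] := hp.
  have [r hr hE] : exists2 r, Num.min s t <= r <= Num.max s t &
      \int[mu]_x (a t x * phi x) - \int[mu]_x (a s x * phi x) =
      sg * lform (b r) (b' r) (q r) phi (derive1 phi) * (t - s).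
    have [st|ts|->] := ltgtP s t; last first.
    - by exists t; [rewrite !lexx|rewrite !subrr mulr0].
    - have [|c /andP[c1 c2] cE] := mvt ts (f := fun r => \int[mu]_x (a r x * phi x))
          (g := fun r => sg * lform (b r) (b' r) (q r) phi (derive1 phi)).
        move=> x hx; apply: (H x _).2 => //.
        by move: hx; rewrite /Order.min /Order.max ltNge (ltW ts)/=.
      exists c; first by rewrite !ltW.
      by rewrite -opprB cE -mulrN opprB.
    - have [|c /andP[c1 c2] cE] := mvt st (f := fun r => \int[mu]_x (a r x * phi x))
          (g := fun r => sg * lform (b r) (b' r) (q r) phi (derive1 phi)).
        move=> x hx; apply: (H x _).2 => //.
        by move: hx; rewrite /Order.min /Order.max st.
      by exists c => //; rewrite !ltW.
  have [[_ br qr hb hq] _] := H r hr.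
  rewrite (@int_eq _ (fun x => (a t x - a s x) * phi x) (fun x => a t x * phi x - a s x * phi x)); last by move=> x; ring.
  have [at2 _ _ _] := at1; have [as2 _ _ _] := as1.
  rewrite intB; [|exact: inL2M..]; rewrite hE.
  have -> : sg * lform (b r) (b' r) (q r) phi (derive1 phi) * (t - s) -
      (t - s) * (sg * lform (b s) (b' s) (q s) phi (derive1 phi)) =
      (t - s) * (sg * lform (fun x => b r x - b s x) (fun x => b' r x - b' s x)
        (fun x => q r x - q s x) phi (derive1 phi)).
    by rewrite lformBl//; ring.
  rewrite normrM; apply: ler_wpM2l => //; rewrite normrM.
  apply: (@le_trans _ _ (1 * (lC * ((eta + eta) * snrm phi (derive1 phi))))); last by lra.
  apply: ler_pM => //.
  apply: le_trans (lform_bound (inSigB br bs) (inL2B qr qs) hp) _.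
  apply: ler_wpM2l => //; apply: ler_wpM2r; first exact: snrm_ge0.
  by apply: lerD => //; rewrite snrmB.
set L := fun f f' => \int[mu]_x ((a t x - a s x) * f x) - (t - s) * (sg * lform (b s) (b' s) (q s) f f').
rewrite -/(L psi psi').
have Ldiff f f' : inSig f f' -> L psi psi' - L f f' =
   L (fun x => psi x - f x) (fun x => psi' x - f' x).
  move=> hf; have [f1 _ _ _] := hf; have [ps1 _ _ _] := hpsi.
  rewrite /L lformBr//.
  rewrite (@int_eq _ (fun x => (a t x - a s x) * (psi x - f x)) (fun x => (a t x - a s x) * psi x - (a t x - a s x) * f x)); last by move=> x; ring.
  by rewrite intB; [ring|exact: inL2M..].
pose D1 := nrm (fun x => a t x - a s x) + `|t - s| * (lC * (snrm (b s) (b' s) + nrm (q s))).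
have D10 : 0 <= D1.
  by rewrite addr_ge0 ?nrm_ge0// !mulr_ge0// addr_ge0 ?snrm_ge0 ?nrm_ge0.
have Lbound f f' : inSig f f' -> `|L f f'| <= D1 * snrm f f'.
  move=> hf; have [f1 _ _ _] := hf.
  apply: le_trans (ler_normB _ _) _; rewrite /D1 [leRHS]mulrDl; apply: lerD.
    apply: le_trans (cauchy_schwarz ast f1) _; apply: ler_wpM2l; first exact: nrm_ge0.
    by rewrite /snrm; have := nrm_ge0 f'; have := nrm_ge0 (fun x => x * f x); lra.
  rewrite normrM -mulrA; apply: ler_wpM2l => //; rewrite normrM.
  apply: (@le_trans _ _ (1 * (lC * ((snrm (b s) (b' s) + nrm (q s)) * snrm f f')))); last by lra.
  by apply: ler_pM => //; exact: lform_bound.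
pose D2 := `|t - s| * (2 * lC * eta).
have D20 : 0 <= D2 by rewrite !mulr_ge0.
apply: (@le_arbitrary _ _ (D1 + D2)); first exact: addr_ge0.
move=> e e0; have [phi tp hphi] := inSig_density hpsi e0.
have hp := test_inSig tp.
have h1 : `|L psi psi' - L phi (derive1 phi)| <= D1 * e.
  rewrite Ldiff//; apply: le_trans (Lbound _ _ (inSigB hpsi hp)) _.
  by apply: ler_wpM2l => //; rewrite snrmB sdistC ltW.
have h2 := key _ tp; rewrite -/(L phi (derive1 phi)) in h2.
have h3 : snrm phi (derive1 phi) <= snrm psi psi' + e.
  have : snrm phi (derive1 phi) <= snrm psi psi' +
      snrm (fun x => phi x - psi x) (fun x => derive1 phi x - psi' x).
    have := snrmD hpsi (inSigB hp hpsi).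
    rewrite (_ : (fun x => psi x + (phi x - psi x)) = phi); last by apply/funext => x; ring.
    by rewrite (_ : (fun x => psi' x + (derive1 phi x - psi' x)) = derive1 phi); last by apply/funext => x; ring.
  by rewrite snrmB; lra.
have h4 : D2 * snrm phi (derive1 phi) <= D2 * (snrm psi psi' + e) by exact: ler_wpM2l.
have h5 : `|L psi psi'| <= `|L psi psi' - L phi (derive1 phi)| + `|L phi (derive1 phi)|.
  by rewrite -[X in `|X| <= _](subrK (L phi (derive1 phi))) ler_normD.
have -> : `|t - s| * (2 * lC * eta * snrm psi psi') = D2 * snrm psi psi' by rewrite /D2; ring.
have h6 : `|t - s| * (2 * lC * eta * snrm phi (derive1 phi)) = D2 * snrm phi (derive1 phi) by rewrite /D2; ring.
rewrite h6 in h2; lra.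
Qed.

Context (T : R) (a a' b b' p q : R -> R -> R).

Context (Hsig : forall t, 0 <= t <= T ->
  [/\ inSig (a t) (a' t), inSig (b t) (b' t), inL2 (p t) & inL2 (q t)]).

Context (Hcont : forall s, 0 <= s <= T -> forall e : R, 0 < e ->
  exists2 d : R, 0 < d & forall t, 0 <= t <= T -> `|t - s| < d ->
    [/\ sdist (a t) (a' t) (a s) (a' s) <= e, sdist (b t) (b' t) (b s) (b' s) <= e,
        nrm (fun x => p t x - p s x) <= e & nrm (fun x => q t x - q s x) <= e]).

Context (Hder : forall t, 0 < t < T -> forall phi, test_function phi ->
  der (fun r => \int[mu]_x (a r x * phi x)) t
    (1 * lform (b t) (b' t) (q t) phi (derive1 phi)) /\
  der (fun r => \int[mu]_x (b r x * phi x)) t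
    (- 1 * lform (a t) (a' t) (p t) phi (derive1 phi))).

Definition mass t : R := nrm (a t) ^+ 2 + nrm (b t) ^+ 2.

Lemma nrm_sqB f g : inL2 f -> inL2 g -> nrm f ^+ 2 - nrm g ^+ 2 =
  \int[mu]_x ((f x - g x) * (f x - g x)) + 2 * \int[mu]_x ((f x - g x) * g x).
Proof.
move=> hf hg; have fg := inL2B hf hg.
have i1 := inL2M fg fg; have i2 := inL2M fg hg; have i3 := intgZ 2 i2.
rewrite -intZ// -intD// !nrm_sq -intB; [|exact: inL2_sq..].
by apply: int_eq => x; ring.
Qed.

Lemma nrm_sdist f f' g g' : nrm (fun x => f x - g x) <= sdist f f' g g'.
Proof. by rewrite /sdist -addrA lerDl addr_ge0 ?nrm_ge0. Qed.

(** The quadratic form contributes nothing to the derivative of the mass, since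
    it is symmetric; only the source terms remain. *)
Lemma mass_der s : 0 < s < T ->
  der mass s (2 * eps * (\int[mu]_x (p s x * b s x) - \int[mu]_x (q s x * a s x))).
Proof.
move=> /andP[s0 sT]; have sI : 0 <= s <= T by rewrite !ltW.
have [as1 bs1 ps1 qs1] := Hsig sI.
have [as2 _ _ _] := as1; have [bs2 _ _ _] := bs1.
have lC0 := lC_ge0.
pose Sa := snrm (a s) (a' s); pose Sb := snrm (b s) (b' s).
have Sa0 : 0 <= Sa := snrm_ge0 _ _; have Sb0 : 0 <= Sb := snrm_ge0 _ _.
have np0 := nrm_ge0 (p s); have nq0 := nrm_ge0 (q s).
pose Ka := lC * (Sb + nrm (q s)) + 2 * lC + 2 * (2 * lC * Sa).
pose Kb := lC * (Sa + nrm (p s)) + 2 * lC + 2 * (2 * lC * Sb).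
have [lA0 lB0] : 0 <= lC * (Sb + nrm (q s)) /\ 0 <= lC * (Sa + nrm (p s)).
  by split; rewrite mulr_ge0// addr_ge0.
have [lSa lSb] : 0 <= lC * Sa /\ 0 <= lC * Sb by split; rewrite mulr_ge0.
have Ka0 : 0 <= Ka by rewrite /Ka; lra.
have Kb0 : 0 <= Kb by rewrite /Kb; lra.
apply: der_eps => e e0.
pose eta := Num.min 1 (e / (Ka + Kb + 1)).
have K1 : 0 < Ka + Kb + 1 by lra.
have eta0 : 0 < eta by rewrite lt_min ltr01 divr_gt0.
have eta1 : eta <= 1 by rewrite ge_min lexx.
have etae : eta * (Ka + Kb + 1) <= e by rewrite -ler_pdivlMr// ge_min lexx orbT.
have [d d0 hd] := Hcont sI eta0.
exists (Num.min d (Num.min s (T - s))); first by rewrite !lt_min d0 s0 subr_gt0.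
move=> h; rewrite !lt_min => /andP[h1 /andP[h2 h3]].
pose t := s + h.
have range r : Num.min s t <= r <= Num.max s t -> 0 < r < T /\ `|r - s| < d.
  move=> /andP[r1 r2].
  have hn := ler_norm h; have hn' := ler_norm (- h); rewrite normrN in hn'.
  have r3 : `|r - s| <= `|h|.
    have : s - `|h| <= r by apply: le_trans r1; rewrite le_min /t; apply/andP; split; have := normr_ge0 h; lra.
    have : r <= s + `|h| by apply: le_trans r2 _; rewrite ge_max /t; apply/andP; split; have := normr_ge0 h; lra.
    by rewrite ler_norml => *; apply/andP; split; lra.
  split; last exact: le_lt_trans r3 h1.
  by move: r3; rewrite ler_norml => /andP[? ?]; apply/andP; split; lra.
have tmm : Num.min s t <= t <= Num.max s t by rewrite ge_min lexx orbT /= le_max lexx orbT.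
have [tI td] := range t tmm.
have tI' : 0 <= t <= T by case/andP: tI => *; rewrite !ltW.
have [at1 bt1 pt1 qt1] := Hsig tI'.
have [at2 _ _ _] := at1; have [bt2 _ _ _] := bt1.
have [da db dp dq] := hd t tI' td.
have PIa := @pairing_increment 1 a a' b b' q s t eta _.
have PIb := @pairing_increment (- 1) b b' a a' p s t eta _.
have {}PIa := PIa _ _; have {}PIb := PIb _ _.
have {}PIa psi psi' := PIa _ _ psi psi'.
have {PIa} PIa psi psi' : inSig psi psi' ->
  `|\int[mu]_x ((a t x - a s x) * psi x) - (t - s) * (1 * lform (b s) (b' s) (q s) psi psi')|
    <= `|t - s| * (2 * lC * eta * snrm psi psi').
  apply: PIa; first by rewrite normr1.
  move=> r hr; have [rI rd] := range r hr.
  have rI' : 0 <= r <= T by case/andP: rI => *; rewrite !ltW.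
  have [? ? ? ?] := Hsig rI'; have [? ? ? ?] := hd r rI' rd.
  by split => // phi tp; have [] := Hder rI tp.
have {}PIb psi psi' : inSig psi psi' ->
  `|\int[mu]_x ((b t x - b s x) * psi x) - (t - s) * (- 1 * lform (a s) (a' s) (p s) psi psi')|
    <= `|t - s| * (2 * lC * eta * snrm psi psi').
  apply: PIb; first by rewrite normrN normr1.
  move=> r hr; have [rI rd] := range r hr.
  have rI' : 0 <= r <= T by case/andP: rI => *; rewrite !ltW.
  have [? ? ? ?] := Hsig rI'; have [? ? ? ?] := hd r rI' rd.
  by split => // phi tp; have [] := Hder rI tp.
have ats := inSigB at1 as1; have bts := inSigB bt1 bs1.
have A1 := PIa _ _ ats; have A2 := PIa _ _ as1.
have B1 := PIb _ _ bts; have B2 := PIb _ _ bs1.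
have lA := lform_bound bs1 qs1 ats; have lB := lform_bound as1 ps1 bts.
rewrite snrmB in A1 lA; rewrite snrmB in B1 lB.
rewrite -/(s + h) -/t.
have ts : t - s = h by rewrite /t addrC addKr.
rewrite ts in A1 A2 B1 B2.
have -> : mass t - mass s - h * (2 * eps * (\int[mu]_x (p s x * b s x) - \int[mu]_x (q s x * a s x))) =
  (nrm (a t) ^+ 2 - nrm (a s) ^+ 2) + (nrm (b t) ^+ 2 - nrm (b s) ^+ 2) -
  2 * (h * (1 * lform (b s) (b' s) (q s) (a s) (a' s))) -
  2 * (h * (- 1 * lform (a s) (a' s) (p s) (b s) (b' s))).
  by rewrite /mass /lform (hformC (b s)); ring.
rewrite nrm_sqB// nrm_sqB//.
move: A1 A2 B1 B2 lA lB.
set X1 := \int[mu]_x ((a t x - a s x) * (a t x - a s x)).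
set X2 := \int[mu]_x ((a t x - a s x) * a s x).
set Y1 := \int[mu]_x ((b t x - b s x) * (b t x - b s x)).
set Y2 := \int[mu]_x ((b t x - b s x) * b s x).
set la1 := lform _ _ _ (fun x => a t x - a s x) _.
set la2 := lform _ _ _ (a s) _.
set lb1 := lform _ _ _ (fun x => b t x - b s x) _.
set lb2 := lform _ _ _ (b s) _.
move=> A1 A2 B1 B2 lA lB.
have h0 : 0 <= `|h| by exact: normr_ge0.
have la1' : `|la1| <= lC * (Sb + nrm (q s)) * eta.
  apply: le_trans lA _; rewrite -mulrA; apply: ler_wpM2l => //; apply: ler_wpM2l => //.
  by rewrite addr_ge0.
have lb1' : `|lb1| <= lC * (Sa + nrm (p s)) * eta.
  apply: le_trans lB _; rewrite -mulrA; apply: ler_wpM2l => //; apply: ler_wpM2l => //.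
  by rewrite addr_ge0.
have bnd (X l S c : R) : `|X - h * l| <= `|h| * (2 * lC * eta * S) -> S <= 1 -> `|l| <= c ->
    `|X| <= `|h| * (c + 2 * lC * eta).
  move=> hX S1 hl; rewrite -[X](subrK (h * l)); apply: le_trans (ler_normD _ _) _.
  rewrite normrM mulrDr addrC; apply: lerD; first exact: ler_wpM2l.
  apply: le_trans hX _; apply: ler_wpM2l => //.
  by rewrite -[leRHS]mulr1; apply: ler_wpM2l => //; rewrite !mulr_ge0// ltW.
have hX1 := bnd _ _ _ _ A1 (le_trans da eta1) (_ : `|1 * la1| <= lC * (Sb + nrm (q s)) * eta).
have {}hX1 := hX1 _; rewrite mul1r in hX1; have {}hX1 := hX1 la1'.
have hY1 := bnd _ _ _ _ B1 (le_trans db eta1) (_ : `|- 1 * lb1| <= lC * (Sa + nrm (p s)) * eta).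
have {}hY1 := hY1 _; rewrite mulN1r normrN in hY1; have {}hY1 := hY1 lb1'.
have hfin : `|h| * (eta * (Ka + Kb + 1)) <= `|h| * e by exact: ler_wpM2l.
have -> : X1 + 2 * X2 + (Y1 + 2 * Y2) - 2 * (h * (1 * la2)) - 2 * (h * (-1 * lb2)) =
  X1 + Y1 + 2 * (X2 - h * (1 * la2)) + 2 * (Y2 - h * (- 1 * lb2)) by ring.
apply: le_trans (ler_normD _ _) _; rewrite (normrM 2) (@ger0_norm _ 2)//.
have n1 := ler_normD (X1 + Y1) (2 * (X2 - h * (1 * la2))).
rewrite (normrM 2) (@ger0_norm _ 2)// in n1.
have n2 := ler_normD X1 Y1.
have hS : `|h| * (eta * (Ka + Kb + 1)) = `|h| * (lC * (Sb + nrm (q s)) * eta + 2 * lC * eta) +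
  `|h| * (lC * (Sa + nrm (p s)) * eta + 2 * lC * eta) + 2 * (`|h| * (2 * lC * eta * Sa)) +
  2 * (`|h| * (2 * lC * eta * Sb)) + `|h| * eta by rewrite /Ka /Kb; ring.
have he : 0 <= `|h| * eta by rewrite mulr_ge0// ltW.
rewrite -/Sa in A2; rewrite -/Sb in B2; lra.
Qed.

Lemma sdist_mass_cvg : forall s, 0 <= s <= T -> forall e, 0 < e ->
  exists2 d, 0 < d & forall t, 0 <= t <= T -> `|t - s| < d -> `|mass t - mass s| <= e.
Proof.
move=> s sI e e0; have [as1 bs1 _ _] := Hsig sI.
have [as2 _ _ _] := as1; have [bs2 _ _ _] := bs1.
pose K := 1 + 2 * nrm (a s) + (1 + 2 * nrm (b s)).
have na := nrm_ge0 (a s); have nb := nrm_ge0 (b s).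
have K0 : 0 < K by rewrite /K; lra.
pose eta := Num.min 1 (e / K).
have eta0 : 0 < eta by rewrite lt_min ltr01 divr_gt0.
have eta1 : eta <= 1 by rewrite ge_min lexx.
have etae : eta * K <= e by rewrite -ler_pdivlMr// ge_min lexx orbT.
have [d d0 hd] := Hcont sI eta0; exists d => // t tI td.
have [at1 bt1 _ _] := Hsig tI; have [at2 _ _ _] := at1; have [bt2 _ _ _] := bt1.
have [da db _ _] := hd t tI td.
have key f f' g g' : inL2 f -> inL2 g -> sdist f f' g g' <= eta ->
    `|nrm f ^+ 2 - nrm g ^+ 2| <= eta * (1 + 2 * nrm g).
  move=> hf hg hs; rewrite nrm_sqB//; have fg := inL2B hf hg.
  have n := le_trans (nrm_sdist f f' g g') hs.
  apply: le_trans (ler_normD _ _) _; rewrite normrM (@ger0_norm _ 2)//.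
  have c1 := cauchy_schwarz fg fg; have c2 := cauchy_schwarz fg hg.
  have n0 := nrm_ge0 (fun x => f x - g x); have ng := nrm_ge0 g.
  have p1 : nrm (fun x => f x - g x) * nrm (fun x => f x - g x) <= eta * 1.
    by apply: ler_pM => //; exact: le_trans n eta1.
  have p2 : nrm (fun x => f x - g x) * nrm g <= eta * nrm g by exact: ler_wpM2r.
  lra.
have k1 := key _ _ _ _ at2 as2 da; have k2 := key _ _ _ _ bt2 bs2 db.
have -> : mass t - mass s = (nrm (a t) ^+ 2 - nrm (a s) ^+ 2) + (nrm (b t) ^+ 2 - nrm (b s) ^+ 2).
  by rewrite /mass; ring.
apply: le_trans (ler_normD _ _) _; rewrite /K in etae; lra.
Qed.

(** Gronwall's argument: exp(-k t) mass(t) does not increase, with k = 4 eps C. *)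
Lemma mass_eq0 (C : R) : 0 <= C -> mass 0 = 0 ->
  (forall t, 0 < t < T -> nrm (p t) <= C * (nrm (a t) + nrm (b t)) /\
     nrm (q t) <= C * (nrm (a t) + nrm (b t))) ->
  forall t, 0 <= t < T -> mass t = 0.
Proof.
move=> C0 m0 hpq t /andP[t0 tT].
have mge r : 0 <= mass r by rewrite addr_ge0 ?sqr_ge0.
have [->//|tn0] := eqVneq t 0.
have {tn0}t0 : 0 < t by rewrite lt_def tn0.
pose k := 4 * (eps * C).
have k0 : 0 <= k by rewrite !mulr_ge0// ltW.
have dmass s : 0 < s < T -> exists2 m', der mass s m' & m' <= k * mass s.
  move=> sI; exists (2 * eps * (\int[mu]_x (p s x * b s x) - \int[mu]_x (q s x * a s x))).
    exact: mass_der.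
  have sI' : 0 <= s <= T by case/andP: sI => *; rewrite !ltW.
  have [[as2 _ _ _] [bs2 _ _ _] ps1 qs1] := Hsig sI'.
  have [hp hq] := hpq s sI.
  have c1 := le_trans (ler_norm _) (cauchy_schwarz ps1 bs2).
  have c2 := le_trans (ler_norm _) (cauchy_schwarz (inL2N qs1) as2).
  have -> : \int[mu]_x (p s x * b s x) - \int[mu]_x (q s x * a s x) =
     \int[mu]_x (p s x * b s x) + \int[mu]_x (- q s x * a s x).
    rewrite -intN; last exact: inL2M.
    by congr (_ + _); apply: int_eq => x; ring.
  rewrite nrmN in c2.
  have na := nrm_ge0 (a s); have nb := nrm_ge0 (b s).
  have p1 : nrm (p s) * nrm (b s) <= C * (nrm (a s) + nrm (b s)) * nrm (b s) by exact: ler_wpM2r.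
  have p2 : nrm (q s) * nrm (a s) <= C * (nrm (a s) + nrm (b s)) * nrm (a s) by exact: ler_wpM2r.
  have p3 : C * (nrm (a s) + nrm (b s)) * nrm (b s) + C * (nrm (a s) + nrm (b s)) * nrm (a s) <= 2 * C * mass s.
    rewrite /mass -subr_ge0.
    have -> : 2 * C * (nrm (a s) ^+ 2 + nrm (b s) ^+ 2) -
      (C * (nrm (a s) + nrm (b s)) * nrm (b s) + C * (nrm (a s) + nrm (b s)) * nrm (a s)) =
      C * (nrm (a s) - nrm (b s)) ^+ 2 by ring.
    by rewrite mulr_ge0// sqr_ge0.
  have -> : k * mass s = 2 * eps * (2 * C * mass s) by rewrite /k; ring.
  by apply: ler_wpM2l; [rewrite mulr_ge0// ltW|lra].
pose G s := expR (- k * s) * mass s.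
have decr s : 0 < s < t -> G t <= G s.
  move=> /andP[s0 st].
  have dG r : s <= r <= t -> der G r (expR (- k * r) * (- k * mass r + (derive1 mass r))).
    move=> /andP[sr rt]; have rI : 0 < r < T by apply/andP; split; lra.
    have [m' dm _] := dmass r rI.
    have de : der (fun r => expR (- k * r)) r (expR (- k * r) * (- k)).
      by apply: der_expR; apply: der_eq (derZ (- k) (der_id r)) _; rewrite mulr1.
    by apply: der_eq (derM de dm) _; rewrite (der_derive1 dm); ring.
  have [c /andP[c1 c2] cE] := mvt st dG.
  have cI : 0 < c < T by apply/andP; split; lra.
  have [m' dm hm] := dmass c cI.
  rewrite -subr_le0 cE (der_derive1 dm) mulr_le0_ge0//; last by rewrite subr_ge0 ltW.
  by rewrite mulr_ge0_le0 ?expR_ge0//; lra.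
have Gle : G t <= 0.
  apply/ler_addgt0Pr => e e0; rewrite add0r.
  have T0 : 0 <= T by lra.
  have I0 : 0 <= (0 : R) <= T by rewrite lexx.
  have [d d0 hd] := sdist_mass_cvg I0 e0.
  pose s := Num.min (t / 2) (d / 2).
  have s0 : 0 < s by rewrite lt_min !divr_gt0.
  have st : s <= t / 2 by rewrite ge_min lexx.
  have sd : s <= d / 2 by rewrite ge_min lexx orbT.
  apply: le_trans (decr s _) _; first by apply/andP; split; lra.
  have sI : 0 <= s <= T by apply/andP; split; lra.
  have hm : mass s <= e.
    have := hd s sI; rewrite subr0 m0 subr0 (ger0_norm (mge s)); apply.
    by rewrite ger0_norm; lra.
  apply: le_trans hm; rewrite /G -[leRHS]mul1r; apply: ler_wpM2r => //.
  by rewrite expR_le1 mulNr oppr_le0 mulr_ge0// ltW.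
apply/eqP; rewrite eq_le mge andbT.
have := expR_gt0 (- k * t); rewrite /G in Gle; move=> ex.
by rewrite -(pmulr_rle0 _ ex).
Qed.

(** The mass is continuous up to the end of the interval, where the equation is
    not available. *)
Lemma mass_end (C : R) : 0 <= C -> 0 <= T -> mass 0 = 0 ->
  (forall t, 0 < t < T -> nrm (p t) <= C * (nrm (a t) + nrm (b t)) /\
     nrm (q t) <= C * (nrm (a t) + nrm (b t))) ->
  mass T = 0.
Proof.
move=> C0 T0 m0 hpq; have [<-//|Tn0] := eqVneq 0 T.
have {Tn0}T1 : 0 < T by rewrite lt_def eq_sym Tn0.
have mge r : 0 <= mass r by rewrite addr_ge0 ?sqr_ge0.
apply/eqP; rewrite eq_le mge andbT.
apply/ler_addgt0Pr => e e0; rewrite add0r.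
have TI : 0 <= T <= T by rewrite T0 lexx.
have [d d0 hd] := sdist_mass_cvg TI e0.
pose s := Num.max (T / 2) (T - d / 2).
have s1 : T / 2 <= s by rewrite le_max lexx.
have s2 : T - d / 2 <= s by rewrite le_max lexx orbT.
have s3 : s < T by rewrite gt_max; apply/andP; split; lra.
have sI : 0 <= s <= T by apply/andP; split; lra.
have := hd s sI; rewrite (mass_eq0 C0 m0 hpq); last by apply/andP; split; lra.
rewrite sub0r normrN (ger0_norm (mge T)); apply.
by rewrite ler0_norm; lra.
Qed.

End Energy.

(** * Complex-valued functions *)

Section ComplexBridge.
Context {R : realType}.
Implicit Types (F G : R -> R[i]) (phi : R -> R).

Local Notation mu := (@lebesgue_measure R).
Local Notation mfun f := (measurable_fun setT (f : R -> R)).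

Definition re F : R -> R := fun x => complex.Re (F x).
Definition im F : R -> R := fun x => complex.Im (F x).

Lemma normc_sq (z : R[i]) : Normc.normc z ^+ 2 = complex.Re z ^+ 2 + complex.Im z ^+ 2.
Proof. by case: z => a b /=; rewrite sqr_sqrtr// addr_ge0 ?sqr_ge0. Qed.

Lemma normc_ge0 (z : R[i]) : 0 <= Normc.normc z.
Proof. by case: z => a b /=; exact: sqrtr_ge0. Qed.

Definition nrmc F : R := Num.sqrt (nrm (re F) ^+ 2 + nrm (im F) ^+ 2).

Lemma nrmc_ge0 F : 0 <= nrmc F. Proof. exact: sqrtr_ge0. Qed.

Definition inL2c F := inL2 (re F) /\ inL2 (im F).

Lemma L2normE F : L2norm F = ((\int[mu]_x ((re F x) ^+ 2 + (im F x) ^+ 2)%:E) `^ 2^-1)%E.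
Proof.
rewrite /L2norm /Lpnorm unlock /=; congr poweR.
apply: eq_integral => x _.
rewrite /= ger0_norm ?normc_ge0//; congr EFin.
rewrite -normc_sq powR_mulrn ?normc_ge0//.
Qed.

Lemma L2norm_inL2 F : inL2c F -> L2norm F = (nrmc F)%:E.
Proof.
move=> [h1 h2]; rewrite L2normE int_EFin; last by apply: intgD; exact: inL2_sq.
rewrite intD; [|exact: inL2_sq..]; rewrite -!nrm_sq poweR_EFin powR12_sqrt//.
by rewrite addr_ge0 ?sqr_ge0.
Qed.

Lemma is_L2P F : is_L2 F <-> inL2c F.
Proof.
split; last first.
  move=> h; split; last by rewrite L2norm_inL2// ltry.
  by case: h => h1 h2; split; exact: inL2_mfun.
move=> [[m1 m2] hfin].
have : intg (fun x => re F x ^+ 2 + im F x ^+ 2).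
  apply/integrableP; split.
    by apply/measurable_EFinP; apply: measurable_funD; exact: measurable_funX.
  under eq_integral do rewrite /= ger0_norm ?addr_ge0 ?sqr_ge0//.
  by move: hfin; rewrite L2normE => /lty_poweRy; apply; rewrite invr_eq0.
move=> hi; split; split => //; apply: intg_le hi.
- exact: measurable_funX.
- by move=> x; rewrite ger0_norm ?sqr_ge0// lerDl sqr_ge0.
- exact: measurable_funX.
- by move=> x; rewrite ger0_norm ?sqr_ge0// lerDr sqr_ge0.
Qed.

Lemma is_weak_derivP F G : is_weak_deriv F G <-> wder (re F) (re G) /\ wder (im F) (im G).
Proof.
split.
  move=> [[f1 f2] [g1 g2] h]; split; split => // phi /h /eqP;
  by rewrite eq_complex /= => /andP[/eqP ? /eqP ?].
move=> [[f1 g1 h1] [f2 g2 h2]]; split => // phi tp.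
by apply/eqP; rewrite eq_complex /=; apply/andP; split; apply/eqP; [exact: h1|exact: h2].
Qed.

Lemma weak_derivP F G : is_weak_deriv F G -> is_weak_deriv F (weak_deriv F).
Proof. by move=> h; exact: (xgetPex _ (ex_intro _ G h)). Qed.

(** The chosen weak derivative may be replaced by any explicit one. *)
Lemma weak_deriv_ae F G : is_weak_deriv F G ->
  {ae mu, forall x : R, re (weak_deriv F) x = re G x} /\
  {ae mu, forall x : R, im (weak_deriv F) x = im G x}.
Proof.
move=> h; have /is_weak_derivP[a1 a2] := weak_derivP h.
by move/is_weak_derivP : h => [b1 b2]; split; [exact: wder_uniq a1 b1|exact: wder_uniq a2 b2].
Qed.

Lemma re_xmul F : re (xmul F) = (fun x => x * re F x).
Proof. by apply/funext => x; rewrite /re /xmul; case: (F x) => a b /=; rewrite mul0r subr0. Qed.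

Lemma im_xmul F : im (xmul F) = (fun x => x * im F x).
Proof. by apply/funext => x; rewrite /im /xmul; case: (F x) => a b /=; rewrite mul0r addr0. Qed.

Definition inSigc F G := inSig (re F) (re G) /\ inSig (im F) (im G).

Lemma inSigc_weak_deriv F G : inSigc F G -> is_weak_deriv F G.
Proof. by move=> [[_ _ _ h1] [_ _ _ h2]]; apply/is_weak_derivP. Qed.

Lemma inSigc_is_Sigma F G : inSigc F G -> is_Sigma F.
Proof.
move=> h; have w := inSigc_weak_deriv h; case: h => [[f1 g1 x1 w1] [f2 g2 x2 w2]].
split; first split.
- by apply/is_L2P.
- by exists G; split => //; apply/is_L2P.
- by apply/is_L2P; split; rewrite ?re_xmul ?im_xmul.
Qed.

Lemma is_SigmaP F : is_Sigma F -> inSigc F (weak_deriv F).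
Proof.
move=> [[/is_L2P[f1 f2] [G [w /is_L2P[g1 g2]]]] /is_L2P].
rewrite /inL2c re_xmul im_xmul => -[x1 x2].
have /is_weak_derivP[w1 w2] := weak_derivP w.
have [e1 e2] := weak_deriv_ae w.
split; split => //.
- by apply: inL2_ae g1; [case: w1 => _ /locint_mfun|apply: aeS e1 => x ->].
- by apply: inL2_ae g2; [case: w2 => _ /locint_mfun|apply: aeS e2 => x ->].
Qed.

Lemma inL2c_ae F G : mfun (re G) -> mfun (im G) ->
  {ae mu, forall x : R, re F x = re G x} -> {ae mu, forall x : R, im F x = im G x} ->
  inL2c F -> inL2c G /\ nrmc F = nrmc G.
Proof.
move=> m1 m2 e1 e2 [h1 h2]; split; first by split; [exact: inL2_ae e1 h1|exact: inL2_ae e2 h2].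
rewrite /nrmc (nrm_ae _ _ e1)//; last exact: inL2_mfun.
by rewrite (nrm_ae _ _ e2)//; exact: inL2_mfun.
Qed.

(** On the energy space the extended real norm is a sum of real norms; this and
    the two comparisons with [sdist] below turn continuity in Sigma into
    estimates between real numbers. *)
Lemma Sigma_normE F G : inSigc F G ->
  Sigma_norm F = (nrmc F + nrmc G + nrmc (xmul F))%:E.
Proof.
move=> h; have w := inSigc_weak_deriv h.
have [[_ d1 _ w1] [_ d2 _ w2]] := is_SigmaP (inSigc_is_Sigma h).
have [e1 e2] := weak_deriv_ae w.
case: h => [[f1 g1 x1 _] [f2 g2 x2 _]].
rewrite /Sigma_norm !L2norm_inL2//; last by split; rewrite ?re_xmul ?im_xmul.
have [_ ->] := @inL2c_ae (weak_deriv F) G (inL2_mfun g1) (inL2_mfun g2) e1 e2 (conj d1 d2).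
by rewrite -!EFinD.
Qed.

Lemma nrm_re_le F : nrm (re F) <= nrmc F.
Proof.
rewrite -[leLHS]ger0_norm ?nrm_ge0// -sqrtr_sqr; apply: ler_wsqrtr.
by rewrite lerDl sqr_ge0.
Qed.

Lemma nrm_im_le F : nrm (im F) <= nrmc F.
Proof.
rewrite -[leLHS]ger0_norm ?nrm_ge0// -sqrtr_sqr; apply: ler_wsqrtr.
by rewrite lerDr sqr_ge0.
Qed.

Lemma nrmc_le F : nrmc F <= nrm (re F) + nrm (im F).
Proof.
have a0 := nrm_ge0 (re F); have b0 := nrm_ge0 (im F).
rewrite -[leRHS]ger0_norm ?addr_ge0// -sqrtr_sqr; apply: ler_wsqrtr; nra.
Qed.

Lemma re_sub F G : re (fun x => F x - G x) = (fun x => re F x - re G x).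
Proof. by apply/funext => x; rewrite /re; case: (F x) => a b; case: (G x) => c d. Qed.

Lemma im_sub F G : im (fun x => F x - G x) = (fun x => im F x - im G x).
Proof. by apply/funext => x; rewrite /im; case: (F x) => a b; case: (G x) => c d. Qed.

Lemma inSigcB F F' G G' : inSigc F F' -> inSigc G G' ->
  inSigc (fun x => F x - G x) (fun x => F' x - G' x).
Proof.
by move=> [f1 f2] [g1 g2]; rewrite /inSigc !re_sub !im_sub; split; exact: inSigB.
Qed.

Lemma xmul_sub F G : xmul (fun x => F x - G x) = (fun x => xmul F x - xmul G x).
Proof. by apply/funext => x; rewrite /xmul mulrBr. Qed.

Lemma sdist_le_Sigma F F' G G' : inSigc F F' -> inSigc G G' ->
  ((sdist (re F) (re F') (re G) (re G'))%:E <= Sigma_norm (fun x => F x - G x)%R)%E /\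
  ((sdist (im F) (im F') (im G) (im G'))%:E <= Sigma_norm (fun x => F x - G x)%R)%E.
Proof.
move=> hF hG; rewrite (Sigma_normE (inSigcB hF hG)) !lee_fin xmul_sub.
have r1 := nrm_re_le (fun x => F x - G x); have i1 := nrm_im_le (fun x => F x - G x).
have r2 := nrm_re_le (fun x => F' x - G' x); have i2 := nrm_im_le (fun x => F' x - G' x).
have r3 := nrm_re_le (fun x => xmul F x - xmul G x).
have i3 := nrm_im_le (fun x => xmul F x - xmul G x).
rewrite !re_sub in r1 r2 r3; rewrite !im_sub in i1 i2 i3.
rewrite !re_xmul in r3; rewrite !im_xmul in i3.
by split; [exact: lerD (lerD r1 r2) r3|exact: lerD (lerD i1 i2) i3].
Qed.

Lemma Sigma_le_sdist F F' G G' : inSigc F F' -> inSigc G G' ->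
  (Sigma_norm (fun x => F x - G x)%R <=
    (sdist (re F) (re F') (re G) (re G') + sdist (im F) (im F') (im G) (im G'))%:E)%E.
Proof.
move=> hF hG; rewrite (Sigma_normE (inSigcB hF hG)) !lee_fin xmul_sub.
have r1 := nrmc_le (fun x => F x - G x).
have r2 := nrmc_le (fun x => F' x - G' x).
have r3 := nrmc_le (fun x => xmul F x - xmul G x).
rewrite !re_sub !im_sub in r1 r2 r3; rewrite !re_xmul !im_xmul in r3.
rewrite /sdist [leRHS]addrACA [X in _ <= X + _]addrACA.
exact: lerD (lerD r1 r2) r3.
Qed.

Lemma Sigma_norm_ge0 F : (0 <= Sigma_norm F)%E.
Proof. by rewrite /Sigma_norm !adde_ge0 ?Lnorm_ge0. Qed.

(** ** The power nonlinearity *)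

Definition nlre (f g : R -> R) : R -> R := fun x => (f x ^+ 2 + g x ^+ 2) ^+ 2 * f x.

Lemma nl_lip (K a b c d : R) : `|a| <= K -> `|b| <= K -> `|c| <= K -> `|d| <= K ->
  `|(a ^+ 2 + b ^+ 2) ^+ 2 * a - (c ^+ 2 + d ^+ 2) ^+ 2 * c| <=
  12 * K ^+ 4 * (`|a - c| + `|b - d|).
Proof.
move=> ha hb hc hd; have K0 : 0 <= K by exact: le_trans ha.
have sq (z : R) : `|z| <= K -> z ^+ 2 <= K ^+ 2.
  by move=> hz; rewrite -(real_normK (num_real z)) lerXn2r// nnegrE.
pose r1 := a ^+ 2 + b ^+ 2; pose r2 := c ^+ 2 + d ^+ 2.
have r10 : 0 <= r1 by rewrite addr_ge0 ?sqr_ge0.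
have r20 : 0 <= r2 by rewrite addr_ge0 ?sqr_ge0.
have r1K : r1 <= 2 * K ^+ 2 by have := sq _ ha; have := sq _ hb; rewrite /r1; lra.
have r2K : r2 <= 2 * K ^+ 2 by have := sq _ hc; have := sq _ hd; rewrite /r2; lra.
have K2 : 0 <= K ^+ 2 by exact: sqr_ge0.
have nac := normr_ge0 (a - c); have nbd := normr_ge0 (b - d).
have dr : `|r1 - r2| <= 2 * K * (`|a - c| + `|b - d|).
  have -> : r1 - r2 = (a - c) * (a + c) + (b - d) * (b + d) by rewrite /r1 /r2; ring.
  apply: le_trans (ler_normD _ _) _; rewrite !normrM.
  have h1 : `|a - c| * `|a + c| <= `|a - c| * (2 * K).
    by apply: ler_wpM2l => //; apply: le_trans (ler_normD _ _) _; lra.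
  have h2 : `|b - d| * `|b + d| <= `|b - d| * (2 * K).
    by apply: ler_wpM2l => //; apply: le_trans (ler_normD _ _) _; lra.
  lra.
rewrite -/r1 -/r2; clearbody r1 r2.
have -> : r1 ^+ 2 * a - r2 ^+ 2 * c = r1 ^+ 2 * (a - c) + (r1 - r2) * ((r1 + r2) * c) by ring.
apply: le_trans (ler_normD _ _) _.
rewrite (normrM (r1 ^+ 2)) (normrM (r1 - r2)) (normrM (r1 + r2)).
have h1 : `|r1 ^+ 2| <= (2 * K ^+ 2) ^+ 2 by rewrite ger0_norm ?sqr_ge0// lerXn2r ?nnegrE ?mulr_ge0.
have h2 : `|r1 + r2| * `|c| <= (4 * K ^+ 2) * K.
  by apply: ler_pM => //; rewrite (ger0_norm (addr_ge0 r10 r20)); lra.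
have h3 : `|r1 ^+ 2| * `|a - c| <= (2 * K ^+ 2) ^+ 2 * `|a - c| by exact: ler_wpM2r.
have h4 : `|r1 - r2| * (`|r1 + r2| * `|c|) <= 2 * K * (`|a - c| + `|b - d|) * (4 * K ^+ 2 * K).
  by apply: ler_pM => //; rewrite mulr_ge0.
have h5 : 0 <= K ^+ 4 * `|b - d| by rewrite mulr_ge0 ?exprn_ge0.
have -> : 12 * K ^+ 4 * (`|a - c| + `|b - d|) = (2 * K ^+ 2) ^+ 2 * `|a - c| +
  2 * K * (`|a - c| + `|b - d|) * (4 * K ^+ 2 * K) + 4 * (K ^+ 4 * `|b - d|) by ring.
lra.
Qed.

Lemma nlre_measurable f g : mfun f -> mfun g -> mfun (nlre f g).
Proof.
move=> mf mg; apply: measurable_funM => //; apply: measurable_funX.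
by apply: measurable_funD; exact: measurable_funX.
Qed.

Lemma nlre_diff K f g h k : inL2 f -> inL2 g -> inL2 h -> inL2 k ->
  {ae mu, forall x : R, `|f x| <= K /\ `|g x| <= K} ->
  {ae mu, forall x : R, `|h x| <= K /\ `|k x| <= K} ->
  inL2 (fun x => nlre f g x - nlre h k x) /\
  nrm (fun x => nlre f g x - nlre h k x) <=
    12 * K ^+ 4 * (nrm (fun x => f x - h x) + nrm (fun x => g x - k x)).
Proof.
move=> hf hg hh hk b1 b2.
have fh := inL2B hf hh; have gk := inL2B hg hk.
have m1 := nlre_measurable (inL2_mfun hf) (inL2_mfun hg).
have m2 := nlre_measurable (inL2_mfun hh) (inL2_mfun hk).
have nn (u : R -> R) : inL2 u -> inL2 (fun x => `|u x|) /\ nrm (fun x => `|u x|) = nrm u.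
  move=> hu; have mu' := inL2_mfun hu; split.
    apply: inL2_le hu => [|x]; last by rewrite normr_id.
    exact: measurableT_comp.
  by congr Num.sqrt; apply: int_eq => x; rewrite real_normK ?num_real.
have [n1 e1] := nn _ fh; have [n2 e2] := nn _ gk.
pose D x := 12 * K ^+ 4 * (`|f x - h x| + `|g x - k x|).
have hD : inL2 D by apply: inL2Z; exact: inL2D.
have K0 : 0 <= 12 * K ^+ 4.
  by rewrite mulr_ge0// (_ : K ^+ 4 = (K ^+ 2) ^+ 2) ?sqr_ge0// -exprM.
have hle : {ae mu, forall x : R, `|nlre f g x - nlre h k x| <= `|D x|}.
  apply: aeS (aeI b1 b2) => x [[? ?] [? ?]].
  by apply: le_trans (nl_lip _ _ _ _) (ler_norm _).
have md := measurable_funB m1 m2.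
split; first exact: inL2_le_ae hle hD.
apply: le_trans (nrm_le_ae md hD hle) _.
rewrite /D nrmZ; last exact: inL2D.
rewrite ger0_norm//; apply: ler_wpM2l => //.
by apply: le_trans (nrmD n1 n2) _; rewrite e1 e2.
Qed.

Lemma nlre_inL2 K f g : inL2 f -> inL2 g ->
  {ae mu, forall x : R, `|f x| <= K /\ `|g x| <= K} -> inL2 (nlre f g).
Proof.
move=> hf hg b1; have h0 : inL2 (fun=> 0 : R) by exact: inL20.
have b2 : {ae mu, forall x : R, `|(fun=> 0 : R) x| <= K /\ `|(fun=> 0 : R) x| <= K}.
  apply: aeS b1 => x [h _] /=; rewrite normr0; split; exact: le_trans h.
have [+ _] := nlre_diff hf hg h0 h0 b1 b2.
by under eq_fun do rewrite /nlre mulr0 subr0.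
Qed.

End ComplexBridge.

(** * Uniqueness for the Schroedinger equation *)

Section Uniqueness.
Context {R : realType}.
Implicit Types (F G : R -> R[i]) (phi : R -> R) (s t r e : R).

Local Notation mu := (@lebesgue_measure R).
Local Notation mfun f := (measurable_fun setT (f : R -> R)).

(** A continuous function on a compact interval is bounded; here continuity is
    relative to the interval and in the form in which [sol_cont] provides it. *)
Lemma eps_delta_bounded (T : R) (F : R -> R) : 0 <= T ->
  (forall s, 0 <= s <= T -> forall e, 0 < e -> exists2 d : R, 0 < d &
     forall t, 0 <= t <= T -> `|t - s| < d -> `|F t - F s| <= e) ->
  exists K : R, forall t, 0 <= t <= T -> F t <= K.
Proof.
move=> T0 hF.
have cF : {within `[0, T], continuous F}.
  apply/subspace_continuousP => s; rewrite /= in_itv/= => sI.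
  apply/cvgrPdist_le => e e0; have [d d0 hd] := hF s sI e e0.
  rewrite near_withinE; apply/nbhs_ballP; exists d => // t /= std.
  rewrite in_itv/= => tI; rewrite distrC; apply: hd => //.
  by rewrite distrC.
have [c _ hc] := EVT_max T0 cF.
by exists (F c) => t tI; apply: hc; rewrite in_itv.
Qed.

Lemma snrm_sdist (f f' g g' : R -> R) : inSig f f' -> inSig g g' ->
  `|snrm f f' - snrm g g'| <= sdist f f' g g'.
Proof.
move=> hf hg.
have key (u u' w w' : R -> R) : inSig u u' -> inSig w w' -> snrm u u' <= sdist u u' w w' + snrm w w'.
  move=> hu hw; rewrite -snrmB; have := snrmD (inSigB hu hw) hw.
  rewrite (_ : (fun x => u x - w x + w x) = u); last by apply/funext => x; ring.
  by rewrite (_ : (fun x => u' x - w' x + w' x) = u'); last by apply/funext => x; ring.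
have k1 := key _ _ _ _ hf hg; have k2 := key _ _ _ _ hg hf.
rewrite (sdistC g) in k2; rewrite ler_norml; apply/andP; split; lra.
Qed.

Lemma inSig_ae_le (f f' : R -> R) K : inSig f f' -> snrm f f' <= K ->
  {ae mu, forall x : R, `|f x| <= K}.
Proof.
move=> hf hK; have K0 : 0 <= K by exact: le_trans (snrm_ge0 _ _) hK.
apply: aeS (inSig_sup_bound hf) => x hx.
rewrite -(@ler_pXn2r _ 2)// ?nnegrE// real_normK ?num_real//.
apply: le_trans hx _; rewrite /snrm in hK.
have n1 := nrm_ge0 f; have n2 := nrm_ge0 f'; have n3 := nrm_ge0 (fun x => x * f x).
apply: (@le_trans _ _ ((nrm f + nrm f') ^+ 2)); first by nra.
by rewrite lerXn2r ?nnegrE ?addr_ge0//; lra.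
Qed.

Lemma sol_cont (J : set R) (v : R -> R -> R[i]) s e : continuous_in_Sigma J v -> J s -> 0 < e ->
  exists2 d : R, 0 < d & forall t, J t -> `|t - s| < d ->
    sdist (re (v t)) (re (weak_deriv (v t))) (re (v s)) (re (weak_deriv (v s))) <= e /\
    sdist (im (v t)) (im (weak_deriv (v t))) (im (v s)) (im (weak_deriv (v s))) <= e.
Proof.
move=> hc Js e0; have [Ss] := hc s Js.
move=> /fine_cvgP[hfin /cvgrPdist_lt /(_ e e0)].
rewrite near_withinE in hfin; rewrite near_withinE => h.
have [d /= d0 hd] := filterI hfin h.
exists d => // t Jt td.
have bt : ball s d t by rewrite /ball/= distrC.
have [h1 h2] := hd t bt; have {}h1 := h1 Jt; have {}h2 := h2 Jt.
have [St _] := hc t Jt.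
have [i1 i2] := sdist_le_Sigma (is_SigmaP St) (is_SigmaP Ss).
rewrite /= sub0r normrN in h2.
have hS : (Sigma_norm (fun x => v t x - v s x)%R <= e%:E)%E.
  by rewrite -(fineK h1) lee_fin; apply: le_trans (ler_norm _) (ltW h2).
by rewrite -!lee_fin; split; [exact: le_trans i1 hS|exact: le_trans i2 hS].
Qed.

Lemma re_realM (r : R) (z : R[i]) : complex.Re (r%:C * z) = r * complex.Re z.
Proof. by case: z => a b /=; rewrite mul0r subr0. Qed.

Lemma im_realM (r : R) (z : R[i]) : complex.Im (r%:C * z) = r * complex.Im z.
Proof. by case: z => a b /=; rewrite mul0r addr0. Qed.

(** The equation in real and imaginary parts, one derivative having been moved
    from the test function to the solution. *)
Lemma sol_der (eps : R) f J (v : R -> R -> R[i]) t phi : 0 < eps -> is_solution eps f J v ->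
  J° t -> test_function phi ->
  der (fun r => \int[mu]_x (re (v r) x * phi x)) t
    (1 * lform eps (im (v t)) (im (weak_deriv (v t))) (nlre (im (v t)) (re (v t))) phi (derive1 phi)) /\
  der (fun r => \int[mu]_x (im (v r) x * phi x)) t
    (- 1 * lform eps (re (v t)) (re (weak_deriv (v t))) (nlre (re (v t)) (im (v t))) phi (derive1 phi)).
Proof.
move=> eps0 [_ _ hc _ heq] Jt tp.
have [St _] := hc t (interior_subset Jt).
have [sre sim] := is_SigmaP St.
have [d [[d1 d2] hE]] := heq t Jt phi tp.
have tp' := test_derive1 tp.
have p2 : derive1n 2 phi = derive1 (derive1 phi) by rewrite derive1nS derive1n1.
have wre : \int[mu]_x (re (v t) x * derive1n 2 phi x) =
    - \int[mu]_x (re (weak_deriv (v t)) x * derive1 phi x).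
  by rewrite p2; case: sre => _ _ _ [_ _]; apply.
have wim : \int[mu]_x (im (v t) x * derive1n 2 phi x) =
    - \int[mu]_x (im (weak_deriv (v t)) x * derive1 phi x).
  by rewrite p2; case: sim => _ _ _ [_ _]; apply.
have tx : inL2 (fun x => x * phi x) by exact: test_inL2 (testM tp smooth_id).
have xre : \int[mu]_x (complex.Re ((x ^+ 2 / 2)%:C * v t x) * phi x) =
    2^-1 * \int[mu]_x ((x * re (v t) x) * (x * phi x)).
  rewrite -intZ; last by apply: inL2M => //; case: sre.
  by apply: int_eq => x; rewrite re_realM /re; field.
have xim : \int[mu]_x (complex.Im ((x ^+ 2 / 2)%:C * v t x) * phi x) =
    2^-1 * \int[mu]_x ((x * im (v t) x) * (x * phi x)).
  rewrite -intZ; last by apply: inL2M => //; case: sim.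
  by apply: int_eq => x; rewrite im_realM /im; field.
have nre : \int[mu]_x (complex.Re ((Normc.normc (v t x) ^+ 4)%:C * v t x) * phi x) =
    \int[mu]_x (nlre (re (v t)) (im (v t)) x * phi x).
  by apply: int_eq => x; rewrite re_realM (exprM _ 2 2) normc_sq.
have nim : \int[mu]_x (complex.Im ((Normc.normc (v t x) ^+ 4)%:C * v t x) * phi x) =
    \int[mu]_x (nlre (im (v t)) (re (v t)) x * phi x).
  by apply: int_eq => x; rewrite im_realM (exprM _ 2 2) normc_sq (addrC (_ ^+ 2)).
move: hE => /eqP; rewrite eq_complex /= xre xim nre nim.
rewrite -/(re (v t)) -/(im (v t)).
move: d d1 d2 => [A B] /= d1 d2 /andP[/eqP E1 /eqP E2].
have {}wre : \int[mu]_x (complex.Re (v t x) * derive1n 2 phi x) =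
    - \int[mu]_x (re (weak_deriv (v t)) x * derive1 phi x) := wre.
have {}wim : \int[mu]_x (complex.Im (v t x) * derive1n 2 phi x) =
    - \int[mu]_x (im (weak_deriv (v t)) x * derive1 phi x) := wim.
rewrite wre wim in E1 E2.
have en0 : eps != 0 by rewrite gt_eqF.
split.
  apply: der_eq d1 _; rewrite /lform /hform.
  apply: (mulfI en0); rewrite !mul0r ?(add0r, addr0, subr0, mul1r, mulr0, sub0r) in E2 *.
  move: E2; set X := \int[mu]_x (_ * derive1 phi x); set Y := \int[mu]_x (_ * (x * phi x)).
  set Z := \int[mu]_x (nlre _ _ x * _) => E2.
  have -> : eps * (eps / 2 * X + (2 * eps)^-1 * Y - eps * Z) =
    2^-1 * eps ^+ 2 * X + 2^-1 * Y - eps ^+ 2 * Z by field.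
  by clearbody X Y Z; clear -E2; lra.
apply: der_eq d2 _; rewrite /lform /hform.
apply: (mulfI en0); rewrite !mul0r ?(add0r, addr0, subr0, mul1r, mulr0, sub0r) in E1 *.
move: E1; set X := \int[mu]_x (_ * derive1 phi x); set Y := \int[mu]_x (_ * (x * phi x)).
set Z := \int[mu]_x (nlre _ _ x * _) => E1.
have -> : eps * (- 1 * (eps / 2 * X + (2 * eps)^-1 * Y - eps * Z)) =
  - (2^-1 * eps ^+ 2 * X + 2^-1 * Y - eps ^+ 2 * Z) by field.
by clearbody X Y Z; clear -E1; lra.
Qed.

Lemma sol_bounded (J : set R) (v : R -> R -> R[i]) T : continuous_in_Sigma J v -> 0 <= T ->
  (forall t, 0 <= t <= T -> J t) -> exists K : R, forall t, 0 <= t <= T ->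
    snrm (re (v t)) (re (weak_deriv (v t))) <= K /\
    snrm (im (v t)) (im (weak_deriv (v t))) <= K.
Proof.
move=> hc T0 JT.
have hS t : 0 <= t <= T -> inSigc (v t) (weak_deriv (v t)).
  by move=> /JT /hc [/is_SigmaP].
have [|K hK] := @eps_delta_bounded T (fun t => snrm (re (v t)) (re (weak_deriv (v t))) +
   snrm (im (v t)) (im (weak_deriv (v t)))) T0.
  move=> s sI e e0; have e2 : 0 < e / 2 by rewrite divr_gt0.
  have [d d0 hd] := sol_cont hc (JT s sI) e2.
  exists d => // t tI td; have [h1 h2] := hd t (JT t tI) td.
  have [t1 t2] := hS t tI; have [s1 s2] := hS s sI.
  have k1 := le_trans (snrm_sdist t1 s1) h1.
  have k2 := le_trans (snrm_sdist t2 s2) h2.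
  rewrite opprD addrACA; apply: le_trans (ler_normD _ _) _; lra.
exists K => t tI; have := hK t tI.
have := snrm_ge0 (re (v t)) (re (weak_deriv (v t))).
have := snrm_ge0 (im (v t)) (im (weak_deriv (v t))).
by split; lra.
Qed.

(** The differences [a], [b] of the real and imaginary parts satisfy the linear
    equation with the differences [p], [q] of the nonlinear terms as sources, and
    these are bounded by a constant times [a] and [b], since both solutions are
    bounded functions.  Gronwall's argument concludes. *)
Theorem nls_unique (eps : R) f J1 J2 (v1 v2 : R -> R -> R[i]) T : 0 < eps ->
  is_solution eps f J1 v1 -> is_solution eps f J2 v2 -> 0 <= T ->
  (forall t, 0 <= t <= T -> J1 t) -> (forall t, 0 <= t <= T -> J2 t) ->
  {ae mu, forall x : R, v1 T x = v2 T x}.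
Proof.
move=> eps0 sol1 sol2 T0 JT1 JT2.
have [_ _ c1 i1 _] := sol1; have [_ _ c2 i2 _] := sol2.
have S1 t : 0 <= t <= T -> inSigc (v1 t) (weak_deriv (v1 t)) by move=> /JT1 /c1 [/is_SigmaP].
have S2 t : 0 <= t <= T -> inSigc (v2 t) (weak_deriv (v2 t)) by move=> /JT2 /c2 [/is_SigmaP].
have [K1 hK1] := sol_bounded c1 T0 JT1; have [K2 hK2] := sol_bounded c2 T0 JT2.
(* a common bound for both solutions, in Sigma and hence pointwise *)
pose K := Num.max K1 K2.
have KK1 : K1 <= K by rewrite le_max lexx.
have KK2 : K2 <= K by rewrite le_max lexx orbT.
have K0 : 0 <= K.
  have [|h _] := hK1 0; first by rewrite lexx.
  by apply: le_trans KK1; apply: le_trans h; exact: snrm_ge0.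
have b1 t : 0 <= t <= T -> {ae mu, forall x : R, `|re (v1 t) x| <= K /\ `|im (v1 t) x| <= K}.
  move=> tI; have [k1 k2] := hK1 t tI; have [s1 s2] := S1 t tI.
  by apply: aeI; [apply: inSig_ae_le s1 _|apply: inSig_ae_le s2 _]; lra.
have b2 t : 0 <= t <= T -> {ae mu, forall x : R, `|re (v2 t) x| <= K /\ `|im (v2 t) x| <= K}.
  move=> tI; have [k1 k2] := hK2 t tI; have [s1 s2] := S2 t tI.
  by apply: aeI; [apply: inSig_ae_le s1 _|apply: inSig_ae_le s2 _]; lra.
have swap (f1 f2 : R -> R) : {ae mu, forall x : R, `|f1 x| <= K /\ `|f2 x| <= K} ->
   {ae mu, forall x : R, `|f2 x| <= K /\ `|f1 x| <= K} by apply: aeS => x [].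
pose a t x := re (v1 t) x - re (v2 t) x.
pose a' t x := re (weak_deriv (v1 t)) x - re (weak_deriv (v2 t)) x.
pose b t x := im (v1 t) x - im (v2 t) x.
pose b' t x := im (weak_deriv (v1 t)) x - im (weak_deriv (v2 t)) x.
pose p t x := nlre (re (v1 t)) (im (v1 t)) x - nlre (re (v2 t)) (im (v2 t)) x.
pose q t x := nlre (im (v1 t)) (re (v1 t)) x - nlre (im (v2 t)) (re (v2 t)) x.
pose C := 12 * K ^+ 4.
have C0 : 0 <= C by rewrite mulr_ge0// exprn_ge0.
have L2 t : 0 <= t <= T -> [/\ inL2 (re (v1 t)), inL2 (im (v1 t)), inL2 (re (v2 t)) & inL2 (im (v2 t))].
  by move=> tI; have [[? _ _ _] [? _ _ _]] := S1 t tI; have [[? _ _ _] [? _ _ _]] := S2 t tI.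
have hpq t : 0 <= t <= T -> [/\ inL2 (p t), inL2 (q t), nrm (p t) <= C * (nrm (a t) + nrm (b t)) &
    nrm (q t) <= C * (nrm (a t) + nrm (b t))].
  move=> tI; have [l1 l2 l3 l4] := L2 t tI.
  have [p1 p2] := nlre_diff l1 l2 l3 l4 (b1 t tI) (b2 t tI).
  have [q1 q2] := nlre_diff l2 l1 l4 l3 (swap _ _ (b1 t tI)) (swap _ _ (b2 t tI)).
  by split => //; rewrite (addrC (nrm (a t))).
have Hsig t : 0 <= t <= T ->
  [/\ inSig (a t) (a' t), inSig (b t) (b' t), inL2 (p t) & inL2 (q t)].
  move=> tI; have [s1 s2] := S1 t tI; have [s3 s4] := S2 t tI.
  by have [? ? _ _] := hpq t tI; split => //; exact: inSigB.
have nl_cont (v : R -> R -> R[i]) t s d :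
   inSigc (v t) (weak_deriv (v t)) -> inSigc (v s) (weak_deriv (v s)) ->
   {ae mu, forall x : R, `|re (v t) x| <= K /\ `|im (v t) x| <= K} ->
   {ae mu, forall x : R, `|re (v s) x| <= K /\ `|im (v s) x| <= K} ->
   sdist (re (v t)) (re (weak_deriv (v t))) (re (v s)) (re (weak_deriv (v s))) <= d ->
   sdist (im (v t)) (im (weak_deriv (v t))) (im (v s)) (im (weak_deriv (v s))) <= d ->
   [/\ inL2 (fun x => nlre (re (v t)) (im (v t)) x - nlre (re (v s)) (im (v s)) x),
       nrm (fun x => nlre (re (v t)) (im (v t)) x - nlre (re (v s)) (im (v s)) x) <= C * (d + d),
       inL2 (fun x => nlre (im (v t)) (re (v t)) x - nlre (im (v s)) (re (v s)) x) &
       nrm (fun x => nlre (im (v t)) (re (v t)) x - nlre (im (v s)) (re (v s)) x) <= C * (d + d)].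
  move=> [[t1 _ _ _] [t2 _ _ _]] [[s1 _ _ _] [s2 _ _ _]] bt bs d1 d2.
  have n1 := le_trans (nrm_sdist _ _ _ _) d1; have n2 := le_trans (nrm_sdist _ _ _ _) d2.
  have [p1 p2] := nlre_diff t1 t2 s1 s2 bt bs.
  have [q1 q2] := nlre_diff t2 t1 s2 s1 (swap _ _ bt) (swap _ _ bs).
  by split => //; [apply: le_trans p2 _|apply: le_trans q2 _]; apply: ler_wpM2l => //; apply: lerD.
have Hcont s : 0 <= s <= T -> forall e, 0 < e ->
  exists2 d : R, 0 < d & forall t, 0 <= t <= T -> `|t - s| < d ->
    [/\ sdist (a t) (a' t) (a s) (a' s) <= e, sdist (b t) (b' t) (b s) (b' s) <= e,
        nrm (fun x => p t x - p s x) <= e & nrm (fun x => q t x - q s x) <= e].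
  move=> sI e e0; pose k := 2 + 4 * C; have k0 : 0 < k by rewrite /k; lra.
  have ek : 0 < e / k by rewrite divr_gt0.
  have [d1 d10 hd1] := sol_cont c1 (JT1 s sI) ek.
  have [d2 d20 hd2] := sol_cont c2 (JT2 s sI) ek.
  exists (Num.min d1 d2); first by rewrite lt_min d10.
  move=> t tI; rewrite lt_min => /andP[td1 td2].
  have [r1 m1] := hd1 t (JT1 t tI) td1; have [r2 m2] := hd2 t (JT2 t tI) td2.
  have [P1 P2 Q1 Q2] := nl_cont v1 t s _ (S1 t tI) (S1 s sI) (b1 t tI) (b1 s sI) r1 m1.
  have [P3 P4 Q3 Q4] := nl_cont v2 t s _ (S2 t tI) (S2 s sI) (b2 t tI) (b2 s sI) r2 m2.
  have ee : e / k * k = e by rewrite divfK// gt_eqF.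
  have ek2 : e / k + e / k <= e by rewrite -[leRHS]ee /k mulrDr; have := mulr_ge0 (ltW ek) C0; lra.
  have ek4 : C * (e / k + e / k) + C * (e / k + e / k) <= e.
    by rewrite -[leRHS]ee /k mulrDr; lra.
  have [t1 t2] := S1 t tI; have [t3 t4] := S2 t tI.
  have [s1 s2] := S1 s sI; have [s3 s4] := S2 s sI.
  have sd (u1 u1' u2 u2' w1 w1' w2 w2' : R -> R) : inSig u1 u1' -> inSig u2 u2' ->
     inSig w1 w1' -> inSig w2 w2' ->
     sdist (fun x => u1 x - u2 x) (fun x => u1' x - u2' x)
       (fun x => w1 x - w2 x) (fun x => w1' x - w2' x) <=
     sdist u1 u1' w1 w1' + sdist u2 u2' w2 w2'.
    move=> hu1 hu2 hw1 hw2; rewrite -!snrmB.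
    have := snrmD (inSigB hu1 hw1) (inSigZ (- 1) (inSigB hu2 hw2)).
    rewrite (_ : (fun x => u1 x - w1 x + -1 * (u2 x - w2 x)) = (fun x => (u1 x - u2 x) - (w1 x - w2 x))); last by apply/funext => x; ring.
    rewrite (_ : (fun x => u1' x - w1' x + -1 * (u2' x - w2' x)) = (fun x => (u1' x - u2' x) - (w1' x - w2' x))); last by apply/funext => x; ring.
    move/le_trans; apply; rewrite lerD2l.
    rewrite /snrm -[X in X + _ + _ <= _]nrmN -[X in _ + X + _ <= _]nrmN -[X in _ + _ + X <= _]nrmN.
    by apply: lerD; [apply: lerD|]; rewrite le_eqVlt; apply/orP; left; apply/eqP; apply: nrm_eq => x; ring.
  split.
  - by apply: le_trans (sd _ _ _ _ _ _ _ _ t1 t3 s1 s3) _; lra.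
  - by apply: le_trans (sd _ _ _ _ _ _ _ _ t2 t4 s2 s4) _; lra.
  - rewrite (@nrm_eq _ _ (fun x => (nlre (re (v1 t)) (im (v1 t)) x - nlre (re (v1 s)) (im (v1 s)) x) -
      (nlre (re (v2 t)) (im (v2 t)) x - nlre (re (v2 s)) (im (v2 s)) x))); last first.
      by move=> x; rewrite /p; ring.
    by apply: le_trans (nrmB P1 P3) _; lra.
  - rewrite (@nrm_eq _ _ (fun x => (nlre (im (v1 t)) (re (v1 t)) x - nlre (im (v1 s)) (re (v1 s)) x) -
      (nlre (im (v2 t)) (re (v2 t)) x - nlre (im (v2 s)) (re (v2 s)) x))); last first.
      by move=> x; rewrite /q; ring.
    by apply: le_trans (nrmB Q1 Q3) _; lra.
have Hder t : 0 < t < T -> forall phi, test_function phi ->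
  der (fun r => \int[mu]_x (a r x * phi x)) t
    (1 * lform eps (b t) (b' t) (q t) phi (derive1 phi)) /\
  der (fun r => \int[mu]_x (b r x * phi x)) t
    (- 1 * lform eps (a t) (a' t) (p t) phi (derive1 phi)).
  move=> tI phi tp.
  have tI' : 0 <= t <= T by case/andP: tI => *; rewrite !ltW.
  have tn : \forall r \near t, 0 < r < T.
    have : t \in `]0, T[%R by rewrite in_itv.
    by move=> /near_in_itvoo; apply: filterS => r; rewrite in_itv.
  have J1t : J1° t by apply: filterS tn => r /andP[? ?]; apply: JT1; rewrite !ltW.
  have J2t : J2° t by apply: filterS tn => r /andP[? ?]; apply: JT2; rewrite !ltW.
  have [A1 B1] := sol_der eps0 sol1 J1t tp.
  have [A2 B2] := sol_der eps0 sol2 J2t tp.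
  have tL := test_inL2 tp; have tS := test_inSig tp.
  have [s1 s2] := S1 t tI'; have [s3 s4] := S2 t tI'.
  have [l1 l2 l3 l4] := L2 t tI'.
  have n1 := nlre_inL2 l1 l2 (b1 t tI'); have n2 := nlre_inL2 l2 l1 (swap _ _ (b1 t tI')).
  have n3 := nlre_inL2 l3 l4 (b2 t tI'); have n4 := nlre_inL2 l4 l3 (swap _ _ (b2 t tI')).
  split.
    have := derB A1 A2; rewrite -mulrBr -lformBl//.
    apply: near_der; apply: filterS tn => r /andP[r0 rT].
    have [|k1 k2 k3 k4] := L2 r; first by rewrite !ltW.
    rewrite -intB; [|exact: inL2M..].
    by apply: int_eq => x; rewrite /a; ring.
  have := derB B1 B2; rewrite -mulrBr -lformBl//.
  apply: near_der; apply: filterS tn => r /andP[r0 rT].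
  have [|k1 k2 k3 k4] := L2 r; first by rewrite !ltW.
  rewrite -intB; [|exact: inL2M..].
  by apply: int_eq => x; rewrite /b; ring.
have I0 : 0 <= (0 : R) <= T by rewrite lexx.
have m0 : mass a b 0 = 0.
  have [l1 l2 l3 l4] := L2 0 I0.
  have e0 : {ae mu, forall x : R, v1 0 x = v2 0 x}.
    have i1' : {ae mu, forall x : R, v1 0 x = f x} := i1.
    have i2' : {ae mu, forall x : R, v2 0 x = f x} := i2.
    by apply: aeS (aeI i1' i2') => x [-> ->].
  have nz (u : R -> R) : inL2 u -> {ae mu, forall x : R, u x = 0} -> nrm u = 0.
    move=> hu u0; rewrite (nrm_ae (inL2_mfun hu) _ u0) ?nrm0//; exact: measurable_cst.
  rewrite /mass !nz ?expr0n ?addr0//.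
  - exact: inL2B.
  - by apply: aeS e0 => x e; rewrite /b /im e subrr.
  - exact: inL2B.
  - by apply: aeS e0 => x e; rewrite /a /re e subrr.
have hm := mass_end eps0 Hsig Hcont Hder C0 T0 m0.
have {}hm : mass a b T = 0.
  apply: hm => t /andP[t0 tT]; have [] := hpq t; first by rewrite !ltW.
  by [].
have TI : 0 <= T <= T by rewrite T0 lexx.
have [l1 l2 l3 l4] := L2 T TI.
have z1 : nrm (a T) = 0.
  apply/eqP; rewrite -sqrf_eq0; apply/eqP.
  by have := sqr_ge0 (nrm (a T)); have := sqr_ge0 (nrm (b T)); move: hm; rewrite /mass; lra.
have z2 : nrm (b T) = 0.
  apply/eqP; rewrite -sqrf_eq0; apply/eqP.
  by have := sqr_ge0 (nrm (a T)); have := sqr_ge0 (nrm (b T)); move: hm; rewrite /mass; lra.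
have e1 := nrm_eq0_ae (inL2B l1 l3) z1; have e2 := nrm_eq0_ae (inL2B l2 l4) z2.
apply: aeS (aeI e1 e2) => x [/eqP h1 /eqP h2].
by apply/eqP; rewrite eq_complex -subr_eq0 h1 -subr_eq0 h2.
Qed.

End Uniqueness.

(** * The ground state *)

Section GroundState.
Context {R : realType}.
Implicit Types (x y : R) (Q f : R -> R).

Local Notation mu := (@lebesgue_measure R).
Local Notation sqrt2 := (Num.sqrt 2 : R).

Lemma sqrt2_sq : sqrt2 ^+ 2 = 2. Proof. by rewrite sqr_sqrtr. Qed.

Lemma sqrt2_gt1 : 1 < sqrt2.
Proof. by rewrite -[X in X < _](@sqrtr1 R) ltr_sqrt// ltr1n. Qed.

Definition sinh y : R := (expR y - expR (- y)) / 2.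

Lemma cosh_gt0 y : 0 < cosh y.
Proof. by rewrite divr_gt0// addr_gt0// expR_gt0. Qed.

Lemma cosh_sinh y : cosh y ^+ 2 - sinh y ^+ 2 = 1.
Proof.
have h : expR y * expR (- y) = 1 by rewrite -expRD subrr expR0.
rewrite /cosh /sinh; transitivity (expR y * expR (- y)); last by [].
by field.
Qed.

Lemma der_cosh f x a : der f x a -> der (fun z => cosh (f z)) x (sinh (f x) * a).
Proof.
move=> df; have := derZ 2^-1 (derD (der_expR df) (der_expR (derN df))).
rewrite (_ : (fun y => _) = fun z => cosh (f z)); last first.
  by apply/funext => z; rewrite /cosh mulrC.
by move=> h; apply: der_eq h _; rewrite /sinh; field.
Qed.

Lemma der_sinh f x a : der f x a -> der (fun z => sinh (f z)) x (cosh (f x) * a).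
Proof.
move=> df; have := derZ 2^-1 (derB (der_expR df) (der_expR (derN df))).
rewrite (_ : (fun y => _) = fun z => sinh (f z)); last first.
  by apply/funext => z; rewrite /sinh mulrC.
by move=> h; apply: der_eq h _; rewrite /cosh; field.
Qed.

Definition th x : R := sinh (2 * x * sqrt2) / cosh (2 * x * sqrt2).

Lemma der_arg x : der (fun x => 2 * x * sqrt2) x (2 * sqrt2).
Proof.
apply: (@der_ext _ (fun x => (2 * sqrt2) * x)); first by move=> y; ring.
by apply: der_eq (derZ (2 * sqrt2) (der_id x)) _; rewrite mulr1.
Qed.

Lemma th_sq x : th x ^+ 2 = 1 - (cosh (2 * x * sqrt2))^-2.
Proof.
have c0 := cosh_gt0 (2 * x * sqrt2); have cs := cosh_sinh (2 * x * sqrt2).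
rewrite /th expr_div_n; have -> : sinh (2 * x * sqrt2) ^+ 2 = cosh (2 * x * sqrt2) ^+ 2 - 1 by lra.
by field; rewrite gt_eqF.
Qed.

Lemma th_bound x : `|th x| <= 1.
Proof.
rewrite -(@ler_pXn2r _ 2)// ?nnegrE// real_normK ?num_real// expr1n th_sq.
by rewrite gerBl invr_ge0 sqr_ge0.
Qed.

Lemma der_th x : der th x (2 * sqrt2 * (1 - th x ^+ 2)).
Proof.
have c0 := cosh_gt0 (2 * x * sqrt2).
have cn0 : cosh (2 * x * sqrt2) != 0 by rewrite gt_eqF.
have h := derM (der_sinh (der_arg x))
  (derV (f := fun z => cosh (2 * z * sqrt2)) cn0 (der_cosh (der_arg x))).
by apply: der_eq h _; rewrite /th; field.
Qed.

Lemma Rsol_gt0 x : 0 < Rsol x.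
Proof. by rewrite divr_gt0 ?powR_gt0// sqrtr_gt0 cosh_gt0. Qed.

(** The power of the ground state that enters the equation is a polynomial in [th],
    whose derivative is one too; the equation becomes a polynomial identity. *)
Lemma Rsol4 x : Rsol x ^+ 4 = 3 * (1 - th x ^+ 2).
Proof.
rewrite th_sq /Rsol expr_div_n.
have -> : (3 `^ 4^-1 : R) ^+ 4 = 3.
  by rewrite -powR_mulrn ?powR_ge0// -powRrM mulVf ?powRr1.
rewrite (exprM _ 2 2) sqr_sqrtr ?(ltW (cosh_gt0 _))//; ring.
Qed.

Lemma der_Rsol x : der (@Rsol R) x (- sqrt2 * th x * Rsol x).
Proof.
have c0 := cosh_gt0 (2 * x * sqrt2).
have s0 : 0 < Num.sqrt (cosh (2 * x * sqrt2)) by rewrite sqrtr_gt0.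
have sE : Num.sqrt (cosh (2 * x * sqrt2)) ^+ 2 = cosh (2 * x * sqrt2).
  by rewrite sqr_sqrtr// ltW.
have h1 := der_comp (f := Num.sqrt) (g := fun z => cosh (2 * z * sqrt2))
  (is_derive1_sqrt c0) (der_cosh (der_arg x)).
have h2 := derZ (3 `^ 4^-1)
  (derV (f := fun z => Num.sqrt (cosh (2 * z * sqrt2))) (lt0r_neq0 s0) h1).
apply: der_eq h2 _; rewrite sE /th /Rsol; field.
by rewrite !gt_eqF.
Qed.

Lemma der2_Rsol x : der (fun x => - sqrt2 * th x * Rsol x) x (2 * Rsol x - 2 * Rsol x ^+ 5).
Proof.
have := derM (derZ (- sqrt2) (der_th x)) (der_Rsol x).
move=> h; apply: der_eq h _.
rewrite (exprSr _ 4) Rsol4.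
rewrite (_ : _ + _ = sqrt2 ^+ 2 * (3 * th x ^+ 2 - 2) * Rsol x); first by rewrite sqrt2_sq; ring.
ring.
Qed.

Lemma derive1_Rsol : derive1 (@Rsol R) = fun x => - sqrt2 * th x * Rsol x.
Proof. by apply/funext => x; exact: der_derive1 (der_Rsol x). Qed.

Lemma Rsol_ground_state : ground_state_equation (@Rsol R).
Proof.
move=> x; split.
- exact: der_derivable (der_Rsol x).
- by rewrite derive1_Rsol; exact: der_derivable (der2_Rsol x).
- rewrite derive1nS derive1n1 derive1_Rsol (der_derive1 (der2_Rsol x)); lra.
Qed.

Lemma continuous_Rsol : continuous (@Rsol R).
Proof. by move=> x; exact: der_continuous (der_Rsol x). Qed.

Lemma continuous_dRsol : continuous (fun x => - sqrt2 * th x * Rsol x).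
Proof. by move=> x; exact: der_continuous (der2_Rsol x). Qed.

(** The decay is exponential, since cosh (2 sqrt 2 x) >= exp (2 |x|) / 2; it is
    recorded against polynomial weights. *)
Lemma Rsol_decay (n : nat) : exists2 D : R, 0 <= D & forall x, Rsol x * (1 + `|x|) ^+ n <= D.
Proof.
have p0 : 0 <= (3 `^ 4^-1 : R) by exact: powR_ge0.
pose D : R := 3 `^ 4^-1 * 2 * (expR 1 * n%:R ^+ n).
have D0 : 0 <= D by rewrite !mulr_ge0 ?expR_ge0 ?exprn_ge0.
exists D => // x.
have x0 := normr_ge0 x.
have h1 : expR `|x| / 2 <= Num.sqrt (cosh (2 * x * sqrt2)).
  rewrite -[leLHS]ger0_norm ?divr_ge0 ?expR_ge0// -sqrtr_sqr; apply: ler_wsqrtr.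
  have hx : expR (2 * `|x|) <= expR (2 * x * sqrt2) + expR (- (2 * x * sqrt2)).
    have s1 := sqrt2_gt1.
    have hh : 2 * `|x| <= `|2 * x * sqrt2|.
      rewrite !normrM (@ger0_norm _ 2)// (@ger0_norm _ sqrt2) ?sqrtr_ge0//.
      by rewrite -[leLHS]mulr1; apply: ler_wpM2l; [rewrite mulr_ge0|exact: ltW].
    have e1 := expR_ge0 (2 * x * sqrt2); have e2 := expR_ge0 (- (2 * x * sqrt2)).
    have : expR (2 * `|x|) <= expR `|2 * x * sqrt2| by rewrite ler_expR.
    by have [h|h] := leP 0 (2 * x * sqrt2); [rewrite (ger0_norm h)|rewrite (ltr0_norm h)]; lra.
  have -> : (expR `|x| / 2) ^+ 2 = expR (2 * `|x|) / 4 by rewrite expr_div_n expRM_natl; congr (_ / _); ring.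
  by rewrite /cosh; have := expR_ge0 (2 * `|x|); lra.
have e0 : 0 < expR `|x| by exact: expR_gt0.
have s0 : 0 < Num.sqrt (cosh (2 * x * sqrt2)) by rewrite sqrtr_gt0 cosh_gt0.
have h2 : Rsol x <= 3 `^ 4^-1 * 2 * expR (- `|x|).
  rewrite -[leRHS]mulrA; apply: ler_wpM2l => //.
  rewrite expRN -[X in _ <= X * _]invrK -invfM lef_pV2 ?posrE ?mulr_gt0 ?invr_gt0//; by rewrite mulrC.
apply: le_trans (ler_wpM2r _ h2) _; first by rewrite exprn_ge0// addr_ge0.
rewrite /D -!mulrA; apply: ler_wpM2l => //; apply: ler_wpM2l => //.
have := @exprn_expR_le R n (1 + `|x|); rewrite addr_ge0// => /(_ erefl).
move=> /(ler_wpM2l (expR_ge0 1)); apply: le_trans.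
rewrite opprD expRD mulrCA (mulrA (expR 1)) -expRD subrr expR0 mul1r.
by rewrite (mulrC (expR _)).
Qed.

(** ** Lebesgue integrability against (1 + x^2)^-1 *)

Lemma int_oneDsqr : (\int[mu]_x ((oneDsqr x)^-1)%:E = (pi : R)%:E)%E.
Proof.
rewrite ge0_symfun_integralT//.
- have -> : [set x : R | 0 <= x] = `[0, +oo[ by apply/seteqP; split => x; rewrite /= in_itv/= andbT.
  by rewrite integral0y_oneDsqr -EFinM mulrC divfK.
- by move=> x; exact: continuous_oneDsqrV.
- by move=> x /=; rewrite /oneDsqr sqrrN.
Qed.

(** The L2-normalised dilation by [e]. *)
Definition dil (e : R) f x : R := (Num.sqrt e)^-1 * f (x / e).

Lemma int_dil_oneDsqr (e : R) : 0 < e ->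
  intg (fun x => e^-1 * (oneDsqr (x / e))^-1) /\
  \int[mu]_x (e^-1 * (oneDsqr (x / e))^-1) = pi.
Proof.
move=> e0; pose F x : R := e^-1 * x.
have dF x : der F x e^-1 by apply: der_eq (derZ e^-1 (der_id x)) _; rewrite mulr1.
have F' : F^`() = fun=> e^-1 by apply/funext => x; exact: der_derive1 (dF x).
have ei : 0 < e^-1 by rewrite invr_gt0.
have g0 x : 0 <= (oneDsqr x)^-1 :> R by rewrite invr_ge0 (le_trans ler01)// oneDsqr_ge1.
have hE : (\int[mu]_x ((oneDsqr x)^-1)%:E = \int[mu]_x ((oneDsqr (F x))^-1 * derive1 F x)%:E)%E.
  apply: (@increasing_ge0_integration_by_substitutionT R F (fun x => (oneDsqr x)^-1)).
  - by move=> a b ab; rewrite /F ltr_pM2l.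
  - by rewrite F' => y; exact: cvg_cst.
  - by rewrite F'; exact: is_cvg_cst.
  - by rewrite F'; exact: is_cvg_cst.
  - by move=> y; exact: der_derivable (dF y).
  - apply/cvgrNyPle => A; near=> y; have : y <= A * e by near: y; apply: nbhs_ninfty_le; exact: num_real.
    by rewrite /F [_ * y]mulrC; move=> ?; rewrite ler_pdivrMr.
  - apply/cvgryPge => A; near=> y; have : A * e <= y by near: y; apply: nbhs_pinfty_ge; exact: num_real.
    by rewrite /F [_ * y]mulrC; move=> ?; rewrite ler_pdivlMr.
  - by move=> x; exact: continuous_oneDsqrV.
  - exact: g0.
rewrite int_oneDsqr F' in hE.
have hE2 : (\int[mu]_x (e^-1 * (oneDsqr (x / e))^-1)%:E = (pi : R)%:E)%E.
  by rewrite hE; apply: eq_integral => x _; rewrite /F [in LHS]mulrC (mulrC x).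
split; last by rewrite /Rintegral hE2.
have p0 x : 0 <= e^-1 * (oneDsqr (x / e))^-1 by rewrite mulr_ge0// ltW.
apply/integrableP; split.
  apply/measurable_EFinP; apply: continuous_mfun => x.
  apply: cvgM; first exact: cvg_cst.
  have h : y / e @[y --> x] --> x / e by apply: cvgM; [exact: cvg_id|exact: cvg_cst].
  have hc : {for x, continuous ((fun z => (oneDsqr z)^-1) \o (fun z => z / e))}.
    by apply: continuous_comp; [exact: h|exact: continuous_oneDsqrV].
  exact: hc.
under eq_integral do rewrite /= ger0_norm//.
by rewrite hE2 ltry.
Unshelve. all: by end_near. Qed.

Lemma dil_L2 (e C : R) f : 0 < e -> 0 <= C -> measurable_fun setT f ->
  (forall x, `|f x| * oneDsqr x <= C) ->
  inL2 (dil e f) /\ nrm (dil e f) <= C * Num.sqrt pi.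
Proof.
move=> e0 C0 mf hf; have [i1 i2] := int_dil_oneDsqr e0.
have o1 x : 1 <= oneDsqr x :> R by exact: oneDsqr_ge1.
have o0 x : 0 < oneDsqr x :> R by exact: lt_le_trans (o1 x).
have md : measurable_fun setT (dil e f).
  apply: measurable_funM => //; apply: (measurableT_comp mf).
  exact: measurable_funM.
have dom x : dil e f x ^+ 2 <= C ^+ 2 * (e^-1 * (oneDsqr (x / e))^-1).
  rewrite /dil exprMn exprVn sqr_sqrtr ?(ltW e0)// [leRHS]mulrCA; apply: ler_wpM2l.
    by rewrite invr_ge0 ltW.
  rewrite ler_pdivlMr// -(real_normK (num_real (f _))).
  apply: (@le_trans _ _ ((`|f (x / e)| * oneDsqr (x / e)) ^+ 2)).
    rewrite exprMn; apply: ler_wpM2l; first exact: sqr_ge0.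
    by rewrite expr2; apply: ler_peMr; [exact: ltW|exact: o1].
  by rewrite lerXn2r ?nnegrE// mulr_ge0// ltW.
have i3 := intgZ (C ^+ 2) i1.
have i4 : intg (fun x => dil e f x ^+ 2).
  apply: intg_le i3; first exact: measurable_funX.
  by move=> x; rewrite ger0_norm ?sqr_ge0.
split; first by split.
rewrite -[leRHS]ger0_norm ?mulr_ge0 ?sqrtr_ge0// -sqrtr_sqr; apply: ler_wsqrtr.
rewrite exprMn sqr_sqrtr ?pi_ge0// -i2 -intZ//.
exact: int_le.
Qed.

Lemma Rsol_inL2 : inL2 (@Rsol R) /\ inL2 (fun x => - sqrt2 * th x * Rsol x).
Proof.
have [D D0 hD] := Rsol_decay 2.
have o2 x : oneDsqr x <= (1 + `|x|) ^+ 2 :> R.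
  by rewrite /oneDsqr -(real_normK (num_real x)); have := normr_ge0 x; nra.
have hf x : `|Rsol x| * oneDsqr x <= D.
  rewrite ger0_norm ?(ltW (Rsol_gt0 x))//; apply: le_trans (hD x).
  by apply: ler_wpM2l => //; rewrite ltW// Rsol_gt0.
have d1 f : dil 1 f = f by apply/funext => x; rewrite /dil sqrtr1 !invr1 mul1r mulr1.
have [h _] := dil_L2 ltr01 D0 (continuous_mfun continuous_Rsol) hf.
rewrite d1 in h; split => //.
have mth : measurable_fun setT (fun x => - sqrt2 * th x).
  apply: continuous_mfun => x; apply: cvgM; first exact: cvg_cst.
  exact: der_continuous (der_th x).
apply: (inL2_bdd (c := sqrt2) mth _ h) => x.
rewrite normrM normrN (ger0_norm (sqrtr_ge0 _)) ler_piMr ?sqrtr_ge0//.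
exact: th_bound.
Qed.

Lemma is_H1_real Q : is_H1 (fun x => (Q x)%:C) ->
  inL2 Q /\ exists2 g, wder Q g & inL2 g.
Proof.
move=> [/is_L2P[h1 _] [g [/is_weak_derivP[w1 _] /is_L2P[g1 _]]]].
by split => //; exists (re g).
Qed.

Lemma Rsol_is_H1 : is_H1 (fun x : R => (Rsol x)%:C).
Proof.
have [h1 h2] := Rsol_inL2; have z := @inL20 R; split; first by apply/is_L2P.
exists (fun x => (- sqrt2 * th x * Rsol x)%:C); split; last by apply/is_L2P.
apply/is_weak_derivP; split.
  by apply: der_wder; [exact: der_Rsol|exact: continuous_dRsol].
have d0 x : der (fun=> 0 : R) x 0 by exact: der_cst.
have c0 : continuous (fun _ : R => 0 : R) by move=> x; exact: cvg_cst.
exact: der_wder d0 c0.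
Qed.

(** ** Uniqueness of the ground state *)

Section UniqueGroundState.
Context (Q : R -> R) (gQ : ground_state_equation Q) (hQ : is_H1 (fun x => (Q x)%:C)).

Let Q1 := derive1 Q.

Let dQ x : der Q x (Q1 x).
Proof. by have [h _ _] := gQ x; exact: derivable_der. Qed.

Let dQ1 x : der Q1 x (2 * Q x - 2 * Q x ^+ 5).
Proof.
have [_ h e] := gQ x; apply: der_eq (derivable_der h) _.
by move: e; rewrite derive1nS derive1n1; lra.
Qed.

Let cQ : continuous Q. Proof. by move=> x; exact: der_continuous (dQ x). Qed.
Let cQ1 : continuous Q1. Proof. by move=> x; exact: der_continuous (dQ1 x). Qed.

Let Q_inL2 : inL2 Q. Proof. by have [] := is_H1_real hQ. Qed.

Let Q1_inL2 : inL2 Q1.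
Proof.
have [_ [g wg hg]] := is_H1_real hQ.
apply: (inL2_ae (continuous_mfun cQ1) _ hg); exact: wder_uniq wg (der_wder dQ cQ1).
Qed.

(** The square is a primitive of twice [Q * Q1], which is integrable. *)
Let Q_bounded : exists B : R, forall x, Q x ^+ 2 <= B.
Proof.
pose S := \int[mu]_x (Q x ^+ 2 + Q1 x ^+ 2).
exists (Q 0 ^+ 2 + S) => x.
have i1 : intg (fun x => Q x ^+ 2 + Q1 x ^+ 2) by apply: intgD; exact: inL2_sq.
have dsq y : der (fun y => Q y ^+ 2) y (2 * (Q y * Q1 y)).
  by apply: der_eq (derX 2 (dQ y)) _; rewrite expr1; ring.
have csq : continuous (fun y => 2 * (Q y * Q1 y)).
  by move=> y; apply: cvgM; [exact: cvg_cst|apply: cvgM; [exact: cQ|exact: cQ1]].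
have i2 : intg (fun y => 2 * (Q y * Q1 y)) by apply: intgZ; exact: inL2M.
have key (a b : R) : a < b -> `|Q b ^+ 2 - Q a ^+ 2| <= S.
  move=> ab; rewrite -(int_FTC ab dsq csq) Rintegral_mkcond.
  have ir := intg_restrict `[a, b]%R i2.
  apply: le_trans (int_norm ir) _; apply: int_le => //; first exact: intg_norm.
  move=> y; rewrite patchE; case: ifPn => _; last by rewrite normr0 addr_ge0 ?sqr_ge0.
  have h1 := sqr_ge0 (Q y - Q1 y); have h2 := sqr_ge0 (Q y + Q1 y).
  by rewrite ler_norml; apply/andP; split; nra.
have S0 : 0 <= S by apply: int_ge0 => y; rewrite addr_ge0 ?sqr_ge0.
have [h|h|<-] := ltgtP 0 x; last by rewrite lerDl.
- by have := key _ _ h; rewrite ler_norml => /andP[_]; lra.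
- by have := key _ _ h; rewrite ler_norml => /andP[]; lra.
Qed.

(** The energy of the trajectory is integrable, hence zero. *)
Let energy x : Q1 x ^+ 2 = 2 * Q x ^+ 2 - 2 / 3 * Q x ^+ 6.
Proof.
pose E x := Q1 x ^+ 2 - 2 * Q x ^+ 2 + 2 / 3 * Q x ^+ 6.
have dE y : der E y 0.
  have := derD (derB (derX 2 (dQ1 y)) (derZ 2 (derX 2 (dQ y)))) (derZ (2 / 3) (derX 6 (dQ y))).
  by move=> h; apply: der_eq h _; rewrite /= expr1; field.
have Ec := der_const dE.
have iE : intg E.
  have [B hB] := Q_bounded; have B0 : 0 <= B by exact: le_trans (sqr_ge0 _) (hB 0).
  apply: (@intg_le _ _ (fun x => Q1 x ^+ 2 + (2 + 2 / 3 * B ^+ 2) * Q x ^+ 2)).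
  - by apply: continuous_mfun => y; exact: der_continuous (dE y).
  - move=> y; have q0 := sqr_ge0 (Q y); have q10 := sqr_ge0 (Q1 y).
    have q6 : Q y ^+ 6 = (Q y ^+ 2) ^+ 2 * Q y ^+ 2 by ring.
    have q6B : Q y ^+ 6 <= B ^+ 2 * Q y ^+ 2.
      rewrite q6; apply: ler_wpM2r => //; rewrite lerXn2r ?nnegrE//; exact: hB.
    have q60 : 0 <= Q y ^+ 6 by rewrite q6 mulr_ge0// sqr_ge0.
    by rewrite /E ler_norml; apply/andP; split; lra.
  - by apply: intgD; [exact: inL2_sq|apply: intgZ; exact: inL2_sq].
have E0 : E 0 = 0.
  apply/eqP; apply: contraT => En0; exfalso.
  have : intg (fun=> 1 : R).
    by apply: intg_eq (intgZ (E 0)^-1 iE) => y; rewrite (Ec y 0) mulVf.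
  move=> /integrableP[_]; under eq_integral do rewrite /= normr1.
  rewrite integral_cst// mul1e.
  by have := lebesgue_measure_itv (`]-oo, +oo[%R : interval R); rewrite set_itvNyy /= => ->.
by have := Ec x 0; rewrite E0 /E; lra.
Qed.

(** The energy identity gives |Q'| <= sqrt 2 |Q|, so that Q^2 times a suitable
    exponential is monotone in either direction; a zero would propagate. *)
Let Q_neq0 : (exists x, Q x != 0) -> forall x, Q x != 0.
Proof.
move=> [x1 Qx1] x0; apply/eqP => Q0; move/eqP: Qx1; apply.
have k0 := sqrtr_ge0 (2 : R); have k2 := sqrt2_sq.
have bnd y : `|2 * (Q y * Q1 y)| <= 2 * sqrt2 * Q y ^+ 2.
  have h : `|Q1 y| <= sqrt2 * `|Q y|.
    rewrite -(@ler_pXn2r _ 2)// ?nnegrE ?mulr_ge0//.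
    rewrite exprMn !real_normK ?num_real// k2 energy.
    have -> : Q y ^+ 6 = (Q y ^+ 3) ^+ 2 by ring.
    by have := sqr_ge0 (Q y ^+ 3); lra.
  rewrite !normrM (@ger0_norm _ 2)// -mulrA -(real_normK (num_real (Q y))).
  apply: ler_wpM2l => //; rewrite expr2 mulrCA.
  exact: ler_wpM2l.
have dsq y : der (fun y => Q y ^+ 2) y (2 * (Q y * Q1 y)).
  by apply: der_eq (derX 2 (dQ y)) _; rewrite expr1; ring.
have dexp (s : R) y : der (fun y => expR (s * y)) y (expR (s * y) * s).
  by apply: der_expR; apply: der_eq (derZ s (der_id y)) _; rewrite mulr1.
pose k : R := 2 * sqrt2.
have eg (s : R) y : 0 < expR (s * y) by exact: expR_gt0.
apply/eqP; rewrite -sqrf_eq0 eq_le sqr_ge0 andbT.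
have [h|h] := leP x0 x1.
  have dec y : der (fun y => - (expR (- k * y) * Q y ^+ 2)) y
      (- (expR (- k * y) * (2 * (Q y * Q1 y) - k * Q y ^+ 2))).
    by apply: der_eq (derN (derM (dexp (- k) y) (dsq y))) _; ring.
  have := der_nondecr h (fun y _ => dec y) _.
  rewrite Q0 expr0n mulr0 oppr0 => /(_ _).
  have H : 0 <= - (expR (- k * x1) * Q x1 ^+ 2) -> Q x1 ^+ 2 <= 0.
    by rewrite oppr_ge0 pmulr_rle0.
  move=> hh; apply: H; apply: hh => y _.
  rewrite -mulrN mulr_ge0 ?(ltW (eg _ _))// opprB subr_ge0.
  exact: le_trans (ler_norm _) (bnd y).
have inc y : der (fun y => expR (k * y) * Q y ^+ 2) y
    (expR (k * y) * (k * Q y ^+ 2 + 2 * (Q y * Q1 y))).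
  by apply: der_eq (derM (dexp k y) (dsq y)) _; ring.
have := der_nondecr (ltW h) (fun y _ => inc y) _.
rewrite Q0 expr0n mulr0 => hh.
rewrite -(pmulr_rle0 _ (eg k x1)); apply: hh => y _.
rewrite mulr_ge0 ?(ltW (eg _ _))//.
have := bnd y; rewrite ler_norml => /andP[hb _]; rewrite /k; lra.
Qed.

(** The function Q^-2 solves the linear equation w'' = 8 w. *)
Lemma ground_state_unique : (exists x, Q x != 0) ->
  exists (s : bool) (x0 : R), forall x, Q x = (-1) ^+ s * Rsol (x - x0).
Proof.
move=> /Q_neq0 Qn0; have k2 := sqrt2_sq; have s1 := sqrt2_gt1.
pose k : R := 2 * sqrt2.
have k0 : 0 < k by rewrite /k; lra.
have kk : k ^+ 2 = 8 by rewrite /k exprMn k2; ring.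
pose w x := (Q x ^+ 2)^-1.
pose w1 x := - 2 * Q1 x / Q x ^+ 3.
have w0 x : 0 < w x by rewrite invr_gt0 lt_def sqr_ge0 andbT expf_neq0.
have dw x : der w x (w1 x).
  have := derV (f := fun z => Q z ^+ 2) (expf_neq0 2 (Qn0 x)) (derX 2 (dQ x)).
  by move=> h; apply: der_eq h _; rewrite /w1 expr1 /=; field; rewrite Qn0.
have dw1 x : der w1 x (8 * w x).
  have := derM (derZ (- 2) (dQ1 x)) (derV (f := fun z => Q z ^+ 3) (expf_neq0 3 (Qn0 x)) (derX 3 (dQ x))).
  move=> h; apply: der_eq h _; rewrite /w /=.
  have -> : - 2 * (2 * Q x - 2 * Q x ^+ 5) * (Q x ^+ 3)^-1 +
    - 2 * Q1 x * (- (3 * Q x ^+ 2 * Q1 x) / (Q x ^+ 3) ^+ 2) =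
    - 2 * (2 * Q x - 2 * Q x ^+ 5) / Q x ^+ 3 + 6 * Q1 x ^+ 2 / Q x ^+ 4 by field; rewrite Qn0.
  by rewrite energy; field; rewrite Qn0.
(* first integrals of w'' = 8 w: the coefficients of its two exponentials *)
pose P x := (w1 x + k * w x) * expR (- k * x).
pose N x := (k * w x - w1 x) * expR (k * x).
have dexp (s : R) y : der (fun y => expR (s * y)) y (expR (s * y) * s).
  by apply: der_expR; apply: der_eq (derZ s (der_id y)) _; rewrite mulr1.
have dP x : der P x 0.
  have := derM (derD (dw1 x) (derZ k (dw x))) (dexp (- k) x).
  move=> h; apply: der_eq h _.
  rewrite (_ : _ + _ = (8 - k ^+ 2) * w x * expR (- k * x)); last by ring.
  by rewrite kk subrr !mul0r.
have dN x : der N x 0.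
  have := derM (derB (derZ k (dw x)) (dw1 x)) (dexp k x).
  move=> h; apply: der_eq h _.
  rewrite (_ : _ + _ = (k ^+ 2 - 8) * w x * expR (k * x)); last by ring.
  by rewrite kk subrr !mul0r.
have PN x : P x * N x = 8 / 3.
  have ee : expR (- k * x) * expR (k * x) = 1 by rewrite -expRD -mulrDl addNr mul0r expR0.
  have -> : P x * N x = (k ^+ 2 * w x ^+ 2 - w1 x ^+ 2) * (expR (- k * x) * expR (k * x)).
    by rewrite /P /N; ring.
  rewrite ee mulr1 kk /w /w1.
  have -> : (- 2 * Q1 x / Q x ^+ 3) ^+ 2 = 4 * Q1 x ^+ 2 / Q x ^+ 6 by field; rewrite Qn0.
  by rewrite energy; field; rewrite Qn0.
have Pc := der_const dP; have Nc := der_const dN.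
have sum x : P 0 * expR (k * x) + N 0 * expR (- k * x) = 2 * k * w x.
  rewrite -(Pc x 0) -(Nc x 0).
  have ee : expR (- k * x) * expR (k * x) = 1 by rewrite -expRD -mulrDl addNr mul0r expR0.
  have -> : P x * expR (k * x) + N x * expR (- k * x) =
    2 * k * w x * (expR (- k * x) * expR (k * x)) by rewrite /P /N; ring.
  by rewrite ee mulr1.
have sum0 := sum 0; rewrite !mulr0 expR0 !mulr1 in sum0.
have PN0 := PN 0; have w00 := w0 0.
have kw : 0 < k * w 0 by rewrite mulr_gt0.
have P0 : 0 < P 0 by nra.
have N0 : 0 < N 0 by nra.
(* the point at which the two exponentials have equal size *)
pose x0 : R := ln (N 0 / P 0) / (2 * k).
have ex0 : expR (k * x0) ^+ 2 = N 0 / P 0.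
  rewrite -expRM_natl.
  have -> : 2 * (k * x0) = ln (N 0 / P 0) by rewrite /x0; field; rewrite gt_eqF.
  by rewrite lnK// posrE divr_gt0.
pose E := expR (k * x0); have E0 : 0 < E by exact: expR_gt0.
have PE : N 0 = P 0 * E ^+ 2 by rewrite ex0 mulrC divfK// gt_eqF.
have PE2 : (P 0 * E) ^+ 2 = 8 / 3 by rewrite -PN0 PE; ring.
have wE x : w x ^+ 2 = (cosh (2 * (x - x0) * sqrt2)) ^+ 2 / 3.
  have hE : 2 * (x - x0) * sqrt2 = k * x - k * x0 by rewrite /k; ring.
  have hc : 2 * k * w x = (P 0 * E) * (2 * cosh (2 * (x - x0) * sqrt2)).
    rewrite -sum PE hE /cosh opprB !expRD expRN (mulNr k) expRN -/E; field.
    by rewrite !gt_eqF// expR_gt0.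
  have : k ^+ 2 * w x ^+ 2 = (P 0 * E) ^+ 2 * cosh (2 * (x - x0) * sqrt2) ^+ 2.
    have {}hc : k * w x = P 0 * E * cosh (2 * (x - x0) * sqrt2) by lra.
    by rewrite -exprMn hc exprMn.
  by rewrite kk PE2; lra.
have Q4 x : (Q x ^+ 2) ^+ 2 = (Rsol (x - x0) ^+ 2) ^+ 2.
  have := wE x; rewrite /w exprVn -!exprM => hw.
  rewrite Rsol4 th_sq opprB addrC subrK -[LHS]invrK hw.
  have c0 := cosh_gt0 (2 * (x - x0) * sqrt2).
  by field; rewrite gt_eqF.
have Q2 x : Q x ^+ 2 = Rsol (x - x0) ^+ 2.
  by apply/eqP; rewrite -(@eqrXn2 _ 2) ?sqr_ge0 //; apply/eqP; exact: Q4.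
have absQ x : `|Q x| = Rsol (x - x0).
  rewrite -[RHS]gtr0_norm ?Rsol_gt0//; apply/eqP.
  by rewrite -(@eqrXn2 _ 2)// !real_normK ?num_real// Q2.
have sign x : 0 < Q x * Q 0.
  rewrite lt_def mulf_neq0//= leNgt; apply/negP => neg.
  have key (a b : R) : a <= b -> Q a * Q b < 0 -> False.
    move=> ab hab.
    have cab : {within `[a, b], continuous Q} by exact: continuous_subspaceT.
    have [|c _ /eqP] := @IVT _ Q a b 0 ab cab; last by rewrite (negbTE (Qn0 c)).
    have [Qa|Qa] := ltP (Q a) 0.
      have : 0 <= Q b by nra.
      by move=> Qb; rewrite ge_min le_max Qb (ltW Qa) orbT.
    have : Q b <= 0 by nra.
    by move=> Qb; rewrite ge_min le_max Qb Qa orbT.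
  have [h|h] := leP x 0; first exact: (key _ _ h).
  by apply: (key _ _ (ltW h)); rewrite mulrC.
have [Q00|Q00] := ltP 0 (Q 0).
  exists false, x0 => x; rewrite expr0 mul1r -absQ gtr0_norm//.
  by have := sign x; rewrite pmulr_lgt0.
have {}Q00 : Q 0 < 0 by rewrite lt_neqAle Qn0.
exists true, x0 => x; rewrite expr1 mulN1r -absQ ltr0_norm ?opprK//.
by have := sign x; rewrite nmulr_lgt0.
Qed.

End UniqueGroundState.

End GroundState.

(** * Lens-modulated profiles and their dependence on parameters *)

Lemma der_bound_itv {R : realType} (f g : R -> R) (lo hi a b K : R) :
  lo <= a <= hi -> lo <= b <= hi ->
  (forall x, lo <= x <= hi -> der f x (g x)) ->
  (forall x, lo <= x <= hi -> `|g x| <= K) -> `|f b - f a| <= K * `|b - a|.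
Proof.
move=> aI bI fg gK.
wlog ab : a b aI bI / a < b => [hw|].
  have [ab|ba|->] := ltgtP a b; first exact: hw.
  - by rewrite distrC (distrC b); exact: hw.
  - by rewrite !subrr normr0 mulr0.
have abI x : a <= x <= b -> lo <= x <= hi.
  by move: aI bI => /andP[? _] /andP[_ ?] /andP[? ?]; apply/andP; split; lra.
have [c cab ->] := mvt ab (fun x xI => fg x (abI x xI)).
rewrite normrM ler_wpM2r//; apply: gK; apply: abI.
by case/andP: cab => *; rewrite !ltW.
Qed.

Section Profile.
Context {R : realType}.
Implicit Types (e x y : R) (C S : R -> R).

Local Notation mu := (@lebesgue_measure R).

(** The parameters of a profile are its amplitude, the coefficient of its
    quadratic oscillation, and its phase. *)
Definition par := (R * R * R)%type.
Implicit Types (p q : par) (F G : par -> R -> R).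

Definition am p : R := p.1.1.
Definition ch p : R := p.1.2.
Definition ph p : R := p.2.

Definition pdist p q : R := `|am p - am q| + `|ch p - ch q| + `|ph p - ph q|.

(** The real and the imaginary part of a profile oscillate like (cos, sin) and
    (sin, - cos); both pairs are treated at once. *)
Definition osc C S := [/\ forall (f : R -> R) (x a : R), der f x a -> der (fun z => C (f z)) x (- S (f x) * a),
  forall (f : R -> R) (x a : R), der f x a -> der (fun z => S (f z)) x (C (f x) * a),
  forall x : R, `|C x| <= 1 & forall x : R, `|S x| <= 1].

Lemma osc_cos : osc cos sin.
Proof.
split; [exact: der_cos|exact: der_sin| |].
  by move=> x; rewrite ler_norml cos_geN1 cos_le1.
by move=> x; rewrite ler_norml sin_geN1 sin_le1.
Qed.

Lemma osc_sin : osc sin (fun x => - cos x).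
Proof.
have [dc ds c1 s1] := osc_cos; split => //.
- by move=> f x a df; rewrite opprK; exact: ds.
- by move=> f x a df; apply: der_eq (derN (dc _ _ _ df)) _; rewrite mulNr opprK.
- by move=> x; rewrite normrN.
Qed.

Lemma oscN C S : osc C S -> osc S (fun x => - C x).
Proof.
move=> [dc ds c1 s1]; split => //.
- by move=> f x a df; rewrite opprK; exact: ds.
- by move=> f x a df; apply: der_eq (derN (dc _ _ _ df)) _; rewrite mulNr opprK.
- by move=> x; rewrite normrN.
Qed.

Lemma osc_lip C S x y : osc C S -> `|C x - C y| <= `|x - y|.
Proof.
move=> [dc _ _ s1]; rewrite -[leRHS]mul1r; apply: (@der_bound _ C (fun z => - S z)).
  by move=> z; apply: der_eq (dc _ _ _ (der_id z)) _; rewrite mulr1.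
by move=> z; rewrite normrN.
Qed.

Section Box.
Context (m M B : R) (m0 : 0 < m) (mM : m <= M) (B0 : 0 <= B).

Definition box p := m <= am p <= M /\ `|ch p| <= B.

Local Notation w y := (1 + `|y|).

(** Families that grow at most polynomially, respectively decay faster than
    any power, and depend on the parameters in a Lipschitz way at the same
    rate. *)
Definition tempered F := exists (n : nat) (D : R), 0 <= D /\ forall p q y, box p -> box q ->
  `|F p y| <= D * w y ^+ n /\ `|F p y - F q y| <= D * pdist p q * w y ^+ n.

Definition rapid F := forall n : nat, exists2 D : R, 0 <= D & forall p q y, box p -> box q ->
  `|F p y| * w y ^+ n <= D /\ `|F p y - F q y| * w y ^+ n <= D * pdist p q.

Lemma pdist_ge0 p q : 0 <= pdist p q.
Proof. by rewrite !addr_ge0. Qed.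

Let w1 y : 1 <= w y. Proof. by rewrite lerDl. Qed.
Let w0 y : 0 < w y. Proof. exact: lt_le_trans (w1 y). Qed.
Let wX (n : nat) y : 0 < w y ^+ n. Proof. by rewrite exprn_gt0. Qed.

Let prod_diff (a b c d : R) : `|a * b - c * d| <= `|a| * `|b - d| + `|a - c| * `|d|.
Proof.
have -> : a * b - c * d = a * (b - d) + (a - c) * d by ring.
by apply: le_trans (ler_normD _ _) _; rewrite !normrM.
Qed.

Let am_ge0 p : box p -> 0 <= am p.
Proof. by move=> [/andP[h _] _]; exact: le_trans (ltW m0) h. Qed.

Lemma temperedM F G : tempered F -> tempered G -> tempered (fun p y => F p y * G p y).
Proof.
move=> [n [D [D0 hF]]] [k [E [E0 hG]]]; exists (n + k)%N, (2 * D * E); split; first by rewrite !mulr_ge0.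
move=> p q y bp bq; have [f1 f2] := hF p q y bp bq; have [g1 g2] := hG p q y bp bq.
have [g3 _] := hG q q y bq bq.
have d0 := pdist_ge0 p q; have wn := ltW (wX n y); have wk := ltW (wX k y).
split.
  rewrite normrM exprD; apply: le_trans (ler_pM _ _ f1 g1) _ => //.
  have -> : 2 * D * E * (w y ^+ n * w y ^+ k) = D * w y ^+ n * (E * w y ^+ k) + D * w y ^+ n * (E * w y ^+ k) by ring.
  by rewrite lerDl !mulr_ge0.
apply: le_trans (prod_diff _ _ _ _) _; rewrite exprD.
have -> : 2 * D * E * pdist p q * (w y ^+ n * w y ^+ k) =
  D * w y ^+ n * (E * pdist p q * w y ^+ k) + D * pdist p q * w y ^+ n * (E * w y ^+ k) by ring.
by apply: lerD; apply: ler_pM.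
Qed.

(** One factor of the rapidly decaying family pays for the growth of the other. *)
Lemma rapidM F G : tempered F -> rapid G -> rapid (fun p y => F p y * G p y).
Proof.
move=> [n [D [D0 hF]]] hG N; have [E E0 {}hG] := hG (N + n)%N.
exists (2 * D * E); first by rewrite !mulr_ge0.
move=> p q y bp bq; have [f1 f2] := hF p q y bp bq; have [g1 g2] := hG p q y bp bq.
have [g3 _] := hG q q y bq bq.
have d0 := pdist_ge0 p q; have wn := ltW (wX n y); have wk := ltW (wX N y).
rewrite !exprD in g1 g2 g3.
split.
  rewrite normrM; apply: (@le_trans _ _ (D * (`|G p y| * (w y ^+ N * w y ^+ n)))).
    have -> : D * (`|G p y| * (w y ^+ N * w y ^+ n)) = D * w y ^+ n * (`|G p y| * w y ^+ N) by ring.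
    by rewrite -[leLHS]mulrA; apply: ler_wpM2r => //; rewrite mulr_ge0.
  apply: le_trans (ler_wpM2l D0 g1) _.
  by rewrite -mulrA -[leLHS]mul1r; apply: ler_wpM2r; [rewrite mulr_ge0|lra].
apply: (@le_trans _ _ (D * (`|G p y - G q y| * (w y ^+ N * w y ^+ n)) +
   D * pdist p q * (`|G q y| * (w y ^+ N * w y ^+ n)))).
  apply: le_trans (ler_wpM2r wk (prod_diff _ _ _ _)) _; rewrite mulrDl.
  have -> : D * (`|G p y - G q y| * (w y ^+ N * w y ^+ n)) =
     D * w y ^+ n * (`|G p y - G q y| * w y ^+ N) by ring.
  have -> : D * pdist p q * (`|G q y| * (w y ^+ N * w y ^+ n)) =
     D * pdist p q * w y ^+ n * (`|G q y| * w y ^+ N) by ring.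
  rewrite -!mulrA; apply: lerD; rewrite !mulrA -!(mulrA _ `|_| (_ ^+ N)).
    by apply: ler_wpM2r => //; rewrite mulr_ge0.
  by apply: ler_wpM2r => //; rewrite mulr_ge0.
have -> : 2 * D * E * pdist p q = D * (E * pdist p q) + D * pdist p q * E by ring.
by apply: lerD; apply: ler_wpM2l => //; rewrite mulr_ge0.
Qed.

Lemma rapidD F G : rapid F -> rapid G -> rapid (fun p y => F p y + G p y).
Proof.
move=> hF hG N; have [D D0 {}hF] := hF N; have [E E0 {}hG] := hG N.
exists (D + E); first by rewrite addr_ge0.
move=> p q y bp bq; have [f1 f2] := hF p q y bp bq; have [g1 g2] := hG p q y bp bq.
have wk := ltW (wX N y).
split.
  apply: le_trans (ler_wpM2r wk (ler_normD _ _)) _; rewrite mulrDl; exact: lerD.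
rewrite opprD addrACA; apply: le_trans (ler_wpM2r wk (ler_normD _ _)) _.
by rewrite mulrDl (mulrDl D); exact: lerD.
Qed.

Lemma tempered_cst c : tempered (fun _ _ => c).
Proof.
exists 0%N, `|c|; split => // p q y _ _; rewrite expr0 !mulr1 subrr normr0; split => //.
by rewrite mulr_ge0// pdist_ge0.
Qed.

Lemma tempered_am : tempered (fun p _ => am p).
Proof.
have M0 : 0 <= M by exact: le_trans (ltW m0) mM.
exists 0%N, (M + 1); split; first by rewrite addr_ge0.
move=> p q y bp _; rewrite expr0 !mulr1; split.
  rewrite (ger0_norm (am_ge0 bp)); case: bp => /andP[_ p2] _.
  by apply: le_trans p2 _; rewrite lerDl.
have d0 := pdist_ge0 p q; rewrite mulrDl mul1r.
have : `|am p - am q| <= pdist p q by rewrite /pdist -addrA lerDl addr_ge0.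
by have := mulr_ge0 M0 d0; lra.
Qed.

Lemma tempered_ch : tempered (fun p _ => ch p).
Proof.
exists 0%N, (B + 1); split; first by rewrite addr_ge0.
move=> p q y [_ p1] _; rewrite expr0 !mulr1; split; first by lra.
have d0 := pdist_ge0 p q; rewrite mulrDl mul1r.
have : `|ch p - ch q| <= pdist p q by rewrite /pdist addrAC lerDr addr_ge0.
by have := mulr_ge0 B0 d0; lra.
Qed.

Lemma tempered_id : tempered (fun _ y => y).
Proof.
exists 1%N, 1; split => // p q y _ _; rewrite expr1 !mul1r subrr normr0; split.
  by rewrite lerDr.
by rewrite mulr_ge0 ?pdist_ge0// ltW.
Qed.

Lemma tempered_osc C S : osc C S -> tempered (fun p y => C (ph p + ch p * y ^+ 2 / 2)).
Proof.
move=> oC; exists 2%N, 1; split => // p q y _ _; have y0 := normr_ge0 y.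
rewrite !mul1r; split.
  by case: oC => _ _ c1 _; apply: le_trans (c1 _) _; rewrite exprn_ege1.
apply: le_trans (osc_lip _ _ oC) _.
have -> : ph p + ch p * y ^+ 2 / 2 - (ph q + ch q * y ^+ 2 / 2) =
  (ph p - ph q) + (ch p - ch q) * (y ^+ 2 / 2) by field.
apply: le_trans (ler_normD _ _) _; rewrite normrM (@ger0_norm _ (_ / 2)) ?divr_ge0 ?sqr_ge0//.
rewrite /pdist -(real_normK (num_real y)).
have := normr_ge0 (am p - am q); have := normr_ge0 (ch p - ch q); have := normr_ge0 (ph p - ph q).
by nra.
Qed.

Let sq_am p q : box p -> box q -> `|am p ^+ 2 - am q ^+ 2| <= 2 * M * pdist p q.
Proof.
move=> bp bq; have p0 := am_ge0 bp; have q0 := am_ge0 bq.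
case: bp bq => /andP[_ p2] _ [/andP[_ q2] _].
have -> : am p ^+ 2 - am q ^+ 2 = (am p + am q) * (am p - am q) by ring.
rewrite normrM (ger0_norm (addr_ge0 p0 q0)).
apply: ler_pM => //; first by rewrite addr_ge0.
  by rewrite mulrDl mul1r; exact: lerD.
by rewrite /pdist -addrA lerDl addr_ge0.
Qed.

Lemma tempered_th : tempered (fun p y => th (am p ^+ 2 * y)).
Proof.
have k0 := sqrtr_ge0 (2 : R); have M0 : 0 <= M by exact: le_trans (ltW m0) mM.
have kM : 0 <= Num.sqrt 2 * M by rewrite mulr_ge0.
exists 1%N, (1 + 4 * Num.sqrt 2 * M); split; first by rewrite -mulrA; lra.
move=> p q y bp bq; have y0 := normr_ge0 y; have d0 := pdist_ge0 p q.
rewrite expr1; split.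
  apply: le_trans (th_bound _) _; nra.
apply: (@le_trans _ _ (2 * Num.sqrt 2 * `|am p ^+ 2 * y - am q ^+ 2 * y|)).
  apply: (@der_bound _ (@th R) (fun x => 2 * Num.sqrt 2 * (1 - th x ^+ 2))); first exact: der_th.
  move=> x; rewrite normrM (@ger0_norm _ (_ * Num.sqrt 2)) ?mulr_ge0//; apply: ler_piMr; first by rewrite mulr_ge0.
  have := th_bound x; move=> h; have h2 : th x ^+ 2 <= 1 by rewrite -(real_normK (num_real (th x))) -[leRHS](expr1n _ 2) lerXn2r ?nnegrE.
  by have := sqr_ge0 (th x); rewrite ler_norml; lra.
rewrite -mulrBl normrM; have h := sq_am bp bq.
apply: (@le_trans _ _ (2 * Num.sqrt 2 * (2 * M * pdist p q * `|y|))).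
  by apply: ler_wpM2l; [rewrite mulr_ge0|apply: ler_wpM2r].
have -> : (1 + 4 * Num.sqrt 2 * M) * pdist p q * (1 + `|y|) =
  2 * Num.sqrt 2 * (2 * M * pdist p q * `|y|) + (pdist p q * (1 + `|y|) + 4 * (Num.sqrt 2 * M) * pdist p q) by ring.
rewrite lerDl addr_ge0//; first by rewrite mulr_ge0// ltW.
by rewrite mulr_ge0// mulr_ge0.
Qed.

(** The parameter is bounded below by [m], so that the decay of the ground state is
    uniform; the Lipschitz bound is the mean value theorem in the scale [s]. *)
Lemma rapid_Rsol : rapid (fun p y => Rsol (am p ^+ 2 * y)).
Proof.
move=> n; have M0 : 0 < M by exact: lt_le_trans m0 mM.
have k0 := sqrtr_ge0 (2 : R).
pose k : R := 1 + (m ^+ 2)^-1.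
have m2 : 0 < m ^+ 2 by rewrite exprn_gt0.
have k1 : 0 < k by rewrite addr_gt0// invr_gt0.
have [D1 D10 hD1] := @Rsol_decay R n; have [D2 D20 hD2] := @Rsol_decay R n.+1.
have dec (l : nat) (D s y : R) : m ^+ 2 <= s -> (forall x, Rsol x * w x ^+ l <= D) ->
    Rsol (s * y) * w y ^+ l <= k ^+ l * D.
  move=> ms hD; apply: (@le_trans _ _ (Rsol (s * y) * (k * w (s * y)) ^+ l)).
    apply: ler_wpM2l; first exact: ltW (Rsol_gt0 _).
    have kw0 : 0 <= k * w (s * y) by rewrite mulr_ge0// ltW.
    rewrite lerXn2r ?nnegrE// ?(ltW (w0 _))//.
    have s0 : 0 < s by exact: lt_le_trans ms.
    rewrite normrM (ger0_norm (ltW s0)) /k mulrDl mul1r.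
    have y0 := normr_ge0 y.
    have h : `|y| <= (m ^+ 2)^-1 * (s * `|y|).
      by rewrite mulrA ler_peMl// ler_pdivlMl// mulr1.
    have h2 : 0 <= s * `|y| by rewrite mulr_ge0// ltW.
    have h3 : 0 <= (m ^+ 2)^-1 by rewrite invr_ge0 ltW.
    by rewrite mulrDr mulr1; lra.
  rewrite exprMn mulrCA; apply: ler_wpM2l; [by rewrite exprn_ge0// ltW|exact: hD].
exists (k ^+ n * D1 + Num.sqrt 2 * (k ^+ n.+1 * D2) * (2 * M)).
  by rewrite addr_ge0// !mulr_ge0// ?exprn_ge0// ltW.
move=> p q y bp bq; have d0 := pdist_ge0 p q.
have wn := ltW (wX n y).
have [[/andP[p1 p2] _] [/andP[q1 q2] _]] := (bp, bq).
have p3 : m ^+ 2 <= am p ^+ 2 by rewrite lerXn2r// ?nnegrE ?(ltW m0)// am_ge0.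
have q3 : m ^+ 2 <= am q ^+ 2 by rewrite lerXn2r// ?nnegrE ?(ltW m0)// am_ge0.
have e1 : 0 <= k ^+ n * D1 by rewrite mulr_ge0// exprn_ge0// ltW.
have e2 : 0 <= Num.sqrt 2 * (k ^+ n.+1 * D2) by rewrite !mulr_ge0// exprn_ge0// ltW.
have e3 : 0 <= Num.sqrt 2 * (k ^+ n.+1 * D2) * (2 * M) by rewrite mulr_ge0// mulr_ge0// ltW.
split.
  rewrite gtr0_norm ?Rsol_gt0//; apply: le_trans (dec n D1 _ _ p3 hD1) _; lra.
have h := @der_bound_itv R (fun s => Rsol (s * y))
  (fun s => - Num.sqrt 2 * th (s * y) * Rsol (s * y) * y) (m ^+ 2)
  (Num.max (am p ^+ 2) (am q ^+ 2)) (am q ^+ 2) (am p ^+ 2)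
  (Num.sqrt 2 * (k ^+ n.+1 * D2) / w y ^+ n).
have {}h := h _ _ _ _.
rewrite q3 p3 !le_max !lexx orbT in h.
apply: le_trans (ler_wpM2r wn (h _ _ _ _)) _ => //.
- move=> s _; apply: (@der_comp _ (@Rsol R) (fun s => s * y)); first exact: der_Rsol.
  by apply: der_eq (derM (der_id s) (der_cst y s)) _; ring.
- move=> s /andP[ms _]; rewrite ler_pdivlMr// (normrM _ y) (normrM _ (Rsol (s * y))) (normrM _ (th (s * y))).
  rewrite normrN (ger0_norm k0) (gtr0_norm (Rsol_gt0 (s * y))).
  have hd := dec n.+1 D2 s y ms hD2; have ht := th_bound (s * y).
  move: (Rsol (s * y)) (Rsol_gt0 (s * y)) hd (th (s * y)) ht => r r0 hd T hT.
  apply: le_trans (ler_wpM2l k0 hd); rewrite exprS -(mulrA (_ * _ * r)) -(mulrA (_ * _)) -(mulrA (Num.sqrt 2)).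
  apply: ler_wpM2l => //.
  rewrite -[leRHS]mul1r; apply: ler_pM => //; first by rewrite mulr_ge0 ?(ltW r0)// mulr_ge0.
  apply: ler_wpM2l; first exact: ltW.
  by apply: ler_wpM2r => //; rewrite lerDr.
rewrite mulrAC divfK ?gt_eqF//.
apply: le_trans (ler_wpM2l e2 (sq_am bp bq)) _.
by rewrite [leLHS]mulrA [leRHS]mulrDl lerDr mulr_ge0.
Qed.

(** The decay beats the weight [oneDsqr], whose inverse has integral [pi] at every
    dilation: this is why the constant does not depend on [e]. *)
Lemma rapid_L2 F : rapid F -> (forall p, continuous (F p)) ->
  (forall e p, 0 < e -> box p -> inL2 (dil e (F p))) /\
  exists2 D : R, 0 <= D & forall e p q, 0 < e -> box p -> box q ->
    nrm (fun x => dil e (F p) x - dil e (F q) x) <= D * pdist p q.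
Proof.
move=> hF cF; have [D D0 hD] := hF 2%N.
have o2 y : oneDsqr y <= w y ^+ 2 :> R.
  by rewrite /oneDsqr -(real_normK (num_real y)); have := normr_ge0 y; nra.
split.
  move=> e p e0 bp; have [] := dil_L2 e0 D0 (continuous_mfun (cF p)) _ => // y.
  have [h _] := hD p p y bp bp; apply: le_trans h; exact: ler_wpM2l.
exists (D * Num.sqrt pi); first by rewrite mulr_ge0 ?sqrtr_ge0.
move=> e p q e0 bp bq.
have Dd0 : 0 <= D * pdist p q by rewrite mulr_ge0// pdist_ge0.
have [||_] := @dil_L2 _ e _ (fun y => F p y - F q y) e0 Dd0.
- by apply: measurable_funB; exact: continuous_mfun.
- by move=> y; have [_ h] := hD p q y bp bq; apply: le_trans h; exact: ler_wpM2l.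
rewrite mulrAC; apply: le_trans; rewrite le_eqVlt; apply/orP; left; apply/eqP.
by apply: nrm_eq => x; rewrite /dil mulrBr.
Qed.

End Box.

(** ** The profiles *)

Definition amp p y : R := am p * Rsol (am p ^+ 2 * y).
Definition amp1 p y : R := am p ^+ 3 * (- Num.sqrt 2 * th (am p ^+ 2 * y) * Rsol (am p ^+ 2 * y)).
(** The second derivative of the amplitude, by the ground state equation. *)
Definition amp2 p y : R := 2 * am p ^+ 4 * amp p y - 2 * amp p y ^+ 5.
Definition phase p y : R := ph p + ch p * y ^+ 2 / 2.

Definition prof C p y : R := amp p y * C (phase p y).
Definition prof1 C S p y : R := amp1 p y * C (phase p y) - amp p y * (ch p * y) * S (phase p y).
Definition prof2 C S p y : R :=
  (amp2 p y - amp p y * (ch p * y) ^+ 2) * C (phase p y)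
  - (2 * amp1 p y * (ch p * y) + amp p y * ch p) * S (phase p y).

Let der_lin (s y : R) : der (fun z => s * z) y s.
Proof. by apply: der_eq (derZ s (der_id y)) _; rewrite mulr1. Qed.

Lemma der_amp p y : der (amp p) y (amp1 p y).
Proof.
have := derZ (am p) (der_comp (f := @Rsol R) (der_Rsol _) (der_lin (am p ^+ 2) y)).
by move=> h; apply: der_eq h _; rewrite /amp1; ring.
Qed.

Lemma der_amp1 p y : der (amp1 p) y (amp2 p y).
Proof.
have := derZ (am p ^+ 3) (der_comp (f := fun x => - Num.sqrt 2 * th x * Rsol x) (der2_Rsol _) (der_lin (am p ^+ 2) y)).
by move=> h; apply: der_eq h _; rewrite /amp2 /amp; ring.
Qed.

Lemma der_phase p y : der (phase p) y (ch p * y).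
Proof.
have := derD (der_cst (ph p) y) (derZ (ch p / 2) (derX 2 (der_id y))).
move=> h; apply: der_ext (der_eq h _); first by move=> z; rewrite /phase /=; field.
by rewrite /= expr1; field.
Qed.

Lemma der_prof C S p y : osc C S -> der (prof C p) y (prof1 C S p y).
Proof.
move=> [dc _ _ _]; apply: der_eq (derM (der_amp p y) (dc _ _ _ (der_phase p y))) _.
by rewrite /prof1; ring.
Qed.

Lemma der_prof1 C S p y : osc C S -> der (prof1 C S p) y (prof2 C S p y).
Proof.
move=> [dc ds _ _]; have dch := der_lin (ch p) y.
have := derB (derM (der_amp1 p y) (dc _ _ _ (der_phase p y)))
  (derM (derM (der_amp p y) dch) (ds _ _ _ (der_phase p y))).
by move=> h; apply: der_eq h _; rewrite /prof2; ring.
Qed.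

Lemma continuous_amp p : continuous (amp p).
Proof. by move=> y; exact: der_continuous (der_amp p y). Qed.

Lemma continuous_prof C S p : osc C S -> continuous (prof C p).
Proof. by move=> o y; exact: der_continuous (der_prof p y o). Qed.

Lemma continuous_prof1 C S p : osc C S -> continuous (prof1 C S p).
Proof. by move=> o y; exact: der_continuous (der_prof1 p y o). Qed.

Lemma continuous_prof2 C S p : osc C S -> continuous (prof2 C S p).
Proof.
move=> [dc ds _ _] y; have dch := der_lin (ch p) y.
have damp2 : der (amp2 p) y (2 * am p ^+ 4 * amp1 p y - 2 * (5 * amp p y ^+ 4 * amp1 p y)).
  exact: derB (derZ _ (der_amp p y)) (derZ 2 (derX 5 (der_amp p y))).
have := derB (derM (derB damp2 (derM (der_amp p y) (derX 2 dch))) (dc _ _ _ (der_phase p y)))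
  (derM (derD (derM (derZ 2 (der_amp1 p y)) dch) (derM (der_amp p y) (der_cst (ch p) y)))
    (ds _ _ _ (der_phase p y))).
exact: der_continuous.
Qed.

Lemma rapid_prof m M B C S : 0 < m -> m <= M -> 0 <= B -> osc C S ->
  [/\ rapid m M B (prof C), rapid m M B (prof1 C S) & rapid m M B (fun p y => y * prof C p y)].
Proof.
move=> m0 mM B0 o; have tk := tempered_am B m0 mM; have tb := tempered_ch m M B0.
have ty := tempered_id m M B; have tc := tempered_osc m M B o; have ts := tempered_osc m M B (oscN o).
have tt := tempered_th B m0 mM; have rR := rapid_Rsol B m0 mM.
have tcst c := tempered_cst m M B c.
have tk3 := temperedM tk (temperedM tk tk).
have r1 : rapid m M B (prof C).
  have := rapidM tc (rapidM tk rR); congr (rapid m M B _).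
  by apply/funext => p; apply/funext => y; rewrite /prof /amp /phase mulrC.
split => //; last exact: rapidM.
have := rapidD (rapidM tc (rapidM tk3 (rapidM (tcst (- Num.sqrt 2)) (rapidM tt rR))))
  (rapidM (tcst (-1)) (rapidM ts (rapidM (temperedM tb ty) (rapidM tk rR)))).
congr (rapid m M B _); apply/funext => p; apply/funext => y; rewrite /prof1 /amp1 /amp /phase.
by rewrite !exprS expr0; ring.
Qed.

(** Under the dilation the derivative and the multiplication by [x] scale like
    [e^-1] and [e]; with these factors taken out the bounds are uniform in [e]. *)
Lemma prof_lip m M B C S : 0 < m -> m <= M -> 0 <= B -> osc C S ->
  (forall e p, 0 < e -> box m M B p -> [/\ inL2 (dil e (prof C p)), inL2 (dil e (prof1 C S p)) &
     inL2 (dil e (fun y => y * prof C p y))]) /\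
  exists2 D : R, 0 <= D & forall e p q, 0 < e -> box m M B p -> box m M B q ->
    [/\ nrm (fun x => dil e (prof C p) x - dil e (prof C q) x) <= D * pdist p q,
        nrm (fun x => dil e (prof1 C S p) x - dil e (prof1 C S q) x) <= D * pdist p q &
        nrm (fun x => dil e (fun y => y * prof C p y) x - dil e (fun y => y * prof C q y) x)
          <= D * pdist p q].
Proof.
move=> m0 mM B0 o; have [r1 r2 r3] := rapid_prof m0 mM B0 o.
have c1 p := continuous_prof (p := p) o; have c2 p := continuous_prof1 (p := p) o.
have c3 p : continuous (fun y => y * prof C p y).
  by move=> y; apply: cvgM; [exact: cvg_id|exact: c1].
have [i1 [D1 D10 h1]] := rapid_L2 r1 c1; have [i2 [D2 D20 h2]] := rapid_L2 r2 c2.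
have [i3 [D3 D30 h3]] := rapid_L2 r3 c3.
split; first by move=> e p e0 bp; split; [exact: i1|exact: i2|exact: i3].
exists (D1 + D2 + D3); first by rewrite !addr_ge0.
move=> e p q e0 bp bq; have d0 := pdist_ge0 p q.
have := h1 e p q e0 bp bq; have := h2 e p q e0 bp bq; have := h3 e p q e0 bp bq.
have := mulr_ge0 D10 d0; have := mulr_ge0 D20 d0; have := mulr_ge0 D30 d0.
by split; lra.
Qed.

Lemma dil_mulx (e : R) (f : R -> R) x : 0 < e -> x * dil e f x = e * dil e (fun y => y * f y) x.
Proof. by move=> e0; rewrite /dil; field; rewrite !gt_eqF// sqrtr_gt0. Qed.

Lemma der_dil (e : R) (f g : R -> R) (x : R) : 0 < e -> (forall y, der f y (g y)) -> der (dil e f) x (e^-1 * dil e g x).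
Proof.
move=> e0 h; have de : der (fun x => x / e) x e^-1.
  by apply: der_eq (derM (der_id x) (der_cst e^-1 x)) _; ring.
have := derZ (Num.sqrt e)^-1 (der_comp (f := f) (g := fun z => z / e) (h (x / e)) de).
by move=> k; apply: der_eq k _; rewrite /dil; ring.
Qed.

Lemma continuous_dil (e : R) (f : R -> R) : continuous f -> continuous (dil e f).
Proof.
move=> cf x; apply: cvgM; first exact: cvg_cst.
have h : {for x, continuous (f \o (fun z => z / e))}.
  by apply: continuous_comp; [apply: cvgM; [exact: cvg_id|exact: cvg_cst]|exact: cf].
exact: h.
Qed.

Lemma box_near p q : pdist q p < Num.min 1 (am p / 2) ->
  box (am p / 2) (2 * am p) (`|ch p| + 1) q.
Proof.
rewrite lt_min => /andP[d1 d2].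
have a1 := normr_ge0 (am q - am p); have a2 := normr_ge0 (ch q - ch p); have a3 := normr_ge0 (ph q - ph p).
split.
  have : `|am q - am p| < am p / 2 by move: d2; rewrite /pdist; lra.
  by rewrite ltr_norml => /andP[? ?]; apply/andP; split; lra.
have h : `|ch q - ch p| < 1 by move: d1; rewrite /pdist; lra.
have : `|ch q| <= `|ch q - ch p| + `|ch p| by rewrite -[X in `|X| <= _](subrK (ch p)) ler_normD.
lra.
Qed.

Let box_self p : 0 < am p -> box (am p / 2) (2 * am p) (`|ch p| + 1) p.
Proof.
move=> p0; apply: box_near.
by rewrite /pdist !subrr normr0 !addr0 lt_min ltr01 divr_gt0.
Qed.

Lemma prof_inSig e C S p : 0 < e -> 0 < am p -> osc C S ->
  inSig (dil e (prof C p)) (fun x => e^-1 * dil e (prof1 C S p) x).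
Proof.
move=> e0 p0 o.
have h1 : 0 < am p / 2 by rewrite divr_gt0.
have h2 : am p / 2 <= 2 * am p by lra.
have h3 : 0 <= `|ch p| + 1 by rewrite addr_ge0.
have [/(_ e p e0 (box_self p0))[i1 i2 i3] _] := prof_lip h1 h2 h3 o.
split => //; first exact: inL2Z.
  have -> : (fun x => x * dil e (prof C p) x) = (fun x => e * dil e (fun y => y * prof C p y) x).
    by apply/funext => x; rewrite dil_mulx.
  exact: inL2Z.
apply: der_wder; first by move=> x; apply: der_dil => // y; exact: der_prof.
move=> x; apply: cvgM; first exact: cvg_cst.
by apply: continuous_dil; exact: continuous_prof1.
Qed.

Lemma prof_continuous e C S p : 0 < e -> 0 < am p -> osc C S ->
  exists2 K : R, 0 <= K & exists2 d : R, 0 < d & forall q, pdist q p < d ->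
    sdist (dil e (prof C q)) (fun x => e^-1 * dil e (prof1 C S q) x)
          (dil e (prof C p)) (fun x => e^-1 * dil e (prof1 C S p) x) <= K * pdist q p.
Proof.
move=> e0 p0 o.
have h1 : 0 < am p / 2 by rewrite divr_gt0.
have h2 : am p / 2 <= 2 * am p by lra.
have h3 : 0 <= `|ch p| + 1 by rewrite addr_ge0.
have bp := box_self p0.
have [iL [D D0 hD]] := prof_lip h1 h2 h3 o.
have ei : 0 < e^-1 by rewrite invr_gt0.
exists (D + e^-1 * D + e * D); first by rewrite !addr_ge0// mulr_ge0// ltW.
exists (Num.min 1 (am p / 2)); first by rewrite lt_min ltr01.
move=> q /box_near bq.
have [k1 k2 k3] := hD e q p e0 bq bp.
have [p1 p2 p3] := iL e p e0 bp; have [q1 q2 q3] := iL e q e0 bq.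
rewrite /sdist !mulrDl; apply: lerD; first apply: lerD => //.
  rewrite (@nrm_eq _ _ (fun x => e^-1 * (dil e (prof1 C S q) x - dil e (prof1 C S p) x))); last by move=> x; ring.
  rewrite nrmZ; last exact: inL2B.
  by rewrite (gtr0_norm ei) -mulrA; apply: ler_wpM2l => //; exact: ltW.
rewrite (@nrm_eq _ _ (fun x => e * (dil e (fun y => y * prof C q y) x - dil e (fun y => y * prof C p y) x))); last first.
  by move=> x; rewrite !dil_mulx// mulrBr.
rewrite nrmZ; last exact: inL2B.
by rewrite (gtr0_norm e0) -mulrA; apply: ler_wpM2l => //; exact: ltW.
Qed.

Definition wave e p x : R[i] := Complex (dil e (prof cos p) x) (dil e (prof sin p) x).

Definition wave1 e p x : R[i] :=
  Complex (e^-1 * dil e (prof1 cos sin p) x)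
          (e^-1 * dil e (prof1 sin (fun x => - cos x) p) x).

Lemma wave_inSigc e p : 0 < e -> 0 < am p -> inSigc (wave e p) (wave1 e p).
Proof. by move=> e0 p0; split; [exact: prof_inSig osc_cos|exact: prof_inSig osc_sin]. Qed.

End Profile.

Arguments par R : clear implicits.

(** * The explicit solution *)

Section Explicit.
Context {R : realType} (eps ts : R) (eps0 : 0 < eps).
Implicit Types (x y t s : R) (C S phi : R -> R).

Local Notation mu := (@lebesgue_measure R).

(** The width of the solution: it solves h'' + h = 0, and its first zero is
    the blow-up time. *)
Definition width t : R := cos t + eps * ts * sin t.
Definition width1 t : R := - sin t + eps * ts * cos t.
Definition blowup : R := pi / 2 + atan (eps * ts).

Definition ppar t : par R :=
  (Num.sqrt (eps / width t), eps * width1 t / width t, eps * sin t / width t).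

Definition sol t : R -> R[i] := wave eps (ppar t).

Lemma width_gt0 t : 0 <= t < blowup -> 0 < width t.
Proof.
move=> /andP[t0 tT]; pose a := atan (eps * ts).
have a1 : - (pi / 2) < a := atan_gtNpi2 _; have a2 : a < pi / 2 := atan_ltpi2 _.
have ca : 0 < cos a by apply: cos_gt0_pihalf; rewrite a1.
have -> : width t = cos (t - a) / cos a.
  by rewrite cosB /width -(atanK (eps * ts)) -/a /tan; field; rewrite gt_eqF.
rewrite divr_gt0// cos_gt0_pihalf//; move: tT; rewrite /blowup -/a => tT.
by apply/andP; split; lra.
Qed.

Lemma blowup_gt0 : 0 < blowup.
Proof. by have := atan_gtNpi2 (eps * ts); rewrite /blowup; lra. Qed.

Lemma der_width t : der width t (width1 t).
Proof.
have := derD (der_cos (der_id t)) (derZ (eps * ts) (der_sin (der_id t))).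
by move=> h; apply: der_eq h _; rewrite /width1; ring.
Qed.

Lemma der_width1 t : der width1 t (- width t).
Proof.
have := derD (derN (der_sin (der_id t))) (derZ (eps * ts) (der_cos (der_id t))).
by move=> h; apply: der_eq h _; rewrite /width; ring.
Qed.

Lemma am_gt0 t : 0 < width t -> 0 < am (ppar t).
Proof. by move=> w0; rewrite sqrtr_gt0 divr_gt0. Qed.

Let am_sq t : 0 < width t -> am (ppar t) ^+ 2 = eps / width t.
Proof. by move=> w0; rewrite sqr_sqrtr// ltW// divr_gt0. Qed.

Lemma der_am t : 0 < width t ->
  der (fun s => am (ppar s)) t (- (am (ppar t) * ch (ppar t)) / (2 * eps)).
Proof.
move=> w0; have wn : width t != 0 by rewrite gt_eqF.
have ew : 0 < eps / width t by rewrite divr_gt0.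
have dw := derZ eps (derV wn (der_width t)).
have := der_comp (f := Num.sqrt) (g := fun s => eps * (width s)^-1) (is_derive1_sqrt ew) dw.
move=> h; apply: der_eq h _.
have a0 := am_gt0 w0; have a2 := am_sq w0.
rewrite /ch/= -[Num.sqrt _]/(am (ppar t)).
transitivity ((2 * am (ppar t))^-1 * (am (ppar t) ^+ 2 * width t * (- width1 t / width t ^+ 2))).
  by rewrite a2 divfK.
by field; rewrite !gt_eqF.
Qed.

Lemma der_ch t : 0 < width t ->
  der (fun s => ch (ppar s)) t (- eps - ch (ppar t) ^+ 2 / eps).
Proof.
move=> w0; have wn : width t != 0 by rewrite gt_eqF.
have := derM (derZ eps (der_width1 t)) (derV wn (der_width t)).
by move=> h; apply: der_eq h _; rewrite /ch/=; field; rewrite !gt_eqF.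
Qed.

Lemma der_ph t : 0 < width t -> der (fun s => ph (ppar s)) t (am (ppar t) ^+ 4 / eps).
Proof.
move=> w0; have wn : width t != 0 by rewrite gt_eqF.
have := derM (derZ eps (der_sin (der_id t))) (derV wn (der_width t)).
move=> h; apply: der_eq h _; rewrite (exprM _ 2 2) am_sq// mulr1.
have cs : cos t * width t - sin t * width1 t = 1.
  by rewrite -(cos2Dsin2 t) /width /width1; ring.
apply: (@mulIf _ (width t ^+ 2)); first by rewrite expf_neq0.
by rewrite -[RHS]mulr1 -[in RHS]cs; field; rewrite !gt_eqF.
Qed.

Lemma sol_init : sol 0 = init_data ts.
Proof.
apply/funext => x; rewrite /sol /wave /init_data.
have w0 : width 0 = 1 by rewrite /width cos0 sin0 mulr0 addr0.
have w1 : width1 0 = eps * ts by rewrite /width1 cos0 sin0 oppr0 add0r mulr1.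
have s0 : 0 < Num.sqrt eps by rewrite sqrtr_gt0.
have pE C : dil eps (prof C (ppar 0)) x = Rsol x * C (ts / 2 * x ^+ 2).
  rewrite /dil /prof /amp /phase /am /ch /ph /= w0 w1 sin0 !divr1 mulr0 add0r.
  rewrite sqr_sqrtr ?(ltW eps0)//.
  have -> : eps * (x / eps) = x by rewrite mulrC divfK ?gt_eqF.
  have -> : eps * (eps * ts) * (x / eps) ^+ 2 / 2 = ts / 2 * x ^+ 2 by field; rewrite gt_eqF.
  by rewrite !mulrA mulVf ?mul1r// gt_eqF.
by rewrite !pE; apply/eqP; rewrite eq_complex /= !mul0r subr0 addr0 !eqxx.
Qed.

Lemma sol_inSigc t : 0 < width t -> inSigc (sol t) (wave1 eps (ppar t)).
Proof. by move=> /am_gt0; exact: wave_inSigc. Qed.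

Lemma ppar_continuous t : 0 < width t -> pdist (ppar s) (ppar t) @[s --> t] --> 0.
Proof.
move=> w0.
have h (f : R -> R) a : der f t a -> `|f s - f t| @[s --> t] --> 0.
  move=> /der_continuous cf; rewrite (_ : 0 = `|f t - f t|); last by rewrite subrr normr0.
  by apply: cvg_norm; apply: cvgB => //; exact: cvg_cst.
rewrite (_ : 0 = 0 + 0 + 0); last by rewrite !addr0.
apply: cvgD; last exact: h (der_ph w0).
by apply: cvgD; [exact: h (der_am w0)|exact: h (der_ch w0)].
Qed.

Lemma sol_continuous : continuous_in_Sigma `[0, blowup[ sol.
Proof.
move=> t; rewrite /= in_itv/= => tI; have w0 := width_gt0 tI.
have iS := sol_inSigc w0; split; first exact: inSigc_is_Sigma iS.
have [K1 K10 [d1 d10 h1]] := prof_continuous eps0 (am_gt0 w0) osc_cos.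
have [K2 K20 [d2 d20 h2]] := prof_continuous eps0 (am_gt0 w0) osc_sin.
have key : \forall s \near t, 0 <= s < blowup ->
    (Sigma_norm (fun x => sol s x - sol t x)%R <= ((K1 + K2) * pdist (ppar s) (ppar t))%:E)%E.
  have nd (d : R) : 0 < d -> \forall s \near t, pdist (ppar s) (ppar t) < d.
    move=> d0; have := ppar_continuous w0.
    by move=> /cvgr_lt; apply.
  apply: filterS2 (nd _ d10) (nd _ d20) => s p1 p2 sI.
  apply: le_trans (Sigma_le_sdist (sol_inSigc (width_gt0 sI)) iS) _.
  by rewrite lee_fin mulrDl; apply: lerD; [exact: h1|exact: h2].
have cE : (((K1 + K2) * pdist (ppar s) (ppar t))%R%:E @[s --> within `[0%R, blowup[%classic (nbhs t)] --> 0%:E)%E.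
  apply: cvg_EFin; first exact: nearW.
  rewrite [X in _ --> X](_ : 0 = (K1 + K2) * 0); last by rewrite mulr0.
  apply: cvgM; first exact: cvg_cst.
  exact: cvg_within_filter (ppar_continuous w0).
apply: (squeeze_cvge _ (cvg_cst 0%E) cE).
rewrite near_withinE; apply: filterS key => s hs.
by rewrite /= in_itv/= => sI; rewrite Sigma_norm_ge0 hs.
Qed.

(** The time derivative of the profile along the trajectory. *)
Definition profT C S (p : par R) y : R :=
  - ch p / (2 * eps) * (amp p y + 2 * y * amp1 p y) * C (phase p y)
  - amp p y * (am p ^+ 4 / eps - (eps + ch p ^+ 2 / eps) * y ^+ 2 / 2) * S (phase p y).

Lemma der_profT C S t y : osc C S -> 0 < width t ->
  der (fun s => prof C (ppar s) y) t (profT C S (ppar t) y).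
Proof.
move=> [dc _ _ _] w0; have a0 := am_gt0 w0.
have da := der_am w0; have db := der_ch w0; have dp := der_ph w0.
have d1 : der (fun s => amp (ppar s) y) t
    (- ch (ppar t) / (2 * eps) * (amp (ppar t) y + 2 * y * amp1 (ppar t) y)).
  have dk : der (fun s => am (ppar s) ^+ 2 * y) t
      (2 * am (ppar t) * (- (am (ppar t) * ch (ppar t)) / (2 * eps)) * y).
    by apply: der_eq (derM (derX 2 da) (der_cst y t)) _; rewrite expr1; ring.
  have := derM da (der_comp (f := @Rsol R) (g := fun s => am (ppar s) ^+ 2 * y) (der_Rsol _) dk).
  by move=> h; apply: der_eq h _; rewrite /amp /amp1; field; rewrite gt_eqF.
have d2 : der (fun s => phase (ppar s) y) t
    (am (ppar t) ^+ 4 / eps - (eps + ch (ppar t) ^+ 2 / eps) * y ^+ 2 / 2).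
  have := derD dp (derM db (der_cst (y ^+ 2 / 2) t)).
  move=> h; apply: der_ext (der_eq h _); first by move=> z; rewrite /phase mulrA.
  by field; rewrite gt_eqF.
by apply: der_eq (derM d1 (dc _ _ _ d2)) _; rewrite /profT; ring.
Qed.

(** The equation for the profile, in the dilated space variable: the lens
    transformation turns the equation for [Rsol] into it. *)
Lemma prof_equation C S p y :
  - eps * profT S (fun x => - C x) p y + 2^-1 * prof2 C S p y =
  eps ^+ 2 * (y ^+ 2 / 2) * prof C p y - amp p y ^+ 4 * prof C p y.
Proof. by rewrite /profT /prof2 /prof /amp2; field; rewrite gt_eqF. Qed.

Lemma profT_bounded C S t : osc C S -> 0 < width t ->
  exists2 d : R, 0 < d & exists K : R, forall s, `|s - t| < d ->
    0 < width s /\ forall y, `|profT C S (ppar s) y| <= K.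
Proof.
move=> o w0; have a0 := am_gt0 w0.
pose m := am (ppar t) / 2; pose M := 2 * am (ppar t); pose B := `|ch (ppar t)| + 1.
have m0 : 0 < m by rewrite divr_gt0.
have mM : m <= M by rewrite /m /M; lra.
have B0 : 0 <= B by rewrite addr_ge0.
have rT : rapid m M B (profT C S).
  have tk := tempered_am B m0 mM; have tb := tempered_ch m M B0.
  have ty := tempered_id m M B; have tc := tempered_osc m M B o; have ts' := tempered_osc m M B (oscN o).
  have tt := tempered_th B m0 mM; have rR := rapid_Rsol B m0 mM.
  have tcst c := tempered_cst m M B c.
  have r1 : rapid m M B (@amp R) by exact: rapidM tk rR.
  have r2 : rapid m M B (@amp1 R).
    have := rapidM (temperedM tk (temperedM tk tk)) (rapidM (tcst (- Num.sqrt 2)) (rapidM tt rR)).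
    congr (rapid m M B _); apply/funext => p; apply/funext => y; rewrite /amp1.
    by rewrite !exprS expr0; ring.
  have tk4 := temperedM (temperedM tk tk) (temperedM tk tk).
  have ty2 := temperedM ty ty; have tb2 := temperedM tb tb.
  have := rapidD (rapidM (temperedM (tcst (- (2 * eps)^-1)) (temperedM tb tc))
      (rapidD r1 (rapidM (temperedM (tcst 2) ty) r2)))
    (rapidD (rapidM (temperedM (tcst (- eps^-1)) (temperedM tk4 ts')) r1)
      (rapidD (rapidM (temperedM (tcst (eps / 2)) (temperedM ty2 ts')) r1)
        (rapidM (temperedM (tcst ((2 * eps)^-1)) (temperedM tb2 (temperedM ty2 ts'))) r1))).
  congr (rapid m M B _); apply/funext => p; apply/funext => y; rewrite /profT /phase.
  by rewrite !exprS expr0; field; rewrite gt_eqF.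
have [K K0 hK] := rT 0%N.
have nw : \forall s \near t, 0 < width s by have /cvgr_gt := der_continuous (der_width t); apply.
have nd : \forall s \near t, pdist (ppar s) (ppar t) < Num.min 1 m.
  by have := ppar_continuous w0; move=> /cvgr_lt; apply; rewrite lt_min ltr01.
have [d /= d0 hd] := filterI nw nd.
exists d => //; exists K => s sd.
have [|ws /box_near bs] := hd s; first by rewrite /= distrC.
split => // y; have [+ _] := hK _ _ y bs bs; by rewrite expr0 mulr1.
Qed.

(** The bound on the time derivative, times the test function, dominates. *)
Lemma der_int_test (F F' : R -> R -> R) t (d K : R) phi : 0 < d -> test_function phi ->
  (forall s, `|s - t| < d -> forall y, der (fun s => F s y) s (F' s y)) ->
  (forall s, `|s - t| < d -> forall y, `|F' s y| <= K) ->
  (forall s, `|s - t| < d -> continuous (F s)) ->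
  der (fun s => \int[mu]_x (F s x * phi x)) t (\int[mu]_x (F' t x * phi x)).
Proof.
move=> d0 tp dF bF cF.
have tt : `|t - t| < d by rewrite subrr normr0.
have near_t s : s \in `]t - d, t + d[%R -> `|s - t| < d.
  by rewrite in_itv/= => /andP[h1 h2]; rewrite ltr_norml; apply/andP; split; lra.
have K0 : 0 <= K by apply: le_trans (bF t tt 0).
pose G y := K * `|phi y|.
have iphi : intg phi by have cp := test_continuous tp; case: tp => _ [M hM]; exact: intg_cc cp hM.
have iG : intg G by apply: intgZ; exact: intg_norm.
have xI : [set` `]t - d, t + d[%R] t by rewrite /= in_itv/=; apply/andP; split; lra.
have dFp s : `|s - t| < d -> forall y, der (fun s => F s y * phi y) s (F' s y * phi y).
  by move=> /dF h y; apply: der_eq (derM (h y) (der_cst (phi y) s)) _; ring.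
have Hd1 s y : `|s - t| < d -> (fun s => F s y * phi y)^`() s = F' s y * phi y.
  by move=> sd; exact: der_derive1 (dFp s sd y).
have := @cvg_differentiation_under_integral R _ _ mu (fun s y => F s y * phi y)
  setT measurableT t (t - d) (t + d) xI.
move=> /(_ _ _ G) H.
apply: cvg_der.
have -> : \int[mu]_x (F' t x * phi x) =
    \int[mu]_(y in setT) partial1of2 (fun s y => F s y * phi y) t y.
  by apply: int_eq => y; rewrite /partial1of2 Hd1.
apply: cvg_trans (H _ _ _ iG _).
- apply: near_eq_cvg; apply: nearW => z.
  by rewrite /GRing.scale/= (addrC z).
- by move=> s /near_t sI; apply: intg_locint_test => //; apply: continuous_locint; exact: cF.
- by move=> s y /near_t sI _; exact: der_derivable (dFp s sI y).
- by move=> y; rewrite mulr_ge0.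
- move=> s y /near_t sI _; rewrite /partial1of2 Hd1// normrM.
  by apply: ler_wpM2r => //; exact: bF.
Qed.


Let s0 : 0 < Num.sqrt eps. Proof. by rewrite sqrtr_gt0. Qed.

Lemma pair_sol_der C S t phi : osc C S -> 0 < width t -> test_function phi ->
  der (fun s => \int[mu]_x (dil eps (prof C (ppar s)) x * phi x)) t
      (\int[mu]_x (dil eps (profT C S (ppar t)) x * phi x)).
Proof.
move=> o w0 tp; have [d d0 [K hK]] := profT_bounded o w0.
apply: (@der_int_test _ (fun s => dil eps (profT C S (ppar s))) t d ((Num.sqrt eps)^-1 * K)) => //.
- by move=> s sd y; apply: derZ; apply: der_profT => //; have [] := hK s sd.
- move=> s sd y; have [_ h] := hK s sd; rewrite /dil normrM ger0_norm ?invr_ge0 ?sqrtr_ge0//.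
  by apply: ler_wpM2l; rewrite ?invr_ge0 ?sqrtr_ge0.
- by move=> s sd; apply: continuous_dil; exact: continuous_prof o.
Qed.

Lemma int_prof2 C S p phi : osc C S -> test_function phi ->
  \int[mu]_x (dil eps (prof C p) x * derive1n 2 phi x) =
  (eps ^+ 2)^-1 * \int[mu]_x (dil eps (prof2 C S p) x * phi x).
Proof.
move=> o tp; have tp' := test_derive1 tp.
have c1 := continuous_dil (e := eps) (continuous_prof1 (p := p) o).
have c2 := continuous_dil (e := eps) (continuous_prof2 (p := p) o).
have cZ (f : R -> R) : continuous f -> continuous (fun x => eps^-1 * f x).
  by move=> cf x; apply: cvgM; [exact: cvg_cst|exact: cf].
have w1 := der_wder (fun x => der_dil x eps0 (fun y => der_prof p y o)) (cZ _ c1).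
have w2 := der_wder (fun x => der_dil x eps0 (fun y => der_prof1 p y o)) (cZ _ c2).
have i1 := intg_locint_test (continuous_locint c1) tp'.
have i2 := intg_locint_test (continuous_locint c2) tp.
rewrite derive1nS derive1n1; case: w1 => _ _ ->//.
rewrite (@int_eq _ _ (fun x => eps^-1 * (dil eps (prof1 C S p) x * derive1 phi x))); last by move=> x; ring.
rewrite intZ//; case: w2 => _ _ ->//.
rewrite (@int_eq _ (fun x => eps^-1 * dil eps (prof2 C S p) x * phi x)
  (fun x => eps^-1 * (dil eps (prof2 C S p) x * phi x))); last by move=> x; ring.
by rewrite intZ//; field; rewrite gt_eqF.
Qed.

Lemma continuous_profT C S p : osc C S -> continuous (profT C S p).
Proof.
move=> o y; have [dc ds _ _] := o; have dph := der_phase p y.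
have := derB (derM (derZ (- ch p / (2 * eps)) (derD (der_amp p y) (derM (derZ 2 (der_id y)) (der_amp1 p y))))
    (dc _ _ _ dph))
  (derM (derM (der_amp p y) (derB (der_cst (am p ^+ 4 / eps) y)
    (derM (derZ (eps + ch p ^+ 2 / eps) (derX 2 (der_id y))) (der_cst 2^-1 y)))) (ds _ _ _ dph)).
exact: der_continuous.
Qed.

Lemma pair_equation C S p phi : osc C S -> test_function phi ->
  - eps * (\int[mu]_x (dil eps (profT S (fun x => - C x) p) x * phi x)) +
    2^-1 * eps ^+ 2 * (\int[mu]_x (dil eps (prof C p) x * derive1n 2 phi x)) =
  \int[mu]_x (x ^+ 2 / 2 * dil eps (prof C p) x * phi x) -
  eps ^+ 2 * \int[mu]_x ((dil eps (amp p) x ^+ 2) ^+ 2 * dil eps (prof C p) x * phi x).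
Proof.
move=> o tp; rewrite (int_prof2 p o tp).
have cT := continuous_profT (p := p) (oscN o).
have cd (f : R -> R) : continuous f -> intg (fun x => dil eps f x * phi x).
  by move=> cf; apply: intg_locint_test tp; apply: continuous_locint; exact: continuous_dil.
have c0 := continuous_prof (p := p) o; have ca := continuous_amp (p := p).
have iT := cd _ cT; have i2 := cd _ (continuous_prof2 (p := p) o).
have cX (f g : R -> R) : continuous f -> continuous g -> continuous (fun x => f x * g x).
  by move=> cf cg x; apply: cvgM; [exact: cf|exact: cg].
have cid : continuous (fun x : R => x) by move=> x; exact: cvg_id.
have ccst (c : R) : continuous (fun _ : R => c) by move=> x; exact: cvg_cst.
have ix : intg (fun x => x ^+ 2 / 2 * dil eps (prof C p) x * phi x).
  have := cX _ _ (cX _ _ (cX _ _ cid cid) (ccst 2^-1)) (continuous_dil (e := eps) c0).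
  by move=> /continuous_locint /intg_locint_test; apply.
have cda := continuous_dil (e := eps) ca.
have i4 : intg (fun x => (dil eps (amp p) x ^+ 2) ^+ 2 * dil eps (prof C p) x * phi x).
  have := cX _ _ (cX _ _ (cX _ _ cda cda) (cX _ _ cda cda)) (continuous_dil (e := eps) c0).
  by move=> /continuous_locint /intg_locint_test; apply.
have j1 := intgZ (- eps) iT; have j2 := intgZ (2^-1 * eps ^+ 2 * (eps ^+ 2)^-1) i2.
have j4 := intgZ (eps ^+ 2) i4.
rewrite [_ * (_ * _)]mulrA -(intZ (- eps) iT) -(intZ _ i2) -(intZ (eps ^+ 2) i4) -(intD j1 j2) -(intB ix j4).
apply: int_eq => x; rewrite /dil.
have hp := prof_equation C S p (x / eps).
have sE : Num.sqrt eps ^+ 2 = eps by rewrite sqr_sqrtr// ltW.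
set T := profT _ _ _ _ in hp *; set P := prof2 _ _ _ _ in hp *; set Q := prof _ _ _ in hp *.
set A := amp _ _ in hp *.
transitivity ((Num.sqrt eps)^-1 * (- eps * T + 2^-1 * P) * phi x).
  by field; rewrite !gt_eqF.
rewrite hp.
have -> : (((Num.sqrt eps)^-1 * A) ^+ 2) ^+ 2 = A ^+ 4 / eps ^+ 2.
  rewrite -[in RHS]sE; by field; rewrite gt_eqF.
by field; rewrite !gt_eqF.
Qed.

Lemma sol_normc4 t x : Normc.normc (sol t x) ^+ 4 = (dil eps (amp (ppar t)) x ^+ 2) ^+ 2.
Proof.
rewrite (exprM _ 2 2) normc_sq /sol /wave /=; congr (_ ^+ 2); rewrite /dil /prof.
transitivity (((Num.sqrt eps)^-1 * amp (ppar t) (x / eps)) ^+ 2 *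
  (cos (phase (ppar t) (x / eps)) ^+ 2 + sin (phase (ppar t) (x / eps)) ^+ 2)); first by ring.
by rewrite cos2Dsin2 mulr1.
Qed.

Let complex_equation (e k l a b c1 c2 x1 x2 n1 n2 : R) :
  - e * b + k * c1 = x1 - l * n1 -> - e * (- a) + k * c2 = x2 - l * n2 ->
  'i%C * e%:C * Complex a b + k%:C * Complex c1 c2 = Complex x1 x2 - l%:C * Complex n1 n2.
Proof.
move=> h1 h2; apply/eqP; rewrite eq_complex /=; apply/andP; split; apply/eqP.
  by rewrite !(mul0r, mul1r, mulr0, addr0, add0r, subr0, sub0r); lra.
by rewrite !(mul0r, mul1r, mulr0, addr0, add0r, subr0, sub0r); lra.
Qed.

Lemma sol_equation : NLS_equation eps `[0, blowup[ sol.
Proof.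
move=> t Jt phi tp; have w0 : 0 < width t by apply: width_gt0; have := interior_subset Jt; rewrite /= in_itv.
exists (Complex (\int[mu]_x (dil eps (profT cos sin (ppar t)) x * phi x))
  (\int[mu]_x (dil eps (profT sin (fun x => - cos x) (ppar t)) x * phi x))).
split; first by split; [exact: pair_sol_der osc_cos w0 tp|exact: pair_sol_der osc_sin w0 tp].
have e1 := pair_equation (ppar t) osc_cos tp.
have e2 := pair_equation (ppar t) osc_sin tp.
have eT : (fun x => dil eps (profT (fun x => - cos x) (fun x => - sin x) (ppar t)) x * phi x) =
   (fun x => - (dil eps (profT cos sin (ppar t)) x * phi x)).
  by apply/funext => x; rewrite /dil /profT; ring.
have iT : intg (fun x => dil eps (profT cos sin (ppar t)) x * phi x).
  apply: intg_locint_test tp; apply: continuous_locint; apply: continuous_dil.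
  exact: continuous_profT osc_cos.
rewrite eT intN// in e2.
have -> : cpair (fun x => (x ^+ 2 / 2)%:C * sol t x) phi =
    Complex (\int[mu]_x (x ^+ 2 / 2 * dil eps (prof cos (ppar t)) x * phi x))
      (\int[mu]_x (x ^+ 2 / 2 * dil eps (prof sin (ppar t)) x * phi x)).
  by congr Complex; apply: int_eq => x; rewrite ?re_realM ?im_realM.
have -> : cpair (fun x => (Normc.normc (sol t x) ^+ 4)%:C * sol t x) phi =
    Complex (\int[mu]_x ((dil eps (amp (ppar t)) x ^+ 2) ^+ 2 * dil eps (prof cos (ppar t)) x * phi x))
      (\int[mu]_x ((dil eps (amp (ppar t)) x ^+ 2) ^+ 2 * dil eps (prof sin (ppar t)) x * phi x)).
  by congr Complex; apply: int_eq => x; rewrite sol_normc4 ?re_realM ?im_realM.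
exact: complex_equation e1 e2.
Qed.

Lemma sol_is_solution : is_solution eps (init_data ts) `[0, blowup[ sol.
Proof.
split.
- split; first exact: interval_is_interval.
  by move=> t; rewrite /= in_itv/= => /andP[].
- by rewrite /= in_itv/= lexx blowup_gt0.
- exact: sol_continuous.
- by apply: aeW => x; rewrite sol_init.
- exact: sol_equation.
Qed.

(** If some time before [blowup] were not in [J], the explicit solution would be a
    proper extension of [v]. *)
Lemma maximal_sol J v : is_maximal_solution eps (init_data ts) J v ->
  (forall t, 0 <= t < blowup -> J t) /\
  forall t, 0 <= t < blowup -> {ae mu, forall x : R, v t x = sol t x}.
Proof.
move=> [sv mv]; have [[iJ J0] J00 _ _ _] := sv.
have hs := sol_is_solution.
have agree T : 0 <= T < blowup -> J T -> {ae mu, forall x : R, v T x = sol T x}.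
  move=> /andP[T0 TT] JT; apply: (nls_unique eps0 sv hs T0) => t /andP[t0 tT].
    by apply: (iJ _ _ J00 JT); rewrite t0.
  by rewrite /= in_itv/= t0 (le_lt_trans tT).
have JJ t : 0 <= t < blowup -> J t.
  move=> tI; apply: contrapT => nJt; apply: (nJt).
  have sub : J `<=` `[0, blowup[.
    move=> s Js; rewrite /= in_itv/= J0//=; case/andP: (tI) => t0 tT.
    apply: lt_trans tT; rewrite ltNge; apply/negP => tls; apply: (nJt).
    by apply: (iJ _ _ J00 Js); rewrite t0.
  apply: (mv _ _ hs sub) => [s Js|]; last by rewrite /= in_itv.
  have := sub s Js; rewrite /= in_itv/= => sI.
  by have := agree s sI Js; apply: aeS => x ->.
by split => // t tI; apply: agree => //; exact: JJ.
Qed.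

End Explicit.

(** * Comparison with the concentrating profile *)

Section Concentration.
Context {R : realType} (ts : R).
Implicit Types (eps lam sg t x : R) (F G : R -> R[i]) (p q : par R).

Local Notation mu := (@lebesgue_measure R).
Local Notation mfun f := (measurable_fun setT (f : R -> R)).

Lemma cos_sub1 x : `|cos x - 1| <= `|x|.
Proof. by have := osc_lip x 0 osc_cos; rewrite cos0 subr0. Qed.

Lemma sin_subx x : `|sin x - x| <= x ^+ 2.
Proof.
have d (y : R) : der (fun y => sin y - y) y (cos y - 1).
  by apply: der_eq (derB (der_sin (der_id y)) (der_id y)) _; rewrite mulr1.
have := @der_bound_itv R _ _ (- `|x|) `|x| 0 x `|x| _ _ (fun y _ => d y) _.
rewrite sin0 !subr0 -expr2 real_normK ?num_real//; apply.
- by rewrite oppr_le0 normr_ge0.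
- by rewrite -ler_norml.
- by move=> y; rewrite -ler_norml; apply: le_trans; exact: cos_sub1.
Qed.

Lemma atan_subx x : `|atan x - x| <= `|x| ^+ 3.
Proof.
have d (y : R) : der (fun y => atan y - y) y ((1 + y ^+ 2)^-1 - 1).
  by apply: derB (der_id y); exact: is_derive1_atan.
have := @der_bound_itv R _ _ (- `|x|) `|x| 0 x (`|x| ^+ 2) _ _ (fun y _ => d y) _.
rewrite atan0 !subr0 -exprSr; apply.
- by rewrite oppr_le0 normr_ge0.
- by rewrite -ler_norml.
- move=> y; rewrite -ler_norml => yx.
  have y2 : y ^+ 2 <= `|x| ^+ 2 by rewrite -(real_normK (num_real y)) lerXn2r ?nnegrE.
  have y20 := sqr_ge0 y; have y3 : 0 < 1 + y ^+ 2 by lra.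
  have -> : (1 + y ^+ 2)^-1 - 1 = - (y ^+ 2 / (1 + y ^+ 2)) by field; rewrite gt_eqF.
  rewrite normrN ger0_norm ?divr_ge0 ?(ltW y3)//; apply: le_trans y2.
  by rewrite ler_pdivrMr// ler_peMr//; lra.
Qed.

Definition focus eps : R := pi / 2 + eps * ts.

(** Since arctan y = y + O(y^3), the blow-up time is [focus eps] up to O(eps^3). *)
Lemma focus_blowup lam : 0 < lam -> exists2 e0 : R, 0 < e0 & forall eps, 0 < eps <= e0 ->
  focus eps - lam * eps < blowup eps ts.
Proof.
move=> l0; have t0 := normr_ge0 ts; have t3 : 0 <= `|ts| ^+ 3 by rewrite exprn_ge0.
pose k : R := `|ts| ^+ 3 + 1; have k0 : 0 < k by rewrite ltr_wpDl.
have lk : 0 < lam / k by rewrite divr_gt0.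
exists (Num.min 1 (lam / k)); first by rewrite lt_min ltr01.
move=> eps /andP[e0]; rewrite le_min ler_pdivlMr// => /andP[e1 ek].
rewrite /blowup /focus.
have := atan_subx (eps * ts); rewrite normrM (gtr0_norm e0) exprMn => h.
have h2 : eps ^+ 3 * `|ts| ^+ 3 <= eps ^+ 2 * `|ts| ^+ 3.
  apply: ler_wpM2r => //; rewrite exprS -[leRHS]mul1r; apply: ler_wpM2r => //; exact: sqr_ge0.
have h3 : eps ^+ 2 * `|ts| ^+ 3 < lam * eps.
  have -> : eps ^+ 2 * `|ts| ^+ 3 = eps * (eps * k) - eps ^+ 2 by rewrite /k; ring.
  have : eps * (eps * k) <= eps * lam by rewrite ler_pM2l.
  have : 0 < eps ^+ 2 by rewrite exprn_gt0.
  lra.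
move: h; rewrite ler_norml => /andP[h _]; lra.
Qed.

(** Taylor expansion at pi/2; the time there is pi/2 up to O(eps). *)
Lemma width_close K : 0 <= K -> exists2 D : R, 0 <= D & forall eps sg, 0 < eps <= 1 ->
  `|sg - ts| <= K -> let t := focus eps - sg * eps in
  [/\ `|width eps ts t / eps - sg| <= D * eps, `|width1 eps ts t + 1| <= D * eps &
      `|sin t - 1| <= D * eps].
Proof.
move=> K0; have t0 := normr_ge0 ts.
exists (K ^+ 2 + `|ts| * K + K + `|ts|); first by rewrite !addr_ge0 ?sqr_ge0 ?mulr_ge0.
move=> eps sg /andP[e0 e1] hK t; pose s := eps * (sg - ts).
have tE : t = pi / 2 - s by rewrite /t /focus /s; ring.
have cE : cos t = sin s by rewrite tE cosB cos_pihalf sin_pihalf; ring.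
have sE : sin t = cos s by rewrite tE sinB cos_pihalf sin_pihalf; ring.
have sK : `|s| <= eps * K by rewrite normrM (gtr0_norm e0) ler_pM2l.
have s2 : s ^+ 2 <= eps ^+ 2 * K ^+ 2.
  by rewrite -(real_normK (num_real s)) -exprMn lerXn2r ?nnegrE ?mulr_ge0// ltW.
have h1 := sin_subx s; have h2 := cos_sub1 s.
have eK : 0 <= eps * K by rewrite mulr_ge0// ltW.
have tK : 0 <= `|ts| * K * eps by rewrite !mulr_ge0// ltW.
have KKe : 0 <= K ^+ 2 * eps by rewrite mulr_ge0 ?sqr_ge0// ltW.
have te : 0 <= `|ts| * eps by rewrite mulr_ge0// ltW.
split.
- rewrite /width cE sE.
  have -> : (sin s + eps * ts * cos s) / eps - sg = (sin s - s) / eps + ts * (cos s - 1).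
    by rewrite /s; field; rewrite gt_eqF.
  apply: le_trans (ler_normD _ _) _; rewrite !normrM normfV (gtr0_norm e0).
  have k1 : `|sin s - s| / eps <= eps * K ^+ 2.
    rewrite ler_pdivrMr//; apply: le_trans h1 _; apply: le_trans s2 _.
    by rewrite le_eqVlt; apply/orP; left; apply/eqP; ring.
  have k2 : `|ts| * `|cos s - 1| <= `|ts| * (eps * K) by apply: ler_wpM2l => //; exact: le_trans sK.
  lra.
- rewrite /width1 cE sE.
  have -> : - cos s + eps * ts * sin s + 1 = - (cos s - 1) + eps * ts * sin s by ring.
  apply: le_trans (ler_normD _ _) _; rewrite normrN (normrM _ (sin s)) (normrM eps) (gtr0_norm e0).
  have k1 : eps * `|ts| * `|sin s| <= eps * `|ts|.
    apply: ler_piMr; first by rewrite mulr_ge0// ltW.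
    by rewrite ler_norml sin_geN1 sin_le1.
  lra.
- rewrite sE; lra.
Qed.

(** The parameters of the concentrating profile, [sg] being the time to the
    focus in units of [eps]. *)
Definition qpar sg : par R := ((Num.sqrt sg)^-1, - sg^-1, sg^-1).

Lemma vtilde_wave eps sg t : 0 < eps -> 0 < sg -> t = focus eps - sg * eps ->
  vtilde ts eps t = wave eps (qpar sg).
Proof.
move=> e0 s0 tE; have T : pi / 2 + eps * ts - t = sg * eps by rewrite tE /focus; ring.
have T' : t - (pi / 2 + eps * ts) = - (sg * eps) by rewrite tE /focus; ring.
apply/funext => x; rewrite /vtilde /wave /dil /prof /phase /amp /am /ch /ph /=.
rewrite T T' sqrtrM ?(ltW s0)// exprVn sqr_sqrtr ?(ltW s0)//.
have se : 0 < Num.sqrt eps by rewrite sqrtr_gt0.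
have ss : 0 < Num.sqrt sg by rewrite sqrtr_gt0.
have -> : x / (sg * eps) = sg^-1 * (x / eps) by field; rewrite !gt_eqF.
have -> : eps / (sg * eps) = sg^-1 by field; rewrite !gt_eqF.
have -> : sg^-1 + - sg^-1 * (x / eps) ^+ 2 / 2 = sg^-1 + x ^+ 2 / (2 * eps * - (sg * eps)).
  by field; rewrite !gt_eqF.
set a := sg^-1; set b := x ^+ 2 / _.
rewrite cosD sinD; apply/eqP; rewrite eq_complex /=; apply/andP; split; apply/eqP; rewrite invfM; ring.
Qed.

(** The parameters are singular where the width vanishes; as [sg] stays away from
    0, an error O(eps) in the width, measured in units of [eps], remains O(eps) in
    the parameters. *)
Lemma par_close lam s1 : 0 < lam -> lam <= s1 -> exists m M B D e0 : R,
  [/\ 0 < m, m <= M, 0 <= B, 0 <= D & 0 < e0] /\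
  forall eps sg, 0 < eps <= e0 -> lam <= sg <= s1 -> let t := focus eps - sg * eps in
  [/\ eps <= 1, 0 <= t < blowup eps ts, box m M B (ppar eps ts t), box m M B (qpar sg) &
      pdist (ppar eps ts t) (qpar sg) <= D * eps].
Proof.
move=> l0 ls; have s10 : 0 < s1 by lra.
have t0 := normr_ge0 ts.
pose K := s1 + `|ts|; have K0 : 0 <= K by rewrite /K; lra.
have [D D0 hD] := width_close K0.
have [eb eb0 heb] := focus_blowup l0.
have l2 : 0 < lam / 2 by rewrite divr_gt0.
pose m : R := (Num.sqrt (s1 + 1))^-1; pose M : R := (Num.sqrt (lam / 2))^-1.
have sl : 0 < Num.sqrt (lam / 2) by rewrite sqrtr_gt0.
have ss : 0 < Num.sqrt (s1 + 1) by rewrite sqrtr_gt0; lra.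
have amb eta : lam / 2 <= eta <= s1 + 1 -> m <= (Num.sqrt eta)^-1 <= M.
  move=> /andP[h1 h2]; have e0 : 0 < Num.sqrt eta by rewrite sqrtr_gt0; lra.
  by rewrite /m /M !lef_pV2 ?posrE//; rewrite !ler_wsqrtr.
have inv eta : lam / 2 <= eta -> 0 < eta^-1 /\ eta^-1 <= 2 / lam.
  move=> h; have e0 : 0 < eta by lra.
  by rewrite invr_gt0 e0; split => //; rewrite -[2 / lam]invrK invf_div lef_pV2 ?posrE.
have dinv eta sg : lam / 2 <= eta -> lam <= sg -> `|eta^-1 - sg^-1| <= (2 / lam) ^+ 2 * `|eta - sg|.
  move=> h1 h2; have [i1 i2] := inv _ h1; have [|i3 i4] := inv sg; first by lra.
  have -> : eta^-1 - sg^-1 = (eta^-1 * sg^-1) * (sg - eta).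
    have n1 : eta != 0 by rewrite -invr_eq0 gt_eqF.
    have n2 : sg != 0 by rewrite -invr_eq0 gt_eqF.
    by field; rewrite n1 n2.
  rewrite normrM distrC ger0_norm ?mulr_ge0 ?(ltW i1) ?(ltW i3)//; apply: ler_wpM2r => //.
  by rewrite expr2; apply: ler_pM => //; exact: ltW.
have ll : 0 < 2 / lam by rewrite divr_gt0.
pose D' : R := (2 / lam) ^+ 2 * D.
have D'0 : 0 <= D' by rewrite mulr_ge0 ?sqr_ge0.
exists m, M, (2 * (2 / lam)), (D' * Num.sqrt (s1 + 1) + (D * (2 / lam) + D') + (D * (2 / lam) + D')).
pose e0 : R := Num.min (Num.min 1 eb) (Num.min (Num.min (D + 1)^-1 (lam / 2 / (D + 1))) (K + 1)^-1).
have D1 : 0 < D + 1 by lra.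
have K1 : 0 < K + 1 by lra.
exists e0; split.
  split => //; [by rewrite invr_gt0| | | | ].
  - have /andP[h1 h2] : m <= (Num.sqrt lam)^-1 <= M by apply: amb; apply/andP; split; lra.
    exact: le_trans h1 h2.
  - by rewrite mulr_ge0// ltW.
  - have k1 := mulr_ge0 D'0 (sqrtr_ge0 (s1 + 1)); have k2 := mulr_ge0 D0 (ltW ll).
    by rewrite !addr_ge0.
  - by rewrite /e0 !lt_min ltr01 eb0 !invr_gt0 D1 K1 divr_gt0.
move=> eps sg /andP[e0' hmin] /andP[sl1 ss1] t; move: hmin; rewrite /e0 !le_min => /andP[/andP[e1 e2] /andP[/andP[e3 e4] e5]].
have hK : `|sg - ts| <= K.
  by apply: le_trans (ler_normB _ _) _; rewrite gtr0_norm /K; lra.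
have [] := hD eps sg; [by rewrite e0'|by []|rewrite -/t].
(* the width in units of [eps], which is close to [sg] *)
set eta := width eps ts t / eps; move=> h1 h2 h3.
have De1 : D * eps <= 1.
  by move: e3; rewrite -[_^-1]mul1r ler_pdivlMr// => ?; have := mulr_ge0 D0 (ltW e0'); lra.
have De2 : D * eps <= lam / 2 by move: e4; rewrite ler_pdivlMr// => ?; lra.
have [et1 et2] : lam / 2 <= eta /\ eta <= s1 + 1.
  move: h1; clear -De1 De2 sl1 ss1; rewrite ler_norml => /andP[? ?]; split; lra.
have et0 : 0 < eta by lra.
have w0 : 0 < width eps ts t by rewrite -(pmulr_lgt0 _ (x := eps^-1)) ?invr_gt0.
have [i1 i2] := inv _ et1.
have etaV : eps / width eps ts t = eta^-1 by rewrite /eta invf_div.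
have amE : am (ppar eps ts t) = (Num.sqrt eta)^-1.
  by rewrite /ppar /am /= etaV sqrtrV// ltW.
have chE : ch (ppar eps ts t) = width1 eps ts t * eta^-1.
  by rewrite /ppar /ch /= -etaV; ring.
have phE : ph (ppar eps ts t) = sin t * eta^-1 by rewrite /ppar /ph /= -etaV; ring.
have w1b : `|width1 eps ts t| <= 2.
  have : `|width1 eps ts t| <= `|width1 eps ts t + 1| + 1.
    rewrite -[X in `|X| <= _](addrK 1); apply: le_trans (ler_normB _ _) _; by rewrite normr1.
  lra.
have tI : 0 <= t < blowup eps ts.
  apply/andP; split.
    have eK : eps * (K + 1) <= 1 by move: e5; rewrite -[_^-1]mul1r ler_pdivlMr.
    have eK2 : eps * (sg - ts) <= eps * K.
      by rewrite ler_pM2l//; apply: le_trans hK; exact: ler_norm.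
    have := @pi_ge2 R; rewrite /t /focus; lra.
  apply: le_lt_trans (heb eps _); last by rewrite e0'.
  by rewrite /t lerD2l lerN2 ler_pM2r.
have de := dinv eta sg et1 sl1.
have {}de : `|eta^-1 - sg^-1| <= D' * eps.
  by apply: le_trans de _; rewrite /D' -[leRHS]mulrA; apply: ler_wpM2l => //; exact: sqr_ge0.
have sb : lam / 2 <= sg <= s1 + 1 by clear -l0 sl1 ss1; apply/andP; split; lra.
have [i3 i4] : 0 < sg^-1 /\ sg^-1 <= 2 / lam by apply: inv; clear -l0 sl1; lra.
split => //.
- split; first by rewrite amE; apply: amb; rewrite et1.
  rewrite chE normrM (gtr0_norm i1); apply: ler_pM => //; exact: ltW.
- split; first exact: amb.
  by rewrite /qpar /ch/= normrN gtr0_norm//; clear -ll i4; lra.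
- rewrite /pdist amE chE phE /qpar /am /ch /ph /= opprK !(mulrDl _ _ eps).
  have er : 0 < Num.sqrt eta by rewrite sqrtr_gt0.
  have sr : 0 < Num.sqrt sg by rewrite sqrtr_gt0; clear -l0 sl1; lra.
  have k1 : `|(Num.sqrt eta)^-1 - (Num.sqrt sg)^-1| <= D' * Num.sqrt (s1 + 1) * eps.
    have -> : (Num.sqrt eta)^-1 - (Num.sqrt sg)^-1 =
        (eta^-1 - sg^-1) * ((Num.sqrt eta)^-1 + (Num.sqrt sg)^-1)^-1.
      rewrite -[in eta^-1](sqr_sqrtr (ltW et0)) -[in sg^-1](@sqr_sqrtr _ sg); last by clear -l0 sl1; lra.
      by field; rewrite !gt_eqF// addr_gt0.
    rewrite normrM mulrAC; apply: ler_pM => //.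
    rewrite ger0_norm ?invr_ge0 ?addr_ge0 ?invr_ge0 ?sqrtr_ge0//.
    rewrite -[leRHS]invrK lef_pV2 ?posrE ?invr_gt0 ?addr_gt0 ?invr_gt0//.
    have /andP[h _] : m <= (Num.sqrt eta)^-1 <= M by apply: amb; rewrite et1.
    apply: le_trans h _.
    by rewrite lerDl invr_ge0 ltW.
  have k2 (a b : R) : `|a - b| <= D * eps -> `|b| = 1 ->
      `|a * eta^-1 - b * sg^-1| <= D * (2 / lam) * eps + D' * eps.
    move=> hab b1.
    have -> : a * eta^-1 - b * sg^-1 = (a - b) * eta^-1 + b * (eta^-1 - sg^-1) by ring.
    apply: le_trans (ler_normD _ _) _; rewrite !normrM b1 mul1r (gtr0_norm i1); apply: lerD => //.
    by rewrite mulrAC; apply: ler_pM => //; exact: ltW.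
  apply: lerD; first apply: lerD => //.
    by have := k2 (width1 eps ts t) (- 1); rewrite opprK mulN1r opprK normrN normr1; apply.
  by have := k2 (sin t) 1; rewrite mul1r normr1; apply.
Qed.

End Concentration.

(** * The three operators, and lower bounds for the explicit solution *)

Section Norms.
Context {R : realType}.
Implicit Types (e eps t x : R) (F G : R -> R[i]) (p q : par R).

Local Notation mu := (@lebesgue_measure R).
Local Notation mfun f := (measurable_fun setT (f : R -> R)).

Lemma inSigc_ae F G G1 : inSigc G G1 -> mfun (re F) -> mfun (im F) ->
  {ae mu, forall x : R, F x = G x} -> inSigc F G1.
Proof.
move=> [[a1 a2 a3 a4] [b1 b2 b3 b4]] mr mi FG.
have er : {ae mu, forall x : R, re G x = re F x} by apply: aeS FG => x; rewrite /re => ->.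
have ei : {ae mu, forall x : R, im G x = im F x} by apply: aeS FG => x; rewrite /im => ->.
have mx (f : R -> R) : mfun f -> mfun (fun x => x * f x) by move=> mf; exact: measurable_funM.
split; split => //.
- exact: inL2_ae mr er a1.
- by apply: inL2_ae (mx _ mr) _ a3; apply: aeS er => x ->.
- by apply: (wder_ae mr (inL2_mfun a2) er _ a4); exact: aeW.
- exact: inL2_ae mi ei b1.
- by apply: inL2_ae (mx _ mi) _ b3; apply: aeS ei => x ->.
- by apply: (wder_ae mi (inL2_mfun b2) ei _ b4); exact: aeW.
Qed.

(** It dominates the L2 norm and splits into real and imaginary parts. *)
Definition nrm2 F : R := nrm (re F) + nrm (im F).

Lemma nrm2_ge0 F : 0 <= nrm2 F. Proof. by rewrite addr_ge0 ?nrm_ge0. Qed.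

(** All three operators are combinations, with bounded coefficients, of the
    identity, [eps] times the derivative, and the multiplication by
    [x / eps]. *)
Lemma operator_bound eps t (B : R -> R -> (R -> R[i]) -> (R -> R[i])) F G G1 : 0 < eps ->
  [\/ B = B_id, B = B_dx | B = B_J] -> inSigc G G1 -> mfun (re F) -> mfun (im F) ->
  {ae mu, forall x : R, F x = G x} ->
  (L2norm (B eps t F) <= (nrm2 G + (1 + `|t - pi / 2| / eps) * (eps * nrm2 G1) +
     eps^-1 * nrm2 (xmul G))%:E)%E.
Proof.
move=> e0 hB hG mr mi FG; have hF := inSigc_ae hG mr mi FG.
have [[f1 w1 x1 d1] [f2 w2 x2 d2]] := is_SigmaP (inSigc_is_Sigma hF).
have [e1 e2] := weak_deriv_ae (inSigc_weak_deriv hF).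
have [[g1 v1 y1 _] [g2 v2 y2 _]] := hG.
have er : {ae mu, forall x : R, re F x = re G x} by apply: aeS FG => x; rewrite /re => ->.
have ei : {ae mu, forall x : R, im F x = im G x} by apply: aeS FG => x; rewrite /im => ->.
have n0 : nrm (re F) = nrm (re G) by exact: nrm_ae (inL2_mfun g1) er.
have n0' : nrm (im F) = nrm (im G) by exact: nrm_ae (inL2_mfun g2) ei.
have n1 : nrm (re (weak_deriv F)) = nrm (re G1) by apply: nrm_ae e1; exact: inL2_mfun.
have n1' : nrm (im (weak_deriv F)) = nrm (im G1) by apply: nrm_ae e2; exact: inL2_mfun.
have n2 : nrm (fun x => x * re F x) = nrm (re (xmul G)).
  rewrite re_xmul; apply: nrm_ae; [exact: inL2_mfun|exact: inL2_mfun|].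
  by apply: aeS er => x ->.
have n2' : nrm (fun x => x * im F x) = nrm (im (xmul G)).
  rewrite im_xmul; apply: nrm_ae; [exact: inL2_mfun|exact: inL2_mfun|].
  by apply: aeS ei => x ->.
have ei0 : 0 < eps^-1 by rewrite invr_gt0.
have k0 := nrm2_ge0 G.
have k1 : 0 <= eps * nrm2 G1 by rewrite mulr_ge0 ?nrm2_ge0// ltW.
have k2 : 0 <= eps^-1 * nrm2 (xmul G) by rewrite mulr_ge0 ?nrm2_ge0// ltW.
pose T := `|t - pi / 2| / eps.
have T0 : 0 <= T by rewrite divr_ge0// ltW.
have Tk : 0 <= T * (eps * nrm2 G1) by rewrite mulr_ge0.
rewrite -/T (mulrDl 1) mul1r.
case: hB => ->.
- rewrite /B_id L2norm_inL2// lee_fin; apply: le_trans (nrmc_le F) _.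
  rewrite n0 n0' -/(nrm2 G); lra.
- have rE : re (B_dx eps t F) = fun x => eps * re (weak_deriv F) x.
    by apply/funext => x; rewrite /re re_realM.
  have iE : im (B_dx eps t F) = fun x => eps * im (weak_deriv F) x.
    by apply/funext => x; rewrite /im im_realM.
  rewrite L2norm_inL2; last by rewrite /inL2c rE iE; split; exact: inL2Z.
  rewrite lee_fin; apply: le_trans (nrmc_le _) _.
  rewrite rE iE !nrmZ// n1 n1' (gtr0_norm e0) -mulrDr -/(nrm2 G1); lra.
- have rE : re (B_J eps t F) = fun x => eps^-1 * (x * re F x) + - (t - pi / 2) * im (weak_deriv F) x.
    apply/funext => x; rewrite /B_J /re /im; case: (F x) => a b; case: (weak_deriv F x) => c d /=.
    by ring.
  have iE : im (B_J eps t F) = fun x => eps^-1 * (x * im F x) + (t - pi / 2) * re (weak_deriv F) x.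
    apply/funext => x; rewrite /B_J /re /im; case: (F x) => a b; case: (weak_deriv F x) => c d /=.
    by ring.
  have i1 := inL2Z eps^-1 x1; have i2 := inL2Z eps^-1 x2.
  have j1 := inL2Z (- (t - pi / 2)) w2; have j2 := inL2Z (t - pi / 2) w1.
  rewrite L2norm_inL2; last by rewrite /inL2c rE iE; split; exact: inL2D.
  rewrite lee_fin; apply: le_trans (nrmc_le _) _; rewrite rE iE.
  apply: le_trans (lerD (nrmD i1 j1) (nrmD i2 j2)) _.
  rewrite !nrmZ// n1 n1' n2 n2' normrN (gtr0_norm ei0).
  have -> : T * (eps * nrm2 G1) = `|t - pi / 2| * nrm2 G1 by rewrite /T mulrA divfK// gt_eqF.
  have -> : eps^-1 * nrm (re (xmul G)) + `|t - pi / 2| * nrm (im G1) +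
    (eps^-1 * nrm (im (xmul G)) + `|t - pi / 2| * nrm (re G1)) =
    eps^-1 * nrm2 (xmul G) + `|t - pi / 2| * nrm2 G1 by rewrite /nrm2; ring.
  lra.
Qed.

(** The scalings absorb the dilation, so that the constant does not depend on it. *)
Lemma wave_close m M B : 0 < m -> m <= M -> 0 <= B -> exists2 D : R, 0 <= D &
  forall e p q, 0 < e -> box m M B p -> box m M B q ->
  let G := fun x => wave e p x - wave e q x in
  let G1 := fun x => wave1 e p x - wave1 e q x in
  [/\ inSigc G G1, nrm2 G <= D * pdist p q, e * nrm2 G1 <= D * pdist p q &
      e^-1 * nrm2 (xmul G) <= D * pdist p q].
Proof.
move=> m0 mM B0.
have [i1 [D1 D10 h1]] := prof_lip m0 mM B0 osc_cos.
have [i2 [D2 D20 h2]] := prof_lip m0 mM B0 osc_sin.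
exists (D1 + D2); first by rewrite addr_ge0.
move=> e p q e0 bp bq G G1.
have am0 r : box m M B r -> 0 < am r by move=> [/andP[h _] _]; exact: lt_le_trans h.
have [a1 a2 a3] := h1 e p q e0 bp bq; have [b1 b2 b3] := h2 e p q e0 bp bq.
have [pc1 pc2 pc3] := i1 e p e0 bp; have [qc1 qc2 qc3] := i1 e q e0 bq.
have [ps1 ps2 ps3] := i2 e p e0 bp; have [qs1 qs2 qs3] := i2 e q e0 bq.
have ei : 0 < e^-1 by rewrite invr_gt0.
split; first by apply: inSigcB; apply: wave_inSigc => //; exact: am0.
- by rewrite /nrm2 re_sub im_sub mulrDl; exact: lerD.
- rewrite /nrm2 re_sub im_sub mulrDr mulrDl; apply: lerD.
    rewrite -[X in X * _](gtr0_norm e0) -nrmZ; last by apply: inL2B; exact: inL2Z.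
    apply: le_trans a2; rewrite le_eqVlt; apply/orP; left; apply/eqP; apply: nrm_eq => x.
    by rewrite /re /wave1 /=; field; rewrite gt_eqF.
  rewrite -[X in X * _](gtr0_norm e0) -nrmZ; last by apply: inL2B; exact: inL2Z.
  apply: le_trans b2; rewrite le_eqVlt; apply/orP; left; apply/eqP; apply: nrm_eq => x.
  by rewrite /im /wave1 /=; field; rewrite gt_eqF.
- rewrite /nrm2 re_xmul im_xmul re_sub im_sub mulrDr mulrDl; apply: lerD.
    apply: le_trans a3; rewrite -[X in X * _](gtr0_norm ei) -nrmZ.
      rewrite le_eqVlt; apply/orP; left; apply/eqP; apply: nrm_eq => x.
      by rewrite /re /wave /= mulrBr !dil_mulx//; field; rewrite gt_eqF.
    have := inL2Z e (inL2B pc3 qc3); congr inL2; apply/funext => x.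
    by rewrite mulrBr -!dil_mulx// -mulrBr.
  apply: le_trans b3; rewrite -[X in X * _](gtr0_norm ei) -nrmZ.
    rewrite le_eqVlt; apply/orP; left; apply/eqP; apply: nrm_eq => x.
    by rewrite /im /wave /= mulrBr !dil_mulx//; field; rewrite gt_eqF.
  have := inL2Z e (inL2B ps3 qs3); congr inL2; apply/funext => x.
  by rewrite mulrBr -!dil_mulx// -mulrBr.
Qed.

(** ** Lower bounds *)

Lemma int_ge_itv (f : R -> R) (a b k : R) : a <= b -> intg f -> (forall x, 0 <= f x) ->
  (forall x, a <= x <= b -> k <= f x) -> k * (b - a) <= \int[mu]_x f x.
Proof.
move=> ab fi f0 fk.
have mI : measurable (`[a, b] : set (measurableTypeR R)) by exact: measurable_itv.
have hm : fine (mu `[a, b]) = b - a.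
  have := lebesgue_measure_itv (`[a, b]%R : interval R); rewrite /= lte_fin => ->.
  by case: ltgtP ab => // -> _; rewrite subrr.
have -> : k * (b - a) = \int[mu]_(x in `[a, b]) k by rewrite Rintegral_cst// hm.
rewrite Rintegral_mkcond; apply: int_le => //.
  have ci : mu.-integrable `[a, b] (EFin \o (fun _ : R => k)).
    apply: continuous_compact_integrable; first exact: segment_compact.
    by apply: continuous_subspaceT => x; exact: cvg_cst.
  have [+ _] := @integrable_mkcond _ _ _ mu `[a, b] (EFin \o (fun _ : R => k)) (measurable_itv _).
  by move=> /(_ ci); rewrite /intg restrict_EFin.
move=> x; rewrite patchE; case: ifPn => [|_]; last exact: f0.
by rewrite inE/= in_itv/=; exact: fk.
Qed.

(** [R'] does not vanish on the interval from 1 to 2; this makes the kinetic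
    energy of a profile at least of the order of the fourth power of its
    amplitude. *)
Lemma Rsol1_away : exists2 c : R, 0 < c & forall z : R, 1 <= z <= 2 ->
  c <= (- Num.sqrt 2 * th z * Rsol z) ^+ 2.
Proof.
have cf : {within `[1, 2], continuous (fun z : R => (- Num.sqrt 2 * th z * Rsol z) ^+ 2)}.
  apply: continuous_subspaceT => z.
  have := derX 2 (der2_Rsol z); exact: der_continuous.
have [//|c cI hc] := EVT_min _ cf; first by rewrite ler1n.
exists ((- Num.sqrt 2 * th c * Rsol c) ^+ 2).
  have s0 : 0 < Num.sqrt 2 :> R by rewrite sqrtr_gt0.
  have th0 : 0 < th c.
    rewrite divr_gt0 ?cosh_gt0// divr_gt0// subr_gt0 ltr_expR.
    move: cI; rewrite in_itv/= => /andP[c1 _].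
    have : 0 < 2 * c * Num.sqrt 2 by rewrite !mulr_gt0// (lt_le_trans ltr01).
    lra.
  have nz : Num.sqrt 2 * th c * Rsol c != 0 by rewrite gt_eqF// mulr_gt0 ?Rsol_gt0// mulr_gt0.
  by rewrite !mulNr sqrrN lt_def sqr_ge0 expf_neq0.
by move=> z zI; apply: hc; rewrite in_itv.
Qed.

Lemma wave1_lower : exists2 c : R, 0 < c & forall e p, 0 < e -> 0 < am p ->
  c * am p ^+ 2 <= e * nrmc (wave1 e p).
Proof.
have [c c0 hc] := Rsol1_away.
exists (Num.sqrt c); first by rewrite sqrtr_gt0.
move=> e p e0 p0.
have [[_ i1 _ _] [_ i2 _ _]] := wave_inSigc e0 p0.
have k0 : 0 < am p ^+ 2 by rewrite exprn_gt0.
have s0 : 0 < Num.sqrt e by rewrite sqrtr_gt0.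
have j1 := inL2_sq (inL2Z e i1); have j2 := inL2_sq (inL2Z e i2).
rewrite -(@ler_pXn2r _ 2)// ?nnegrE ?mulr_ge0 ?sqrtr_ge0 ?nrmc_ge0 ?sqr_ge0// ?(ltW e0) ?(ltW p0)//.
rewrite (exprMn 2 (Num.sqrt c)) (exprMn 2 e) (sqr_sqrtr (ltW c0)) /nrmc sqr_sqrtr ?addr_ge0 ?sqr_ge0//.
have -> : e ^+ 2 * (nrm (re (wave1 e p)) ^+ 2 + nrm (im (wave1 e p)) ^+ 2) =
    \int[mu]_x ((e * re (wave1 e p) x) ^+ 2 + (e * im (wave1 e p) x) ^+ 2).
  rewrite (intD j1 j2) -(nrm_sq (fun x => e * re (wave1 e p) x)).
  rewrite -(nrm_sq (fun x => e * im (wave1 e p) x)) (nrmZ e i1) (nrmZ e i2) (gtr0_norm e0).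
  by rewrite (exprMn 2 e (nrm (re _))) (exprMn 2 e (nrm (im _))) mulrDr.
pose a := e / am p ^+ 2.
have a0 : 0 < a by rewrite divr_gt0.
have -> : c * (am p ^+ 2) ^+ 2 = (e^-1 * (am p ^+ 6 * c)) * (2 * a - a).
  by rewrite /a; field; rewrite !gt_eqF.
apply: int_ge_itv; [by lra|exact: intgD|by move=> x; rewrite addr_ge0 ?sqr_ge0|].
move=> x /andP[x1 x2].
have -> : (e * re (wave1 e p) x) ^+ 2 + (e * im (wave1 e p) x) ^+ 2 =
   e^-1 * (amp1 p (x / e) ^+ 2 + (amp p (x / e) * (ch p * (x / e))) ^+ 2) *
   (cos (phase p (x / e)) ^+ 2 + sin (phase p (x / e)) ^+ 2).
  rewrite /re /im /wave1 /= /dil /prof1; set X := x / e.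
  rewrite -[in RHS](sqr_sqrtr (ltW e0)); by field; rewrite !gt_eqF.
rewrite cos2Dsin2 mulr1; apply: ler_wpM2l; first by rewrite invr_ge0 ltW.
apply: (@le_trans _ _ (amp1 p (x / e) ^+ 2)); last by rewrite lerDl sqr_ge0.
rewrite /amp1 exprMn -exprM; apply: ler_wpM2l; first by rewrite exprn_ge0// ltW.
apply: hc; rewrite mulrA ler_pdivlMr// ler_pdivrMr// mul1r.
move: x1 x2; rewrite /a ler_pdivrMr// => x1 x2; rewrite mulrC x1/=.
by move: x2; rewrite mulrA ler_pdivlMr// mulrC.
Qed.

(** The modulus of a profile is continuous, so that its essential supremum is at
    least its value at the origin; half of that value is enough below. *)
Lemma wave_sup_lower F e p : 0 < e -> 0 < am p -> {ae mu, forall x : R, F x = wave e p x} ->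
  ((am p * Rsol 0 / 2)%:E <= Linftynorm (fun x => (Num.sqrt e)%:C * F x)%R)%E.
Proof.
move=> e0 p0 FG; have s0 : 0 < Num.sqrt e by rewrite sqrtr_gt0.
pose k := am p * Rsol 0 / 2.
have k0 : 0 < k by rewrite divr_gt0// mulr_gt0// Rsol_gt0.
have normE x : Normc.normc ((Num.sqrt e)%:C * wave e p x) = amp p (x / e).
  have a0 : 0 <= amp p (x / e) by rewrite mulr_ge0// ltW// Rsol_gt0.
  apply/eqP; rewrite -(@eqrXn2 _ 2)// ?normc_ge0//; apply/eqP.
  rewrite normc_sq re_realM im_realM /wave /= /dil /prof.
  transitivity (amp p (x / e) ^+ 2 * (cos (phase p (x / e)) ^+ 2 + sin (phase p (x / e)) ^+ 2)).
    by field; rewrite gt_eqF.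
  by rewrite cos2Dsin2 mulr1.
have muT : (0 < mu [set: R])%E.
  by have := lebesgue_measure_itv (`]-oo, +oo[%R : interval R); rewrite set_itvNyy /= => ->; exact: ltry.
rewrite /Linftynorm /Lpnorm unlock muT leNgt; apply/negP => hlt.
have hae : {ae mu, forall x : R, ~ (k < amp p (x / e))}.
  have /ess_supP h := ltW hlt.
  have h' : {ae mu, forall x : R, (`|Normc.normc ((Num.sqrt e)%:C * F x)|%:E <= k%:E)%E} := h.
  apply: aeS (aeI h' FG) => x [h1 h2]; move: h1.
  rewrite h2 normE lee_fin => h1; apply/negP; rewrite -leNgt; apply: le_trans h1; exact: ler_norm.
have c0 : {for 0, continuous (fun x => amp p (x / e))}.
  have -> : (fun x => amp p (x / e)) = (fun x => Num.sqrt e * dil e (amp p) x).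
    by apply/funext => x; rewrite /dil mulrA divff ?mul1r// gt_eqF.
  apply: cvgM; first exact: cvg_cst.
  by apply: continuous_dil; exact: continuous_amp.
have k2 : k < amp p (0 / e) by rewrite mul0r /amp mulr0; rewrite /k in k0 *; lra.
have [d /= d0 hd] : \forall x \near (0 : R), k < amp p (x / e) by have /cvgr_gt := c0; apply.
have : mu.-negligible (`]- d, d[ : set R).
  apply: negligibleS hae => x /=; rewrite in_itv/= => /andP[x1 x2]; move=> nQ; apply: nQ.
  by apply: hd => /=; rewrite sub0r normrN ltr_norml x1.
have mI : measurable (`]- d, d[ : set (measurableTypeR R)) by exact: measurable_itv.
move=> /(@measure_negligible _ _ _ mu _ mI).
have := lebesgue_measure_itv (`]- d, d[%R : interval R); rewrite /= lte_fin.
have -> : - d < d by lra.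
by move=> -> /eqP; rewrite -EFinB eqe; lra.
Qed.

End Norms.

(** * Limits *)

Section Limits.
Context {R : realType}.
Implicit Types (eps lam A : R).

Lemma near_right0 (P : R -> Prop) (e0 : R) : 0 < e0 ->
  (forall eps, 0 < eps <= e0 -> P eps) -> \forall eps \near 0^'+, P eps.
Proof.
move=> e00 h; apply: filterS2 (nbhs_right_gt (0 : R)) (nbhs_right_le e00) => eps h1 h2.
by apply: h; rewrite h1.
Qed.

Lemma limf_esup_le (f : R -> \bar R) (F : set_system R) (c : \bar R) :
  (\forall x \near F, f x <= c)%E -> (limf_esup f F <= c)%E.
Proof.
move=> h; rewrite limf_esupE; apply: (@le_trans _ _ (ereal_sup (f @` [set x | (f x <= c)%E]))).
  by apply: ereal_inf_lbound; exists [set x | (f x <= c)%E].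
by apply: ge_ereal_sup => _ [x hx <-].
Qed.

Lemma limf_esup_ge (f : R -> \bar R) (F : set_system R) (c : \bar R) : ProperFilter F ->
  (\forall x \near F, c <= f x)%E -> (c <= limf_esup f F)%E.
Proof.
move=> PF h; rewrite limf_esupE; apply: le_ereal_inf_tmp => _ [V FV <-].
have [x [Vx hx]] := filter_ex (filterI FV h).
by apply: le_trans hx _; apply: ereal_sup_ubound; exists x.
Qed.

Lemma limf_einf_ge (f : R -> \bar R) (F : set_system R) (c : \bar R) :
  (\forall x \near F, c <= f x)%E -> (c <= limf_einf f F)%E.
Proof.
move=> h; rewrite limf_einfE.
apply: (@le_trans _ _ (ereal_inf (f @` [set x | (c <= f x)%E]))).
  by apply: le_ereal_inf_tmp => _ [x hx <-].
by apply: ereal_sup_ubound; exists [set x | (c <= f x)%E].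
Qed.

Context (ts : R) (I : R -> set R) (u : R -> R -> R -> R[i])
  (hu : forall eps : R, 0 < eps <= 1 ->
     is_maximal_solution eps (init_data ts) (I eps) (u eps)).

Local Notation mu := (@lebesgue_measure R).

Lemma sol_wave eps t : 0 < eps <= 1 -> 0 <= t < blowup eps ts ->
  [/\ I eps t, measurable_fun setT (re (u eps t)), measurable_fun setT (im (u eps t)),
      {ae mu, forall x : R, u eps t x = wave eps (ppar eps ts t) x} & 0 < am (ppar eps ts t)].
Proof.
move=> e01 tI; have e0 : 0 < eps by case/andP: e01.
have mx := hu e01; have [h1 h2] := maximal_sol e0 mx.
have It := h1 t tI; split => //; last by apply: am_gt0 => //; exact: width_gt0.
- by have [[_ _ hc _ _] _] := mx; have [/is_SigmaP[[/inL2_mfun]]] := hc t It.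
- by have [[_ _ hc _ _] _] := mx; have [/is_SigmaP[_ [/inL2_mfun]]] := hc t It.
- exact: h2.
Qed.

Lemma existence_interval lam : 0 < lam -> \forall eps \near 0^'+,
  `[0, pi / 2 + eps * ts - lam * eps]%classic `<=` I eps.
Proof.
move=> l0; have [e0 e00 he] := focus_blowup ts l0.
apply: (@near_right0 _ (Num.min 1 e0)); first by rewrite lt_min ltr01.
move=> eps /andP[eps0]; rewrite le_min => /andP[e1 e2] t; rewrite /= in_itv/= => /andP[t0 tT].
have [] // := @sol_wave eps t; first by rewrite eps0.
rewrite t0/=; apply: le_lt_trans tT _; apply: he; by rewrite eps0.
Qed.

(** The profile [vtilde] approximates the solution on every interval of the
    rescaled time to the focus that stays away from 0: the limsup vanishes for
    each large [Lam], before any limit in [Lam] is taken. *)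
Lemma concentration lam (B : R -> R -> (R -> R[i]) -> (R -> R[i])) : 0 < lam ->
  [\/ B = B_id, B = B_dx | B = B_J] ->
  limf_esup (fun eps : R =>
    ereal_sup [set L2norm (B eps t (fun x => u eps t x - vtilde ts eps t x))
              | t in `[pi / 2 - Lam * eps, pi / 2 + eps * ts - lam * eps]%classic])
    0^'+ @[Lam --> +oo] --> 0%E.
Proof.
move=> l0 hB; apply: cvg_near_cst.
have : \forall Lam \near +oo, lam - ts <= Lam by apply: nbhs_pinfty_ge; exact: num_real.
apply: filterS => Lam hL; pose s1 := Lam + ts.
have ls : lam <= s1 by rewrite /s1; lra.
have [m [M [Bx [D [e0 [[m0 mM B0 D0 e00] hpar]]]]]] := par_close ts l0 ls.
have [D2 D20 hwave] := wave_close m0 mM B0.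
pose K := s1 + `|ts|; have K0 : 0 <= K by rewrite addr_ge0//; lra.
pose C := (3 + K) * D2 * D; have C0 : 0 <= C by rewrite !mulr_ge0// addr_ge0.
(* [sg] is the time to the focus in units of [eps]; it ranges over [lam, s1] *)
have key eps t : 0 < eps <= e0 -> pi / 2 - Lam * eps <= t <= pi / 2 + eps * ts - lam * eps ->
    (L2norm (B eps t (fun x => u eps t x - vtilde ts eps t x)%R) <= (C * eps)%:E)%E.
  move=> /andP[eps0 epse] /andP[t1 t2]; pose sg := (focus ts eps - t) / eps.
  have tE : t = focus ts eps - sg * eps by rewrite /sg divfK ?gt_eqF//; ring.
  have sgI : lam <= sg <= s1.
    by rewrite /sg ler_pdivlMr// ler_pdivrMr// /focus /s1; apply/andP; split; lra.
  have sg0 : 0 < sg by case/andP: sgI => h _; exact: lt_le_trans h.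
  have [|e1 tI bp bq dpq] := hpar eps sg _ sgI; first by rewrite eps0.
  rewrite -tE in tI bp dpq.
  have [|_ mr mi ae p0] := @sol_wave eps t _ tI; first by rewrite eps0.
  have [hG n0 n1 n2] := hwave eps _ _ eps0 bp bq.
  rewrite (vtilde_wave eps0 sg0 tE).
  have wS : inSigc (wave eps (qpar sg)) (wave1 eps (qpar sg)).
    by apply: wave_inSigc => //; case: bq => /andP[h _] _; exact: lt_le_trans h.
  have [[/inL2_mfun q1 _ _ _] [/inL2_mfun q2 _ _ _]] := wS.
  have mr' : measurable_fun setT (re (fun x => u eps t x - wave eps (qpar sg) x)).
    by rewrite re_sub; exact: measurable_funB.
  have mi' : measurable_fun setT (im (fun x => u eps t x - wave eps (qpar sg) x)).
    by rewrite im_sub; exact: measurable_funB.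
  have ae' : {ae mu, forall x : R, u eps t x - wave eps (qpar sg) x =
      wave eps (ppar eps ts t) x - wave eps (qpar sg) x} by apply: aeS ae => x ->.
  apply: le_trans (operator_bound t eps0 hB hG mr' mi' ae') _; rewrite lee_fin.
  have TK : `|t - pi / 2| / eps <= K.
    rewrite ler_pdivrMr// tE /focus.
    have -> : pi / 2 + eps * ts - sg * eps - pi / 2 = (ts - sg) * eps by ring.
    rewrite normrM (gtr0_norm eps0) ler_pM2r//; apply: le_trans (ler_normB _ _) _.
    by rewrite (gtr0_norm sg0) /K addrC lerD2r; case/andP: sgI.
  set T := _ / eps in TK *; set N1 := eps * _ in n1 *.
  have T0 : 0 <= T by rewrite divr_ge0// ltW.
  have d0 : 0 <= D2 * pdist (ppar eps ts t) (qpar sg) by rewrite mulr_ge0// pdist_ge0.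
  have n1' : (1 + T) * N1 <= (1 + K) * (D2 * pdist (ppar eps ts t) (qpar sg)).
    apply: (@le_trans _ _ ((1 + T) * (D2 * pdist (ppar eps ts t) (qpar sg)))).
      by apply: ler_wpM2l => //; rewrite addr_ge0.
    by apply: ler_wpM2r => //; rewrite lerD2l.
  apply: (@le_trans _ _ ((3 + K) * (D2 * pdist (ppar eps ts t) (qpar sg)))).
    move: n0 n1' n2; set a := nrm2 _; set b := eps^-1 * _; set c := D2 * _; set d := (1 + T) * _.
    clearbody a b c d; clear => *; lra.
  rewrite /C -!mulrA; apply: ler_wpM2l; first by rewrite addr_ge0.
  exact: ler_wpM2l.
apply/eqP; rewrite eq_le; apply/andP; split.
  apply/lee_addgt0Pr => d d0; rewrite add0e; apply: limf_esup_le.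
  have C1 : 0 < C + 1 by lra.
  apply: (@near_right0 _ (Num.min e0 (d / (C + 1)))); first by rewrite lt_min e00 divr_gt0.
  move=> eps /andP[eps0]; rewrite le_min ler_pdivlMr// => /andP[h1 h2].
  apply: ge_ereal_sup => _ [t + <-]; rewrite /= in_itv/= => tI.
  apply: le_trans (key eps t _ tI) _; first by rewrite eps0.
  rewrite lee_fin; lra.
(* the set of times contains its right end, so that the supremum is not -oo *)
apply: limf_esup_ge; apply: (@near_right0 _ 1) => // eps /andP[eps0 _].
pose t := pi / 2 + eps * ts - lam * eps.
apply: (@le_trans _ _ (L2norm (B eps t (fun x => u eps t x - vtilde ts eps t x)%R))).
  exact: Lnorm_ge0.
apply: ereal_sup_ubound; exists t => //; rewrite /= in_itv/= lexx andbT /t.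
have : lam * eps <= (Lam + ts) * eps by rewrite ler_pM2r.
by lra.
Qed.

(** The concentrating profile with [sg = lam] has amplitude [lam] to the power -1/2,
    and the amplitude of the solution is within O(eps) of it. *)
Lemma last_time lam : 0 < lam -> \forall eps \near 0^'+, let t := pi / 2 + eps * ts - lam * eps in
  [/\ 0 < eps <= 1, 0 <= t < blowup eps ts & (2 * Num.sqrt lam)^-1 <= am (ppar eps ts t)].
Proof.
move=> l0; have [m [M [Bx [D [e0 [[m0 mM B0 D0 e00] hpar]]]]]] := par_close ts l0 (lexx lam).
have s0 : 0 < Num.sqrt lam by rewrite sqrtr_gt0.
have D1 : 0 < D + 1 by lra.
apply: (@near_right0 _ (Num.min e0 ((2 * Num.sqrt lam)^-1 / (D + 1)))).
  by rewrite lt_min e00 divr_gt0// invr_gt0 mulr_gt0.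
move=> eps /andP[eps0]; rewrite le_min ler_pdivlMr// => /andP[h1 h2]; set t := pi / 2 + _ - _.
have [||e1 tI _ _ dpq] := hpar eps lam; rewrite ?eps0 ?lexx//.
split => //.
have : `|am (ppar eps ts t) - am (qpar lam)| <= D * eps.
  by apply: le_trans dpq; rewrite /pdist -addrA lerDl addr_ge0.
rewrite ler_norml /qpar {2}/am /= => /andP[h3 _].
have -> : (2 * Num.sqrt lam)^-1 = (Num.sqrt lam)^-1 - (2 * Num.sqrt lam)^-1.
  by field; rewrite gt_eqF.
move: h2 h3; set a := (2 * _)^-1; set b := am _; set c := (Num.sqrt lam)^-1.
clearbody a b c; clear -D0 eps0; nra.
Qed.

Lemma gradient_blowup :
  limf_einf (fun eps : R =>
    ereal_sup [set L2norm (fun x => eps%:C * weak_deriv (u eps t) x)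
              | t in `[0, pi / 2 + ts * eps - lam * eps]%classic])
    0^'+ @[lam --> 0^'+] --> +oo%E.
Proof.
apply/cvgeyPge => A; have [c c0 hc] := @wave1_lower R.
have A1 : 0 < `|A| + 1 by rewrite ltr_wpDl.
apply: (@near_right0 _ (c / (4 * (`|A| + 1)))); first by rewrite divr_gt0// mulr_gt0.
move=> lam /andP[l0]; rewrite ler_pdivlMr ?mulr_gt0// => lA.
apply: limf_einf_ge; apply: filterS (last_time l0) => eps [e01 tI hk].
have e0 : 0 < eps by case/andP: e01.
set t := pi / 2 + _ - _ in tI hk *.
have [_ mr mi ae p0] := sol_wave e01 tI.
have hS := inSigc_ae (wave_inSigc e0 p0) mr mi ae.
have [[_ w1 _ _] [_ w2 _ _]] := is_SigmaP (inSigc_is_Sigma hS).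
have [a1 a2] := weak_deriv_ae (inSigc_weak_deriv hS).
have [[_ v1 _ _] [_ v2 _ _]] := hS.
have [_ nE] := @inL2c_ae _ (weak_deriv (u eps t)) _ (inL2_mfun v1) (inL2_mfun v2) a1 a2 (conj w1 w2).
have rE : re (fun x => eps%:C * weak_deriv (u eps t) x) = fun x => eps * re (weak_deriv (u eps t)) x.
  by apply/funext => x; rewrite /re re_realM.
have iE : im (fun x => eps%:C * weak_deriv (u eps t) x) = fun x => eps * im (weak_deriv (u eps t)) x.
  by apply/funext => x; rewrite /im im_realM.
have nZ : L2norm (fun x => eps%:C * weak_deriv (u eps t) x) = (eps * nrmc (wave1 eps (ppar eps ts t)))%:E.
  rewrite L2norm_inL2; last by rewrite /inL2c rE iE; split; exact: inL2Z.
  rewrite -nE /nrmc rE iE (nrmZ eps w1) (nrmZ eps w2) (gtr0_norm e0).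
  rewrite (exprMn 2 eps (nrm (re _))) (exprMn 2 eps (nrm (im _))) -mulrDr.
  by rewrite sqrtrM ?sqr_ge0// sqrtr_sqr (gtr0_norm e0).
apply: (@le_trans _ _ (eps * nrmc (wave1 eps (ppar eps ts t)))%:E); last first.
  rewrite -nZ; apply: ereal_sup_ubound; exists t => //; rewrite /= in_itv/=.
  by case/andP: tI => -> _; rewrite (mulrC ts) lexx.
rewrite lee_fin; apply: le_trans (hc _ _ e0 p0).
have s0 : 0 < Num.sqrt lam by rewrite sqrtr_gt0.
have h4 : (4 * lam)^-1 <= am (ppar eps ts t) ^+ 2.
  have -> : (4 * lam)^-1 = (2 * Num.sqrt lam)^-1 ^+ 2.
    by rewrite exprVn exprMn (sqr_sqrtr (ltW l0)); congr (_^-1); ring.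
  by rewrite lerXn2r// ?nnegrE ?invr_ge0 ?mulr_ge0 ?(ltW s0) ?(ltW p0).
apply: le_trans (ler_wpM2l (ltW c0) h4); rewrite ler_pdivlMr ?mulr_gt0//.
apply: le_trans lA; rewrite mulrCA [leRHS]mulrCA; apply: ler_wpM2l => //.
rewrite mulrC; apply: ler_wpM2l; first exact: ltW.
by apply: le_trans (ler_norm A) _; rewrite lerDl.
Qed.

Lemma sup_blowup :
  limf_einf (fun eps : R =>
    ereal_sup [set Linftynorm (fun x => (Num.sqrt eps)%:C * u eps t x)
              | t in `[0, pi / 2 + ts * eps - lam * eps]%classic])
    0^'+ @[lam --> 0^'+] --> +oo%E.
Proof.
apply/cvgeyPge => A; have c0 : 0 < Rsol (0 : R) by exact: Rsol_gt0.
have A1 : 0 < `|A| + 1 by rewrite ltr_wpDl.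
pose k : R := Rsol 0 / (4 * (`|A| + 1)).
have k0 : 0 < k by rewrite divr_gt0// mulr_gt0.
apply: (@near_right0 _ (k ^+ 2)); first by rewrite exprn_gt0.
move=> lam /andP[l0 lk].
apply: limf_einf_ge; apply: filterS (last_time l0) => eps [e01 tI hk].
have e0 : 0 < eps by case/andP: e01.
set t := pi / 2 + _ - _ in tI hk *.
have [_ mr mi ae p0] := sol_wave e01 tI.
apply: (@le_trans _ _ (Linftynorm (fun x => (Num.sqrt eps)%:C * u eps t x)%R)); last first.
  apply: ereal_sup_ubound; exists t => //; rewrite /= in_itv/=.
  by case/andP: tI => -> _; rewrite (mulrC ts) lexx.
apply: le_trans (wave_sup_lower e0 p0 ae); rewrite lee_fin.
have s0 : 0 < Num.sqrt lam by rewrite sqrtr_gt0.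
have sk : Num.sqrt lam <= k by rewrite -(gtr0_norm k0) -sqrtr_sqr; exact: ler_wsqrtr.
have h5 : (2 * k)^-1 <= am (ppar eps ts t).
  have a1 : 0 < 2 * k by exact: mulr_gt0.
  have a2 : 0 < 2 * Num.sqrt lam by exact: mulr_gt0.
  by apply: le_trans hk; rewrite lef_pV2 ?posrE// ler_pM2l.
have -> : am (ppar eps ts t) * Rsol 0 / 2 = Rsol 0 / 2 * am (ppar eps ts t) by ring.
have r2 : 0 <= Rsol (0 : R) / 2 by rewrite divr_ge0// ltW.
apply: le_trans (ler_wpM2l r2 h5).
have -> : Rsol 0 / 2 * (2 * k)^-1 = `|A| + 1 by rewrite /k; field; rewrite !gt_eqF.
by apply: le_trans (ler_norm A) _; rewrite lerDl.
Qed.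

End Limits.

Local Open Scope complex_scope.
Local Open Scope ring_scope.
Theorem proposition1p5 (R : realType) (tstar : R)
    (I : R -> set R) (u : R -> R -> R -> R[i])
    (hu : forall eps : R, 0 < eps <= 1 ->
       is_maximal_solution eps (init_data tstar) (I eps) (u eps)) :
  (* R is the unique nonzero H^1 solution up to translation and sign *)
  [/\ ground_state_equation (@Rsol R),
      is_H1 (fun x : R => (Rsol x)%:C) &
      forall Q : R -> R, ground_state_equation Q ->
        is_H1 (fun x => (Q x)%:C) -> (exists x, Q x != 0) ->
        exists (s : bool) (x0 : R), forall x, Q x = (-1) ^+ s * Rsol (x - x0)]
  /\
  (* the times considered belong to the interval of existence *)
  (forall lam : R, 0 < lam ->
     \forall eps \near 0^'+,
       `[0, pi / 2 + eps * tstar - lam * eps]%classic `<=` I eps)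
  /\
  (forall lam : R, 0 < lam ->
     forall B : R -> R -> (R -> R[i]) -> (R -> R[i]),
     [\/ B = B_id, B = B_dx | B = B_J] ->
     limf_esup (fun eps : R =>
       ereal_sup [set L2norm (B eps t
                        (fun x => u eps t x - vtilde tstar eps t x))
                 | t in `[pi / 2 - Lam * eps,
                          pi / 2 + eps * tstar - lam * eps]%classic])
       0^'+ @[Lam --> +oo] --> 0%E)
  /\
  (limf_einf (fun eps : R =>
     ereal_sup [set L2norm (fun x => eps%:C * weak_deriv (u eps t) x)
               | t in `[0, pi / 2 + tstar * eps - lam * eps]%classic])
     0^'+ @[lam --> 0^'+] --> +oo%E)
  /\
  (limf_einf (fun eps : R =>
     ereal_sup [set Linftynorm (fun x => (Num.sqrt eps)%:C * u eps t x)
               | t in `[0, pi / 2 + tstar * eps - lam * eps]%classic])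
     0^'+ @[lam --> 0^'+] --> +oo%E).

Proof.
split; first split; [exact: Rsol_ground_state|exact: Rsol_is_H1|exact: ground_state_unique|].
split; first exact: existence_interval hu.
split; first by move=> lam l0 B hB; exact: concentration hu lam B l0 hB.
by split; [exact: gradient_blowup hu|exact: sup_blowup hu].
Qed.
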